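(* Let $B$ be a finite Blaschke product of degree $n$, $g\in H^\infty(\mathbb{D})$ and $0<p\le\infty$. The function $\Gamma(g)$ vanishes identically if and only if the closure of $\mathbb{C}[B,g]$ in $H^p$ does not contain a non-trivial (that is, different from $\{0\}$) $z$-invariant subspace.
   Context: $\mathbb{D}$ is the open unit disk, $H^p=H^p(\mathbb{D})$ the Hardy space, and $\mathbb{C}[B,g]$ the algebra of all polynomials in $B$ and $g$. The closure is taken in the $H^p$ norm if $p<\infty$, and with respect to bounded pointwise convergence if $p=\infty$ (a sequence converges boundedly pointwise if it is uniformly bounded on $\mathbb{D}$ and converges pointwise on $\mathbb{D}$; the closure is the smallest subset of $H^\infty$ containing the algebra and closed under limits of such sequences). A subspace $M\subset H^p$ is $z$-invariant if $zf\in M$ for all $f\in M$. The Blaschke product is $B(z)=\prod_{j=1}^n\frac{a_j-z}{1-\bar a_j z}$ with $a_1,\dots,a_n\in\mathbb{D}$, $n\ge 2$. For $z\in\mathbb{D}$ there are exactly $n$ points of $\mathbb{D}$, counted with multiplicity, at which $B$ takes the value $B(z)$; they are denoted $z=\varphi_0(z),\varphi_1(z),\dots,\varphi_{n-1}(z)$. For $f$ holomorphic in $\mathbb{D}$, $\Gamma(f)$ is the holomorphic function on $\mathbb{D}$ given at points with $B'(z)\ne0$ by $\Gamma(f)(z)=\prod_{j=1}^{n-1}\frac{f(z)-f(\varphi_j(z))}{z-\varphi_j(z)}$ (the remaining singularities are removable). *)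

(* Defs.v *)
From HB Require Import structures.
From mathcomp Require Import all_boot all_order all_algebra.
From mathcomp Require Import all_classical all_reals all_analysis.
From mathcomp Require Import polyXY complex.

Set Implicit Arguments.
Unset Strict Implicit.
Unset Printing Implicit Defensive.

Import Order.TTheory GRing.Theory Num.Theory.
Import numFieldNormedType.Exports.

Local Open Scope classical_set_scope.
Local Open Scope ring_scope.
Local Open Scope complex_scope.

(* Functions on the unit disk are total functions R[i] -> R[i] whose values
   off the disk are irrelevant: every notion below only reads values on it. *)

Section Defs.
Variable R : realType.
Local Notation C := (R[i]^o).
Implicit Types (f g h : C -> C) (z w : C) (p : \bar R).

(* The real-valued modulus; the library norm `|z| lives in R[i]. *)
Definition cabs z : R := ComplexField.Normc.normc z.

Definition disk : set C := [set z | cabs z < 1].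

(* derivable over the field R[i] is complex differentiability. *)
Definition holomorphic f : Prop := forall z, disk z -> derivable f z 1.

Definition circle_point (r t : R) : C := (r * cos t) +i* (r * sin t).

Definition hardy_mean (q r : R) f : \bar R :=
  ((2 * pi)^-1%:E * \int[lebesgue_measure]_(t in `[0%R, (2 * pi)%R])
     (cabs (f (circle_point r t)) `^ q)%:E)%E.

(* Used for 0 < p <= +oo only. *)
Definition hardy_norm p f : \bar R :=
  match p with
  | q%:E => ereal_sup [set poweR (hardy_mean q r f) q^-1 | r in `[0, 1[]
  | _ => ereal_sup [set (cabs (f z))%:E | z in disk]
  end.

Definition hardy p : set (C -> C) :=
  [set f | holomorphic f /\ (hardy_norm p f < +oo)%E].

Definition blaschke n (a : 'I_n -> C) : C -> C :=
  fun z => \prod_(j < n) ((a j - z) / (1 - (a j)^* * z)).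

Definition poly_algebra (b g : C -> C) : set (C -> C) :=
  [set h | exists P : {poly {poly R[i]}}, h = fun z => P.[g z, b z]].

Definition bp_cvg (u : nat -> C -> C) f : Prop :=
  (exists M : R, forall k z, disk z -> cabs (u k z) <= M) /\
  (forall z, disk z -> u k z @[k --> \oo] --> f z).

Definition bp_closed (S : set (C -> C)) : Prop :=
  S `<=` hardy +oo%E /\
  (forall u f, (forall k, S (u k)) -> hardy +oo%E f -> bp_cvg u f -> S f).

Definition hardy_closure p (A : set (C -> C)) : set (C -> C) :=
  match p with
  | +oo%E => smallest bp_closed A
  | _ => [set f | hardy p f /\
           forall e : R, 0 < e ->
             exists2 h, A h & (hardy_norm p (fun z => f z - h z)%R < e%:E)%E]
  end.

Definition z_invariant_subspace p (M : set (C -> C)) : Prop :=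
  [/\ M `<=` hardy p,
      M (fun=> 0),
      (forall f g, M f -> M g -> M (fun z => f z + g z)),
      (forall (c : C) f, M f -> M (fun z => c * f z)) &
      (forall f, M f -> M (fun z => z * f z))].

Definition nontrivial (M : set (C -> C)) : Prop :=
  exists2 f, M f & exists2 z, disk z & f z != 0.

Definition is_zero_order h w (k : nat) : Prop :=
  exists u : C -> C, [/\ holomorphic u, u w != 0 &
    forall x, disk x -> h x = (x - w) ^+ k * u x].

(* The multiplicity with which b takes the value b w at w. *)
Definition value_mult (b : C -> C) w : nat :=
  xget 0%N [set k | is_zero_order (fun x => b x - b w) w k].

Definition other_preimages (b : C -> C) z : set C :=
  [set w | [/\ disk w, b w = b z & w <> z]].

(* The product over phi_1(z), ..., phi_(n-1)(z): when b^`() z != 0 the point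
   phi_0(z) = z has multiplicity one, so these are the preimages of b z other
   than z itself, each repeated according to its multiplicity. *)
Definition Gamma_regular (b f : C -> C) z : C :=
  \big[*%R/1]_(w \in other_preimages b z)
     ((f z - f w) / (z - w)) ^+ value_mult b w.

(* The zeros of b^`() are isolated, and the value there is the one that removes
   the singularity. *)
Definition Gamma (b f : C -> C) z : C :=
  if (derive1 b z : C) != 0 then Gamma_regular b f z
  else lim (Gamma_regular b f w @[w --> z^']).

End Defs.

(* Main.v *)
Require Import Defs.
From mathcomp Require Import all_boot all_order all_algebra.
From mathcomp Require Import all_classical all_reals all_analysis.
From mathcomp Require Import complex qpoly zify ring lra.

Set Implicit Arguments.
Unset Strict Implicit.
Unset Printing Implicit Defensive.

Import Order.TTheory GRing.Theory Num.Theory.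
Import numFieldNormedType.Exports.

Local Open Scope classical_set_scope.
Local Open Scope ring_scope.
Local Open Scope complex_scope.

(** Why the theorem holds.

    Suppose that Gamma vanishes identically. At a point z with B'(z) <> 0 one
    factor of the product vanishes, so g takes the same value at z and at another
    point w of the fibre of B through z. Every polynomial in B and g then takes the
    same value at z and w, and so does every function of the closure, because point
    evaluations are continuous ([closure_agree]). If f lies in a z-invariant subspace
    of the closure, this applies to f and to the product of f by the coordinate, so
    z f(z) = w f(w) = w f(z) and f(z) = 0. As the critical points of B are isolated,
    f = 0.

    Conversely, let x run over the n points of the fibre of B through z. For a
    polynomial q, the product of the values q(x) is a rational function of B(z) with
    poles off the closed disk: factor q and evaluate the numerator of B - B(z) at its
    roots ([bpc_norm]). The product of the T - q(x) is a polynomial in T with such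
    coefficients, so T may be replaced by g(z) ([bpc_norm_sub]), and q by any bounded
    holomorphic u, which is a bounded pointwise limit of polynomials. Taking
    u = g - e p with p a polynomial, the factor x = z of the product of the
    g(z) - u(x) is e p(z); dividing by e and letting e tend to 0 shows that p Delta
    lies in the bounded pointwise closure ([bpc_Delta]), where Delta(z) is the
    product of the g(z) - g(x) over the other points of the fibre. The functions
    p Delta form a z-invariant subspace. It is non-trivial as soon as Gamma is not
    identically zero: Delta does not vanish where Gamma and B' do not.

    For finite p the invariant subspace must lie in the norm closure, although bounded
    pointwise convergence does not imply norm convergence. It implies weak
    convergence in the Hilbert space H^2, so averages converge in H^2 by the
    Banach-Saks argument ([banach_saks]) and, being bounded, in every H^p: the norm
    closure contains the bounded pointwise closure ([bp_closure_sub]).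

    The function theory needed for this is developed from complex differentiability
    alone: Goursat's theorem, Cauchy's formula, Taylor coefficients with Bessel's
    inequality, and the stability of holomorphy under bounded pointwise limits. Point
    evaluations on H^p with p < 1 ([point_evaluation]) are controlled by
    splitting |f| = |f|^p |f|^(1 - p) in the Cauchy estimate and absorbing the second
    factor in a weighted supremum. *)

(** * The modulus and complex differentiability *)

Arguments cabs : simpl never.

Section Modulus.
Variable R : realType.
Local Notation C := (R[i]^o).
Implicit Types (z w : C) (x : R).

Lemma normr_cabs z : `|z| = (cabs z)%:C. Proof. by []. Qed.

Lemma cabs_ge0 z : 0 <= cabs z.
Proof. by rewrite -(@lecR R) -normr_cabs normr_ge0. Qed.

Lemma cabsM z w : cabs (z * w) = cabs z * cabs w.
Proof. exact: ComplexField.Normc.normcM. Qed.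

Lemma cabs0 : cabs (0 : C) = 0.
Proof. exact: ComplexField.Normc.normc0. Qed.

Lemma cabs1 : cabs (1 : C) = 1.
Proof. exact: ComplexField.Normc.normc1. Qed.

Lemma cabs_eq0 z : (cabs z == 0) = (z == 0).
Proof.
apply/eqP/eqP => [|->]; last exact: cabs0.
exact: ComplexField.Normc.eq0_normc.
Qed.

Lemma cabs_gt0 z : (0 < cabs z) = (z != 0).
Proof. by rewrite lt_def cabs_ge0 andbT cabs_eq0. Qed.

Lemma cabsV z : cabs z^-1 = (cabs z)^-1.
Proof. exact: ComplexField.Normc.normcV. Qed.

Lemma cabsD z w : cabs (z + w) <= cabs z + cabs w.
Proof. by rewrite -(@lecR R) raddfD/= -!normr_cabs ler_normD. Qed.

Lemma cabsN z : cabs (- z) = cabs z.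
Proof. by apply: (@complexI R); rewrite -!normr_cabs normrN. Qed.

Lemma cabsB z w : cabs (z - w) <= cabs z + cabs w.
Proof. by rewrite -[cabs w]cabsN cabsD. Qed.

Lemma cabs_sym z w : cabs (z - w) = cabs (w - z).
Proof. by rewrite -cabsN opprB. Qed.

Lemma cabs_sub_ge z w : cabs z - cabs w <= cabs (z - w).
Proof. by rewrite lerBlDr -{1}(subrK w z) cabsD. Qed.

Lemma cabsX z k : cabs (z ^+ k) = cabs z ^+ k.
Proof. by elim: k => [|k IH]; rewrite ?expr0 ?cabs1 // !exprS cabsM IH. Qed.

Lemma cabs_real x : cabs (x%:C : C) = `|x|.
Proof. by rewrite /cabs /ComplexField.Normc.normc /= expr0n addr0 sqrtr_sqr. Qed.

Lemma cabs_sqr z : cabs z ^+ 2 = complex.Re z ^+ 2 + complex.Im z ^+ 2.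
Proof. by case: z => a b; rewrite /cabs sqr_sqrtr // addr_ge0 ?sqr_ge0. Qed.

Lemma cabs_conj z : cabs (z^*)%C = cabs z.
Proof. by case: z => a b; rewrite /cabs /= sqrrN. Qed.

Lemma mulc_conj z : z * (z^*)%C = ((cabs z ^+ 2)%:C : C).
Proof.
case: z => a b; rewrite cabs_sqr /=; apply/eqP; rewrite eq_complex/=.
by apply/andP; split; apply/eqP; ring.
Qed.

Lemma absRe_cabs z : `|complex.Re z| <= cabs z.
Proof.
rewrite -(@ler_pXn2r _ 2) ?nnegrE ?cabs_ge0 // cabs_sqr real_normK ?num_real//.
by rewrite lerDl sqr_ge0.
Qed.

Lemma absIm_cabs z : `|complex.Im z| <= cabs z.
Proof.
rewrite -(@ler_pXn2r _ 2) ?nnegrE ?cabs_ge0 // cabs_sqr real_normK ?num_real//.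
by rewrite lerDr sqr_ge0.
Qed.

Lemma cabs_ReIm z : cabs z <= `|complex.Re z| + `|complex.Im z|.
Proof.
rewrite -(@ler_pXn2r _ 2) ?nnegrE ?cabs_ge0 ?addr_ge0 // cabs_sqr.
rewrite sqrrD !real_normK ?num_real// lerD2r lerDl.
by rewrite mulrn_wge0 ?mulr_ge0.
Qed.

Lemma creD z w : complex.Re (z + w) = complex.Re z + complex.Re w. Proof. by case: z; case: w. Qed.
Lemma cimD z w : complex.Im (z + w) = complex.Im z + complex.Im w. Proof. by case: z; case: w. Qed.
Lemma creN z : complex.Re (- z) = - complex.Re z. Proof. by case: z. Qed.
Lemma cimN z : complex.Im (- z) = - complex.Im z. Proof. by case: z. Qed.
Lemma creM z w : complex.Re (z * w) = complex.Re z * complex.Re w - complex.Im z * complex.Im w.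
Proof. by case: z; case: w. Qed.
Lemma cimM z w : complex.Im (z * w) = complex.Re z * complex.Im w + complex.Im z * complex.Re w.
Proof. by case: z; case: w. Qed.

Lemma complex_ext z w : complex.Re z = complex.Re w -> complex.Im z = complex.Im w -> z = w.
Proof. by case: z w => a b [c d] /= -> ->. Qed.

Lemma complexC_re x : complex.Re (x%:C : C) = x. Proof. by []. Qed.

Lemma disk0 : disk (0 : C).
Proof. by rewrite /disk /= cabs0. Qed.

End Modulus.

Section EpsilonDelta.
Variable R : realType.
Local Notation C := (R[i]^o).
Implicit Types (f g : C -> C) (z w d : C).

Lemma real_of_pos (e : R[i]) : 0 < e -> exists2 x : R, 0 < x & e = x%:C.
Proof.
rewrite ltcE /= => /andP[/eqP h1 h2]; exists (complex.Re e) => //.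
by case: e h1 h2 => a b /= ->.
Qed.

Lemma nbhsC_P z (P : C -> Prop) :
  nbhs z P <-> exists2 e : R, 0 < e & forall w, cabs (w - z) < e -> P w.
Proof.
split=> [/nbhs_ballP[e /real_of_pos[x x0 ->]] h|[e e0 h]].
  exists x => // w hw; apply: h; rewrite /ball /= -normrN opprB normr_cabs.
  by rewrite ltcR.
apply/nbhs_ballP; exists (e%:C) => /=; first by rewrite ltcR.
by move=> w; rewrite /ball /= -normrN opprB normr_cabs ltcR; apply: h.
Qed.

Lemma cvg_seqC_P (u : nat -> C) l :
  u k @[k --> \oo] --> l <->
  (forall e : R, 0 < e ->
     exists N, forall k, (N <= k)%N -> cabs (u k - l) <= e).
Proof.
split=> [h e e0|h].
  have /h [N _ hN] : nbhs l (fun w => cabs (w - l) < e).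
    by apply/nbhsC_P; exists e.
  by exists N => k /hN /ltW.
move=> P /nbhsC_P[e e0 he]; have [|N hN] := h (e / 2); first by rewrite divr_gt0.
exists N => // k /= /hN hk; apply: he; apply: le_lt_trans hk _.
by rewrite ltr_pdivrMr // ltr_pMr // ltr1n.
Qed.

(** The increment form of complex differentiability: unlike the difference
    quotient it needs no case distinction at the centre. *)
Definition cdiff f z d := forall e : R, 0 < e -> exists2 r : R, 0 < r &
  forall w, cabs (w - z) < r ->
    cabs (f w - f z - d * (w - z)) <= e * cabs (w - z).

Definition ccontinuous_at f z := forall e : R, 0 < e -> exists2 r : R, 0 < r &
  forall w, cabs (w - z) < r -> cabs (f w - f z) <= e.

Lemma nbhs_dnbhsC_P z (P : C -> Prop) :
  nbhs z^' P <-> exists2 e : R, 0 < e &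
    forall w, w != z -> cabs (w - z) < e -> P w.
Proof.
split=> [/nbhsC_P[e e0 h]|[e e0 h]].
  by exists e => // w wz /h; apply.
by apply/nbhsC_P; exists e => // w hw wz; apply: h.
Qed.

Lemma cvg_quotient_cdiff f z d :
  h^-1 *: (f (h + z) - f z) @[h --> (0 : C)^'] --> (d : C) <-> cdiff f z d.
Proof.
split=> [hd e e0|hd].
  have : nbhs d (fun w => cabs (w - d) < e) by apply/nbhsC_P; exists e.
  move=> /hd /nbhs_dnbhsC_P[r r0 hr]; exists r => // w hw.
  have [->|wz] := eqVneq w z; first by rewrite !subrr mulr0 subr0 cabs0 mulr0.
  have wz0 : w - z != 0 by rewrite subr_eq0.
  have := hr (w - z) wz0; rewrite /= subr0 subrK => /(_ hw) /ltW.
  rewrite -[_ *: _]/(_ * _) => h.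
  have -> : f w - f z - d * (w - z) =
    ((w - z)^-1 * (f w - f z) - d) * (w - z) by field.
  by rewrite cabsM ler_wpM2r // cabs_ge0.
move=> P /nbhsC_P[e e0 he].
have [|r r0 hr] := hd (e / 2); first by rewrite divr_gt0.
apply/nbhs_dnbhsC_P; exists r => // w w0; rewrite subr0 => hw.
apply: he; have := hr (w + z); rewrite addrK => /(_ hw).
rewrite -[_ *: _]/(_ * _) => h.
have -> : w^-1 * (f (w + z) - f z) - d = (f (w + z) - f z - d * w) / w by field.
have wp : 0 < cabs w by rewrite cabs_gt0.
rewrite cabsM cabsV ltr_pdivrMr //; apply: le_lt_trans h _.
by rewrite ltr_pM2r // ltr_pdivrMr // ltr_pMr // ltr1n.
Qed.

Lemma derivable_cdiff f z : derivable f z 1 <-> exists d, cdiff f z d.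
Proof.
have E : (fun h : C => h^-1 *: ((f \o shift z) (h *: (1 : C)) - f z)) =
         (fun h : C => h^-1 *: (f (h + z) - f z)).
  by apply/funext => h; rewrite /= -[_ *: 1]/(_ * _) mulr1.
split=> [h|[d /cvg_quotient_cdiff h]].
  exists (lim (h^-1 *: (f (h + z) - f z) @[h --> (0 : C)^'])).
  apply/cvg_quotient_cdiff; rewrite /derivable E in h; exact: h.
by apply/cvg_ex; exists d; rewrite E.
Qed.

Lemma holomorphic_cdiff f :
  holomorphic f <-> forall z, disk z -> exists d, cdiff f z d.
Proof. by split=> h z /h /derivable_cdiff. Qed.

Lemma cdiff_unique f z d1 d2 : cdiff f z d1 -> cdiff f z d2 -> d1 = d2.
Proof.
move=> h1 h2; apply/eqP; rewrite -subr_eq0 -cabs_eq0 eq_le cabs_ge0 andbT.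
apply/ler_addgt0Pr => e e0; rewrite add0r.
have e2 : 0 < e / 2 by rewrite divr_gt0.
have [r1 r10 k1] := h1 _ e2; have [r2 r20 k2] := h2 _ e2.
pose x := Num.min r1 r2 / 2.
have m0 : 0 < Num.min r1 r2 by rewrite lt_min r10.
have x0 : 0 < x by rewrite divr_gt0.
have xm : x < Num.min r1 r2 by rewrite ltr_pdivrMr // ltr_pMr // ltr1n.
move: xm; rewrite lt_min => /andP[x1 x2].
have E : cabs (x%:C : C) = x by rewrite cabs_real gtr0_norm.
have := k1 (z + x%:C); have := k2 (z + x%:C).
rewrite [z + _]addrC addrK E => /(_ x2) l2 /(_ x1) l1.
have : cabs ((d1 - d2) * x%:C) <= e * x.
  have -> : (d1 - d2) * x%:C = (f (x%:C + z) - f z - d2 * x%:C)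
     - (f (x%:C + z) - f z - d1 * x%:C) by ring.
  apply: le_trans (cabsB _ _) _; apply: le_trans (lerD l2 l1) _.
  by rewrite -mulrDl -splitr.
by rewrite cabsM E ler_pM2r.
Qed.

Lemma derive1_cdiff f z d : cdiff f z d -> derive1 f z = d.
Proof.
move=> h; rewrite /derive1; apply/cvg_lim; first exact: norm_hausdorff.
exact/cvg_quotient_cdiff.
Qed.

Lemma derive1P f z : derivable f z 1 -> cdiff f z (derive1 f z).
Proof. by move=> /derivable_cdiff[d hd]; rewrite (derive1_cdiff hd). Qed.

Lemma cdiff_continuous f z d : cdiff f z d -> ccontinuous_at f z.
Proof.
move=> h e e0; have [r r0 hr] := h 1 ltr01.
have c0 : 0 < 1 + cabs d by rewrite ltr_wpDr // cabs_ge0.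
exists (Num.min r (e / (1 + cabs d))); first by rewrite lt_min r0 divr_gt0.
move=> w; rewrite lt_min => /andP[/hr h1 h2].
have -> : f w - f z = (f w - f z - d * (w - z)) + d * (w - z) by ring.
apply: le_trans (cabsD _ _) _; apply: le_trans (lerD h1 (lexx _)) _.
by rewrite cabsM -mulrDl mulrC -ler_pdivlMr // ltW.
Qed.

Lemma cdiff_local f g z d (r : R) : 0 < r ->
  (forall w, cabs (w - z) < r -> f w = g w) -> cdiff f z d -> cdiff g z d.
Proof.
move=> r0 fg h e e0; have [s s0 hs] := h e e0.
exists (Num.min r s); first by rewrite lt_min r0.
move=> w; rewrite lt_min => /andP[wr ws].
by rewrite -!fg ?subrr ?cabs0 //; exact: hs.
Qed.

Lemma disk_ball z : disk z -> exists2 r : R, 0 < r &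
  forall w, cabs (w - z) < r -> disk w.
Proof.
move=> hz; exists (1 - cabs z); first by rewrite subr_gt0.
move=> w; rewrite ltrBrDr => h; apply: le_lt_trans h.
by rewrite -{1}(subrK z w) cabsD.
Qed.

Lemma cdiff_disk f g z d : disk z -> (forall w, disk w -> f w = g w) ->
  cdiff f z d -> cdiff g z d.
Proof.
move=> /disk_ball[r r0 hr] fg; apply: cdiff_local r0 _ => w /hr; exact: fg.
Qed.

Lemma holomorphic_eq f g : (forall w, disk w -> f w = g w) ->
  holomorphic f -> holomorphic g.
Proof.
move=> fg /holomorphic_cdiff hf; apply/holomorphic_cdiff => z hz.
by have [d hd] := hf z hz; exists d; apply: cdiff_disk hd.
Qed.

Lemma cdiff_is_derive f z d : cdiff f z d <-> is_derive z (1 : C) f d.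
Proof.
split=> [h|h]; last first.
  have hd : derivable f z 1 by apply: ex_derive.
  by have := derive1P hd; rewrite derive1E derive_val.
have hd : derivable f z 1 by apply/derivable_cdiff; exists d.
apply: DeriveDef => //; rewrite -derive1E; exact: derive1_cdiff.
Qed.

Lemma cdiffD f g z d1 d2 : cdiff f z d1 -> cdiff g z d2 ->
  cdiff (fun w => f w + g w) z (d1 + d2).
Proof. by move=> /cdiff_is_derive ? /cdiff_is_derive ?; apply/cdiff_is_derive. Qed.

Lemma cdiffM f g z d1 d2 : cdiff f z d1 -> cdiff g z d2 ->
  cdiff (fun w => f w * g w) z (f z * d2 + g z * d1).
Proof. by move=> /cdiff_is_derive ? /cdiff_is_derive ?; apply/cdiff_is_derive. Qed.

Lemma cdiff_cst (c : C) z : cdiff (fun=> c) z 0.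
Proof. by apply/cdiff_is_derive. Qed.

Lemma cdiff_id z : cdiff id z 1.
Proof. by apply/cdiff_is_derive. Qed.

Lemma cdiffV f z d : f z != 0 -> cdiff f z d ->
  cdiff (fun w => (f w)^-1) z (- (f z ^- 2 * d)).
Proof.
move=> fz /cdiff_is_derive h; apply/cdiff_is_derive.
have hd : derivable f z 1 by apply: ex_derive.
apply: DeriveDef; first exact: derivableV.
by rewrite deriveV // derive_val -[_ *: _]/(_ * _) mulNr.
Qed.

End EpsilonDelta.

(** * Real integrals of continuous functions *)

Section RealIntegral.
Variable R : realType.
Implicit Types (f g F : R -> R) (T t x : R).
Local Notation mu := (@lebesgue_measure R).

Lemma continuous_epsP f : continuous f <->
  forall t e, 0 < e -> exists2 r, 0 < r &
    forall s, `|s - t| < r -> `|f s - f t| <= e.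
Proof.
split=> [h t e e0|h t].
  have /cvgrPdist_le /(_ e e0) /nbhs_ballP[r r0 hr] := h t.
  exists r => // s hs; rewrite distrC; apply: hr.
  by rewrite /ball /= distrC.
apply/cvgrPdist_le => e e0; have [r r0 hr] := h t e e0.
apply/nbhs_ballP; exists r => // s; rewrite /ball /= distrC => /hr.
by rewrite distrC.
Qed.

Lemma is_derive_eps f t (d : R) : (forall e, 0 < e -> exists2 r, 0 < r &
    forall s, `|s - t| < r -> `|f s - f t - d * (s - t)| <= e * `|s - t|) ->
  is_derive t (1 : R) f d.
Proof.
move=> h.
have H : h^-1 *: ((f \o shift t) (h *: (1 : R)) - f t) @[h --> (0 : R)^'] --> (d : R).
  apply/cvgrPdist_le => e e0; have [r r0 hr] := h e e0.
  apply/nbhs_ballP; exists r => // s; rewrite /ball /= sub0r normrN => hs s0.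
  have := hr (s + t); rewrite addrK => /(_ hs); rewrite -[_%:A]/(s * 1) mulr1.
  rewrite -[_ *: _]/(_ * _) => k.
  have -> : d - s^-1 * (f (s + t) - f t) = - ((f (s + t) - f t - d * s) / s).
    by field.
  by rewrite normrN normrM normfV ler_pdivrMr // normr_gt0.
apply: DeriveDef; first by apply/cvg_ex; exists d.
by apply/cvg_lim => //; exact: norm_hausdorff.
Qed.

Lemma is_derive_epsP f t (d : R) : is_derive t (1 : R) f d ->
  forall e, 0 < e -> exists2 r, 0 < r &
    forall s, `|s - t| < r -> `|f s - f t - d * (s - t)| <= e * `|s - t|.
Proof.
move=> h e e0; have hd : derivable f t 1 by apply: ex_derive.
have H : h^-1 *: ((f \o shift t) (h *: (1 : R)) - f t) @[h --> (0 : R)^'] --> (d : R).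
  by have <- : 'D_1 f t = d by exact: derive_val.
move/cvgrPdist_le : H => /(_ e e0) /nbhs_ballP[r r0 hr].
exists r => // s hs; have [->|st] := eqVneq s t.
  by rewrite !subrr mulr0 subr0 normr0 mulr0.
have st0 : s - t != 0 by rewrite subr_eq0.
have := hr (s - t); rewrite /ball /= sub0r normrN => /(_ hs st0).
rewrite -[_%:A]/((s - t) * 1) mulr1 subrK -[_ *: _]/(_ * _) => k.
have -> : f s - f t - d * (s - t) = - (d - (s - t)^-1 * (f s - f t)) * (s - t).
  by field.
by rewrite normrM normrN ler_wpM2r.
Qed.

Lemma continuous_integrable f (a b : R) : continuous f ->
  mu.-integrable `[a, b] (EFin \o f).
Proof.
move=> cf; apply: continuous_compact_integrable; first exact: segment_compact.
by apply: continuous_subspaceT.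
Qed.

Definition rint T f := (\int[mu]_(t in `[0%R, T]) f t)%R.

Lemma rint_eq T f g : (forall t, 0 <= t <= T -> f t = g t) -> rint T f = rint T g.
Proof.
by move=> h; apply: eq_Rintegral => t; rewrite inE /= in_itv /= => /h.
Qed.

Lemma rintD T f g : continuous f -> continuous g ->
  rint T (fun t => f t + g t) = rint T f + rint T g.
Proof. by move=> cf cg; apply: RintegralD => //; exact: continuous_integrable. Qed.

Lemma rintZ T (c : R) f : continuous f ->
  rint T (fun t => c * f t) = c * rint T f.
Proof. by move=> cf; apply: RintegralZl => //; exact: continuous_integrable. Qed.

Lemma rintB T f g : continuous f -> continuous g ->
  rint T (fun t => f t - g t) = rint T f - rint T g.
Proof. by move=> cf cg; apply: RintegralB => //; exact: continuous_integrable. Qed.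

Lemma rint_le T f g : continuous f -> continuous g ->
  (forall t, 0 <= t <= T -> f t <= g t) -> rint T f <= rint T g.
Proof.
move=> cf cg h; by apply: le_Rintegral => //; exact: continuous_integrable.
Qed.

Lemma rint_cst T (c : R) : 0 <= T -> rint T (fun=> c) = c * T.
Proof.
move=> T0; rewrite /rint Rintegral_cst //= lebesgue_measure_itv /= lte_fin.
have [T1|] := ltP 0 T; first by rewrite sube0.
by move=> T1; have -> : T = 0 by apply/eqP; rewrite eq_le T0 T1.
Qed.

Lemma rint_FTC T f F : 0 < T -> continuous f ->
  (forall t, 0 <= t <= T -> is_derive t (1 : R) F (f t)) ->
  rint T f = F T - F 0.
Proof.
move=> T0 cf hF.
have cF t : 0 <= t <= T -> {for t, continuous F}.
  move=> /hF h; have hd : derivable F t 1 by apply: ex_derive.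
  by apply: differentiable_continuous; apply/derivable1_diffP.
rewrite /rint /Rintegral (@continuous_FTC2 R f F 0 T) //.
- by apply: continuous_subspaceT.
- split.
  + move=> t; rewrite in_itv /= => /andP[t0 t1].
    by have h := hF t; case: h => //; rewrite !ltW.
  + by apply: cvg_at_right_filter; apply: cF; rewrite lexx ltW.
  + by apply: cvg_at_left_filter; apply: cF; rewrite lexx ltW.
- move=> t; rewrite in_itv /= => /andP[t0 t1]; rewrite derive1E.
  by have h := hF t; apply: derive_val; apply: h; rewrite !ltW.
Qed.

Lemma antiderivative_ex f : continuous f ->
  exists F, forall t, 0 <= t -> is_derive t (1 : R) F (f t).
Proof.
move=> cf; exists (fun x => \int[mu]_(t in `[(-1)%R, x]) f t)%R => t t0.
have t1 : t < t + 1 by rewrite ltrDl.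
have := @continuous_FTC1 R f (BLeft (-1)) t (t + 1) t1.
rewrite /= => /(_ (continuous_integrable (-1) (t + 1) cf)).
have lt1 : (-1 : R) < t by rewrite (lt_le_trans _ t0) // ltrN10.
have lb : ((-1)%:E < t%:E)%E by rewrite lte_fin.
move=> /(_ lb (cf t)) [].
by move=> h1 h2; apply: DeriveDef => //; rewrite -derive1E.
Qed.

Lemma rint_halves f : continuous f ->
  rint 1 f = 2^-1 * rint 1 (fun t => f (t / 2)) +
             2^-1 * rint 1 (fun t => f ((1 + t) / 2)).
Proof.
move=> cf; have [F hF] := antiderivative_ex cf.
have c1 : continuous (fun t : R => t / 2) by move=> t; exact: mulrr_continuous.
have c2 : continuous (fun t : R => (1 + t) / 2).
  move=> t; apply: (@continuous_comp R R R (fun t => 1 + t) (fun t => t / 2)).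
    by apply: continuousD; [exact: cst_continuous | exact: cvg_id].
  exact: c1.
have cf1 : continuous (fun t => f (t / 2)).
  by move=> t; apply: continuous_comp; [exact: c1 | exact: cf].
have cf2 : continuous (fun t => f ((1 + t) / 2)).
  by move=> t; apply: continuous_comp; [exact: c2 | exact: cf].
have -> : rint 1 f = F 1 - F 0.
  by apply: rint_FTC => // t /andP[t0 _]; exact: hF.
have H : forall (a : R), 0 <= a -> continuous (fun t => f ((a + t) / 2)) ->
    rint 1 (fun t => f ((a + t) / 2)) = 2 * F ((a + 1) / 2) - 2 * F (a / 2).
  move=> a a0 ca.
  have -> : a / 2 = (a + 0) / 2 by rewrite addr0.
  apply: (@rint_FTC _ _ (fun t => 2 * F ((a + t) / 2))) => // t /andP[t0 _].
  have h : is_derive ((a + t) / 2) (1 : R) F (f ((a + t) / 2)).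
    by apply: hF; rewrite divr_ge0 // addr_ge0.
  apply: is_derive_eps => e e0; have [r r0 hr] := is_derive_epsP h e0.
  exists (2 * r); first by rewrite mulr_gt0.
  move=> s hs; have E : (a + s) / 2 - (a + t) / 2 = (s - t) / 2 by field.
  have := hr ((a + s) / 2); rewrite E normrM normfV (ger0_norm (ler0n _ _)).
  rewrite ltr_pdivrMr // mulrC => /(_ hs) k.
  have -> : 2 * F ((a + s) / 2) - 2 * F ((a + t) / 2) - f ((a + t) / 2) * (s - t)
    = 2 * (F ((a + s) / 2) - F ((a + t) / 2) - f ((a + t) / 2) * ((s - t) / 2)).
    by field.
  rewrite normrM (ger0_norm (ler0n _ _)).
  by move: k; set u := `|_|; set v := `|_|; move=> k; lra.
have -> : (fun t => f (t / 2)) = (fun t => f ((0 + t) / 2)).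
  by apply/funext => t; rewrite add0r.
rewrite !H //; last by rewrite (_ : (fun t => _) = (fun t => f (t / 2))) //;
  apply/funext => t; rewrite add0r.
have -> : (1 + 1) / 2 = 1 :> R by field.
by rewrite mul0r add0r; field.
Qed.

Lemma R_cauchy (x : nat -> R) :
  (forall e, 0 < e -> exists N, forall n m, (N <= n)%N -> (N <= m)%N ->
     `|x n - x m| <= e) ->
  exists l, forall e, 0 < e -> exists N, forall n, (N <= n)%N -> `|x n - l| <= e.
Proof.
move=> h; have cx : cvg (x @ \oo).
  apply/cauchy_cvgP/cauchy_ballP => e e0.
  have [|N hN] := h (e / 2); first by rewrite divr_gt0.
  exists (x @` [set n | (N <= n)%N], x @` [set n | (N <= n)%N]).
    by split; exists N => // n hn; exists n.
  move=> [_ _] /= [[n hn <-] [m hm <-]]; rewrite /ball /=.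
  by apply: le_lt_trans (hN _ _ hn hm) _; rewrite ltr_pdivrMr // ltr_pMr // ltr1n.
exists (lim (x @ \oo)) => e e0.
move/cvgrPdist_le : cx => /(_ e e0) [N _ hN].
by exists N => n hn; rewrite distrC; exact: hN.
Qed.

End RealIntegral.

(** * Complex curves and their integrals *)

Section Curves.
Variable R : realType.
Local Notation C := (R[i]^o).
Implicit Types (phi psi : R -> C) (f : C -> C) (T t : R).

(** Continuity of a curve is kept componentwise, since integrals of complex
    functions are taken componentwise. *)
Definition cc phi := continuous (fun t => complex.Re (phi t)) /\
                     continuous (fun t => complex.Im (phi t)).

Lemma cc_epsP phi : cc phi <->
  forall t e, 0 < e -> exists2 r, 0 < r &
    forall s, `|s - t| < r -> cabs (phi s - phi t) <= e.
Proof.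
split=> [[/continuous_epsP h1 /continuous_epsP h2] t e e0|h].
  have e2 : 0 < e / 2 by rewrite divr_gt0.
  have [r1 r10 k1] := h1 t _ e2; have [r2 r20 k2] := h2 t _ e2.
  exists (Num.min r1 r2); first by rewrite lt_min r10.
  move=> s; rewrite lt_min => /andP[/k1 l1 /k2 l2].
  apply: le_trans (cabs_ReIm _) _; rewrite creD cimD creN cimN.
  by apply: le_trans (lerD l1 l2) _; rewrite -splitr.
split; apply/continuous_epsP => t e e0; have [r r0 hr] := h t e e0;
  exists r => // s /hr.
- by rewrite -creN -creD; apply: le_trans; exact: absRe_cabs.
- by rewrite -cimN -cimD; apply: le_trans; exact: absIm_cabs.
Qed.

Lemma cc_cst (c : C) : cc (fun=> c).
Proof. by split; apply: cst_continuous. Qed.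

Lemma rcontD (f g : R -> R) : continuous f -> continuous g ->
  continuous (fun t => f t + g t).
Proof. by move=> cf cg t; apply: cvgD; [exact: cf|exact: cg]. Qed.

Lemma rcontM (f g : R -> R) : continuous f -> continuous g ->
  continuous (fun t => f t * g t).
Proof. by move=> cf cg t; apply: cvgM; [exact: cf|exact: cg]. Qed.

Lemma rcontB (f g : R -> R) : continuous f -> continuous g ->
  continuous (fun t => f t - g t).
Proof. by move=> cf cg t; apply: cvgB; [exact: cf|exact: cg]. Qed.

Lemma ccD phi psi : cc phi -> cc psi -> cc (fun t => phi t + psi t).
Proof.
move=> [a1 a2] [b1 b2]; split.
- rewrite (_ : (fun t => _) = (fun t => complex.Re (phi t) + complex.Re (psi t))).
    exact: rcontD.
  by apply/funext => t; rewrite creD.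
- rewrite (_ : (fun t => _) = (fun t => complex.Im (phi t) + complex.Im (psi t))).
    exact: rcontD.
  by apply/funext => t; rewrite cimD.
Qed.

Lemma ccM phi psi : cc phi -> cc psi -> cc (fun t => phi t * psi t).
Proof.
move=> [a1 a2] [b1 b2]; split.
- rewrite (_ : (fun t => _) = (fun t => complex.Re (phi t) * complex.Re (psi t)
     - complex.Im (phi t) * complex.Im (psi t))).
    by apply: rcontB; exact: rcontM.
  by apply/funext => t; rewrite creM.
- rewrite (_ : (fun t => _) = (fun t => complex.Re (phi t) * complex.Im (psi t)
     + complex.Im (phi t) * complex.Re (psi t))).
    by apply: rcontD; exact: rcontM.
  by apply/funext => t; rewrite cimM.
Qed.

Lemma ccZ (c : C) phi : cc phi -> cc (fun t => c * phi t).
Proof. by apply: ccM; exact: cc_cst. Qed.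

Lemma ccN phi : cc phi -> cc (fun t => - phi t).
Proof.
move=> h; rewrite (_ : (fun t => _) = (fun t => (-1) * phi t)); first exact: ccZ.
by apply/funext => t; rewrite mulN1r.
Qed.

Lemma ccB phi psi : cc phi -> cc psi -> cc (fun t => phi t - psi t).
Proof. by move=> h1 h2; apply: ccD => //; exact: ccN. Qed.

Lemma ccX phi k : cc phi -> cc (fun t => phi t ^+ k).
Proof.
move=> h; elim: k => [|k IH]; first by apply: cc_cst.
rewrite (_ : (fun t => _) = (fun t => phi t * phi t ^+ k)); first exact: ccM.
by apply/funext => t; rewrite exprS.
Qed.

Lemma cc_conj phi : cc phi -> cc (fun t => (phi t)^*).
Proof.
move=> /cc_epsP h; apply/cc_epsP => t e /(h t)[r r0 hr]; exists r => // s /hr.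
by rewrite -(cabs_conj (phi s - phi t)) rmorphB.
Qed.

Lemma cc_comp f phi : (forall t, ccontinuous_at f (phi t)) -> cc phi ->
  cc (fun t => f (phi t)).
Proof.
move=> hf /cc_epsP h; apply/cc_epsP => t e /(hf t)[r r0 hr].
have r2 : 0 < r / 2 by rewrite divr_gt0.
have [s s0 hs] := h t _ r2; exists s => // u /hs hu; apply: hr.
by apply: le_lt_trans hu _; rewrite ltr_pdivrMr // ltr_pMr // ltr1n.
Qed.

Lemma ccV phi : (forall t, phi t != 0) -> cc phi -> cc (fun t => (phi t)^-1).
Proof.
move=> h; apply: (@cc_comp (fun z : C => z^-1)) => t.
exact: (cdiff_continuous (cdiffV (f := id) (h t) (cdiff_id _))).
Qed.

Lemma cc_cabs phi : cc phi -> continuous (fun t => cabs (phi t)).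
Proof.
move=> /cc_epsP h; apply/continuous_epsP => t e /(h t)[r r0 hr].
exists r => // s /hr; apply: le_trans; rewrite ler_norml cabs_sub_ge andbT.
by rewrite lerNl opprB cabs_sym cabs_sub_ge.
Qed.

Lemma cc_real (u : R -> R) : continuous u -> cc (fun t => (u t)%:C).
Proof. by move=> h; split => //; apply: cst_continuous. Qed.

Definition cint T phi : C :=
  rint T (fun t => complex.Re (phi t)) +i* rint T (fun t => complex.Im (phi t)).

Lemma cint_eq T phi psi : (forall t, 0 <= t <= T -> phi t = psi t) ->
  cint T phi = cint T psi.
Proof. by move=> h; congr (_ +i* _); apply: rint_eq => t /h ->. Qed.

Lemma cintD T phi psi : cc phi -> cc psi ->
  cint T (fun t => phi t + psi t) = cint T phi + cint T psi.
Proof.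
move=> [a1 a2] [b1 b2]; apply: complex_ext; rewrite ?creD ?cimD /= -rintD //;
by apply: rint_eq => t _; rewrite ?creD ?cimD.
Qed.

Lemma cintZ T (c : C) phi : cc phi ->
  cint T (fun t => c * phi t) = c * cint T phi.
Proof.
move=> [a1 a2].
have cm (x : R) (u : R -> R) : continuous u -> continuous (fun t => x * u t).
  by move=> cu; apply: rcontM => //; exact: cst_continuous.
apply: complex_ext; rewrite ?creM ?cimM /= -!rintZ // -?rintB -?rintD; try exact: cm;
by apply: rint_eq => t _; rewrite ?creM ?cimM.
Qed.

Lemma cintN T phi : cc phi -> cint T (fun t => - phi t) = - cint T phi.
Proof.
move=> h; rewrite -mulN1r -cintZ //; apply: cint_eq => t _; by rewrite mulN1r.
Qed.

Lemma cintB T phi psi : cc phi -> cc psi ->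
  cint T (fun t => phi t - psi t) = cint T phi - cint T psi.
Proof. by move=> h1 h2; rewrite cintD ?cintN //; exact: ccN. Qed.

Lemma cint_cst T (c : C) : 0 <= T -> cint T (fun=> c) = c * T%:C.
Proof.
move=> T0; apply: complex_ext; rewrite ?creM ?cimM /= rint_cst //;
by rewrite mulr0 ?subr0 ?add0r.
Qed.

Lemma cint_conj T phi : cc phi -> cint T (fun t => (phi t)^*) = (cint T phi)^*.
Proof.
move=> [a1 a2]; apply: complex_ext => /=.
  by apply: rint_eq => t _; case: (phi t).
rewrite -mulN1r -rintZ //; apply: rint_eq => t _; rewrite mulN1r.
by case: (phi t).
Qed.

(** Rotating the integral onto the positive real axis reduces the triangle
    inequality for integrals to the estimate of a real part. *)
Lemma cint_norm T phi : cc phi ->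
  cabs (cint T phi) <= rint T (fun t => cabs (phi t)).
Proof.
move=> h; set I := cint T phi.
have [->|I0] := eqVneq I 0.
  by rewrite cabs0; apply: Rintegral_ge0 => t _; exact: cabs_ge0.
have Ip : 0 < cabs I by rewrite cabs_gt0.
rewrite -(ler_pM2l Ip) -expr2 -[X in X <= _]complexC_re -mulc_conj mulrC.
rewrite /I -cintZ // -/I /= -rintZ; last exact: cc_cabs.
apply: rint_le.
- by have [] := ccZ (I^*)%C h.
- by apply: rcontM; [exact: cst_continuous|exact: cc_cabs].
move=> t _; apply: le_trans (ler_norm _) _; apply: le_trans (absRe_cabs _) _.
by rewrite cabsM -[X in X * _]/(cabs (I^*)%C) cabs_conj.
Qed.

Lemma cint_bound T phi (M : R) : 0 <= T -> cc phi ->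
  (forall t, 0 <= t <= T -> cabs (phi t) <= M) -> cabs (cint T phi) <= M * T.
Proof.
move=> T0 h hM; apply: le_trans (cint_norm T h) _; rewrite -(rint_cst M T0).
by apply: rint_le => //; [exact: cc_cabs|apply: cst_continuous].
Qed.

(** Differentiability of a complex curve in its real parameter. *)
Definition rdiff phi t (d : C) := forall e : R, 0 < e -> exists2 r : R, 0 < r &
  forall s, `|s - t| < r ->
    cabs (phi s - phi t - d * (s - t)%:C) <= e * `|s - t|.

Lemma cint_FTC T phi psi : 0 < T -> cc psi ->
  (forall t, 0 <= t <= T -> rdiff phi t (psi t)) ->
  cint T psi = phi T - phi 0.
Proof.
move=> T0 [c1 c2] h; apply: complex_ext; rewrite ?creD ?cimD ?creN ?cimN /=.
- apply: (@rint_FTC R T _ (fun t => complex.Re (phi t))) => // t ht.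
  apply: is_derive_eps => e /(h t ht)[r r0 hr]; exists r => // s /hr.
  apply: le_trans; apply: le_trans (absRe_cabs _).
  by rewrite !creD !creN creM /= mulr0 subr0.
- apply: (@rint_FTC R T _ (fun t => complex.Im (phi t))) => // t ht.
  apply: is_derive_eps => e /(h t ht)[r r0 hr]; exists r => // s /hr.
  apply: le_trans; apply: le_trans (absIm_cabs _).
  by rewrite !cimD !cimN cimM /= mulr0 add0r.
Qed.

Lemma rdiff_comp f phi t d p : cdiff f (phi t) d -> rdiff phi t p ->
  rdiff (fun s => f (phi s)) t (d * p).
Proof.
move=> hf hp e e0.
pose k := 1 + cabs p; have k0 : 0 < k by rewrite ltr_wpDr // cabs_ge0.
pose k' := 1 + cabs d; have k'0 : 0 < k' by rewrite ltr_wpDr // cabs_ge0.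
have [|r1 r10 h1] := hf (e / 2 / k); first by rewrite !divr_gt0.
have [r2 r20 h2] := hp 1 ltr01.
have [|r3 r30 h3] := hp (e / 2 / k'); first by rewrite !divr_gt0.
exists (Num.min (Num.min r2 r3) (r1 / k)).
  by rewrite !lt_min r20 r30 divr_gt0.
move=> s; rewrite !lt_min => /andP[/andP[/h2 l2 /h3 l3] l1].
have B : cabs (phi s - phi t) <= k * `|s - t|.
  have -> : phi s - phi t = (phi s - phi t - p * (s - t)%:C) + p * (s - t)%:C.
    by ring.
  apply: le_trans (cabsD _ _) _; rewrite cabsM cabs_real.
  by apply: le_trans (lerD l2 (lexx _)) _; rewrite mulrDl.
have /h1 l4 : cabs (phi s - phi t) < r1.
  by apply: le_lt_trans B _; rewrite mulrC -ltr_pdivlMr.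
have -> : f (phi s) - f (phi t) - d * p * (s - t)%:C =
   (f (phi s) - f (phi t) - d * (phi s - phi t)) +
   d * (phi s - phi t - p * (s - t)%:C) by ring.
apply: le_trans (cabsD _ _) _; rewrite cabsM.
have X1 : e / 2 / k * cabs (phi s - phi t) <= e / 2 * `|s - t|.
  rewrite -mulrA ler_pM2l ?divr_gt0 // ler_pdivrMl //.
have X2 : cabs d * cabs (phi s - phi t - p * (s - t)%:C) <= e / 2 * `|s - t|.
  apply: (@le_trans _ _ (k' * (e / 2 / k' * `|s - t|))).
    by apply: ler_pM => //; rewrite ?cabs_ge0 // /k' lerDr.
  by rewrite mulrA mulrCA divff ?mulr1 // gt_eqF.
apply: le_trans (lerD (le_trans l4 X1) X2) _.
by rewrite -mulrDl -splitr.
Qed.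

Lemma C_cauchy (x : nat -> C) :
  (forall e, 0 < e -> exists N, forall n m, (N <= n)%N -> (N <= m)%N ->
     cabs (x n - x m) <= e) ->
  exists l : C, forall e, 0 < e -> exists N, forall n, (N <= n)%N ->
     cabs (x n - l) <= e.
Proof.
move=> h.
have [a ha] : exists a, forall e, 0 < e -> exists N, forall n, (N <= n)%N ->
    `|complex.Re (x n) - a| <= e.
  apply: R_cauchy => e /h[N hN]; exists N => n m hn hm.
  by rewrite -creN -creD; apply: le_trans (absRe_cabs _) _; exact: hN.
have [b hb] : exists b, forall e, 0 < e -> exists N, forall n, (N <= n)%N ->
    `|complex.Im (x n) - b| <= e.
  apply: R_cauchy => e /h[N hN]; exists N => n m hn hm.
  by rewrite -cimN -cimD; apply: le_trans (absIm_cabs _) _; exact: hN.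
exists (a +i* b) => e e0; have e2 : 0 < e / 2 by rewrite divr_gt0.
have [N1 h1] := ha _ e2; have [N2 h2] := hb _ e2.
exists (maxn N1 N2) => n; rewrite geq_max => /andP[/h1 l1 /h2 l2].
apply: le_trans (cabs_ReIm _) _; rewrite creD cimD creN cimN /=.
by apply: le_trans (lerD l1 l2) _; rewrite -splitr.
Qed.

End Curves.

(** * Integrals along segments and triangles *)

Section Segments.
Variable R : realType.
Local Notation C := (R[i]^o).
Implicit Types (f g : C -> C) (a b c z w : C).

(** The parametrisation of a segment is kept constant outside [0, 1], so that
    it never leaves the segment and integrands are continuous on the line. *)
Definition clamp (u : R) : R := Num.max 0 (Num.min 1 u).

Lemma clamp_id u : 0 <= u <= 1 -> clamp u = u.
Proof.
by case/andP=> h0 h1; rewrite /clamp (min_idPr h1) (max_idPr h0).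
Qed.

Lemma clamp_ge0 u : 0 <= clamp u.
Proof. by rewrite /clamp le_max lexx. Qed.

Lemma clamp_le1 u : clamp u <= 1.
Proof. by rewrite /clamp ge_max ler01 /= ge_min lexx. Qed.

Lemma clamp_continuous : continuous clamp.
Proof.
apply/continuous_epsP => t e e0; exists e => // s hs; apply: le_trans (ltW hs).
rewrite /clamp !maxEle !minEle.
case: (lerP 1 s) => h1; case: (lerP 1 t) => h2; rewrite ?ler01;
  case: (lerP 0 s) => h3; case: (lerP 0 t) => h4;
  rewrite ?subrr ?normr0 //; case: (ger0P (s - t)) => h5;
  rewrite ler_norml; apply/andP; split; lra.
Qed.

Definition sgm a b (u : R) : C := a + (clamp u)%:C * (b - a).

Lemma cc_sgm a b : cc (sgm a b).
Proof.
apply: ccD; first exact: cc_cst.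
apply: ccM; last exact: cc_cst.
by apply: cc_real; exact: clamp_continuous.
Qed.

Lemma cabs_sgm (rho : R) x a b u : cabs (a - x) <= rho -> cabs (b - x) <= rho ->
  cabs (sgm a b u - x) <= rho.
Proof.
move=> ha hb.
have -> : sgm a b u - x = (1 - clamp u)%:C * (a - x) + (clamp u)%:C * (b - x).
  by rewrite /sgm rmorphB /=; ring.
apply: le_trans (cabsD _ _) _; rewrite !cabsM !cabs_real.
rewrite (ger0_norm (clamp_ge0 u)) ger0_norm; last by rewrite subr_ge0 clamp_le1.
have -> : rho = (1 - clamp u) * rho + clamp u * rho by ring.
by apply: lerD; apply: ler_wpM2l; rewrite // ?subr_ge0 ?clamp_le1 ?clamp_ge0.
Qed.

Lemma disk_sgm a b u : disk a -> disk b -> disk (sgm a b u).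
Proof.
rewrite /disk /= => ha hb.
have : cabs (sgm a b u - 0) <= Num.max (cabs a) (cabs b).
  by apply: cabs_sgm; rewrite subr0 le_max lexx ?orbT.
by rewrite subr0 => /le_lt_trans; apply; rewrite gt_max ha.
Qed.

Definition dcontinuous f := forall z, disk z -> ccontinuous_at f z.

Lemma holomorphic_dcontinuous f : holomorphic f -> dcontinuous f.
Proof. by move=> /holomorphic_cdiff h z /h[d]; exact: cdiff_continuous. Qed.

Lemma cc_dcomp f phi : dcontinuous f -> (forall t, disk (phi t)) -> cc phi ->
  cc (fun t => f (phi t)).
Proof. by move=> hf h; apply: cc_comp => t; apply: hf. Qed.

(** The line integral of f along the segment from a to b. *)
Definition seg f a b : C := (b - a) * cint 1 (fun u => f (sgm a b u)).

Lemma seg_bound f a b (M : R) : dcontinuous f -> disk a -> disk b ->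
  (forall u, cabs (f (sgm a b u)) <= M) -> cabs (seg f a b) <= M * cabs (b - a).
Proof.
move=> cf ha hb h; rewrite cabsM mulrC ler_wpM2r ?cabs_ge0 //.
rewrite -[M]mulr1; apply: cint_bound => //.
by apply: cc_dcomp => // [u|]; [exact: disk_sgm|exact: cc_sgm].
Qed.

Lemma cc_seg f a b : dcontinuous f -> disk a -> disk b ->
  cc (fun u => f (sgm a b u)).
Proof. by move=> cf ha hb; apply: cc_dcomp => // [u|]; [exact: disk_sgm|exact: cc_sgm]. Qed.

Lemma segB f g a b : dcontinuous f -> dcontinuous g -> disk a -> disk b ->
  seg (fun z => f z - g z) a b = seg f a b - seg g a b.
Proof.
by move=> cf cg ha hb; rewrite /seg cintB ?mulrBr //; exact: cc_seg.
Qed.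

Lemma seg_affine (p d : C) a b :
  seg (fun z => p + d * z) a b = p * (b - a) + d * ((b ^+ 2 - a ^+ 2) / 2).
Proof.
pose F (u : R) : C := p * (b - a) * u%:C
  + d * (b - a) * (a * u%:C + (b - a) * (u%:C * u%:C) / 2).
have -> : seg (fun z => p + d * z) a b
   = cint 1 (fun u => (b - a) * (p + d * (sgm a b u))).
  rewrite cintZ //; apply: ccD; first exact: cc_cst.
  by apply: ccM; [exact: cc_cst|exact: cc_sgm].
rewrite (@cint_FTC R 1 F) // ?ltr01 //.
- by rewrite /F /= !rmorph1 !rmorph0; field.
- apply: ccZ; apply: ccD; first exact: cc_cst.
  by apply: ccM; [exact: cc_cst|exact: cc_sgm].
- move=> t ht e e0; pose k := 1 + cabs (d * (b - a) * (b - a) / 2).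
  have k0 : 0 < k by rewrite ltr_wpDr // cabs_ge0.
  exists (e / k); first by rewrite divr_gt0.
  move=> s hs; rewrite /F /sgm clamp_id //.
  have -> : p * (b - a) * s%:C + d * (b - a) * (a * s%:C + (b - a) * (s%:C * s%:C) / 2)
   - (p * (b - a) * t%:C + d * (b - a) * (a * t%:C + (b - a) * (t%:C * t%:C) / 2))
   - (b - a) * (p + d * (a + t%:C * (b - a))) * (s - t)%:C
    = (d * (b - a) * (b - a) / 2) * ((s - t)%:C * (s - t)%:C).
    by rewrite rmorphB /=; field.
  rewrite (cabsM (d * (b - a) * (b - a) / 2)) (cabsM (s - t)%:C) cabs_real.
  rewrite mulrA ler_wpM2r //.
  apply: (@le_trans _ _ (k * (e / k))); last first.
    by rewrite mulrCA divff ?mulr1 // gt_eqF.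
  apply: ler_pM; rewrite ?cabs_ge0 //; last exact: ltW.
  by rewrite /k lerDr.
Qed.

Lemma rint_flip (f : R -> R) : continuous f ->
  rint 1 (fun u => f (1 - u)) = rint 1 f.
Proof.
move=> cf; rewrite /rint (@Rintegration_by_substitution_onem R f 1) //.
- by rewrite /unstable.onem subrr.
- by rewrite ler01 lexx.
- exact: continuous_subspaceT.
Qed.

Lemma cint_halves (phi : R -> C) : cc phi ->
  cint 1 phi = 2^-1 * cint 1 (fun t => phi (t / 2)) +
               2^-1 * cint 1 (fun t => phi ((1 + t) / 2)).
Proof.
move=> [c1 c2].
have half x y : (2^-1 : C) * (x +i* y) = (2^-1 * x) +i* (2^-1 * y).
  have -> : (2^-1 : C) = (2^-1 : R)%:C by rewrite fmorphV /= rmorph_nat.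
  by apply: complex_ext; rewrite ?creM ?cimM /= mul0r ?subr0 ?addr0.
by rewrite /cint (rint_halves c1) (rint_halves c2) !half.
Qed.

Lemma cint_flip (phi : R -> C) : cc phi ->
  cint 1 (fun u => phi (1 - u)) = cint 1 phi.
Proof.
by move=> [c1 c2]; rewrite /cint -(rint_flip c1) -(rint_flip c2).
Qed.

Lemma seg_rev f a b : dcontinuous f -> disk a -> disk b ->
  seg f b a = - seg f a b.
Proof.
move=> cf ha hb; rewrite /seg -mulNr opprB; congr (_ * _).
rewrite -cint_flip; last exact: cc_seg.
apply: cint_eq => u /andP[u0 u1]; congr (f _).
rewrite /sgm !clamp_id ?u0 ?u1 ?subr_ge0 ?lerBlDr ?lerDl ?u0 ?u1 //.
by rewrite rmorphB /= rmorph1; ring.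
Qed.

Definition mid a b : C := (a + b) / 2.

Lemma cabs_mid (rho : R) x a b : cabs (a - x) <= rho -> cabs (b - x) <= rho ->
  cabs (mid a b - x) <= rho.
Proof.
have -> : mid a b = sgm a b (2^-1).
  rewrite /sgm clamp_id; last by rewrite invr_ge0 ler0n invf_le1 ?ler1n.
  by rewrite fmorphV /= rmorph_nat /mid; field.
exact: cabs_sgm.
Qed.

Lemma disk_mid a b : disk a -> disk b -> disk (mid a b).
Proof.
rewrite /disk /= => ha hb.
have : cabs (mid a b - 0) <= Num.max (cabs a) (cabs b).
  by apply: cabs_mid; rewrite subr0 le_max lexx ?orbT.
by rewrite subr0 => /le_lt_trans; apply; rewrite gt_max ha.
Qed.

Lemma seg_mid f a b : dcontinuous f -> disk a -> disk b ->
  seg f a b = seg f a (mid a b) + seg f (mid a b) b.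
Proof.
move=> cf ha hb; rewrite /seg cint_halves; last exact: cc_seg.
rewrite mulrDr !mulrA; congr (_ * _ + _ * _).
- by rewrite /mid; field.
- apply: cint_eq => u /andP[u0 u1]; congr (f _).
  rewrite /sgm !clamp_id ?u0 ?u1 ?divr_ge0 ?ler_pdivrMr //=.
    by rewrite rmorphM /= fmorphV /= rmorph_nat /mid; field.
  by rewrite mul1r (le_trans u1) // ler1n.
- by rewrite /mid; field.
- apply: cint_eq => u /andP[u0 u1]; congr (f _).
  rewrite /sgm !clamp_id ?u0 ?u1 //.
    by rewrite rmorphM rmorphD rmorph1 /= fmorphV /= rmorph_nat /mid; field.
  rewrite divr_ge0 ?addr_ge0 //= ler_pdivrMr // mul1r.
  by rewrite [X in _ <= X](_ : _ = 1 + 1) // lerD2l.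
Qed.

Definition tri f a b c : C := seg f a b + seg f b c + seg f c a.

Definition per a b c : R := cabs (b - a) + cabs (c - b) + cabs (a - c).

Lemma per_ge0 a b c : 0 <= per a b c.
Proof. by rewrite !addr_ge0 ?cabs_ge0. Qed.

Lemma tri_subdivision f a b c : dcontinuous f -> disk a -> disk b -> disk c ->
  tri f a b c = tri f a (mid a b) (mid c a) + tri f (mid a b) b (mid b c) +
    tri f (mid c a) (mid b c) c + tri f (mid a b) (mid b c) (mid c a).
Proof.
move=> cf ha hb hc; rewrite /tri (seg_mid cf ha hb) (seg_mid cf hb hc) (seg_mid cf hc ha).
have hab := disk_mid ha hb; have hbc := disk_mid hb hc; have hca := disk_mid hc ha.
rewrite (seg_rev cf hab hca) (seg_rev cf hab hbc) (seg_rev cf hbc hca).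
ring.
Qed.

Lemma triB f g a b c : dcontinuous f -> dcontinuous g ->
  disk a -> disk b -> disk c ->
  tri (fun z => f z - g z) a b c = tri f a b c - tri g a b c.
Proof. by move=> cf cg ha hb hc; rewrite /tri !segB //; ring. Qed.

Lemma tri_affine (p d : C) a b c : tri (fun z => p + d * z) a b c = 0.
Proof. by rewrite /tri !seg_affine; field. Qed.

Lemma per_half a b c :
  [/\ per a (mid a b) (mid c a) = per a b c / 2,
      per (mid a b) b (mid b c) = per a b c / 2,
      per (mid c a) (mid b c) c = per a b c / 2 &
      per (mid a b) (mid b c) (mid c a) = per a b c / 2].
Proof.
have H (x y x' y' : C) : x - y = (x' - y') / 2 -> cabs (x - y) = cabs (x' - y') / 2.
  by move=> ->; rewrite cabsM -[2]/(2%:R) -(rmorph_nat (real_complex R)) cabsV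
    cabs_real normr_nat.
have H' (x y x' y' : C) : x - y = (x' - y') / 2 -> cabs (x - y) = cabs (y' - x') / 2.
  by move=> /H ->; rewrite cabs_sym.
rewrite /per; split.
- rewrite (H (mid a b) a b a) ?(H (mid c a) (mid a b) c b) ?(H a (mid c a) a c);
    rewrite /mid; by field.
- rewrite (H b (mid a b) b a) ?(H (mid b c) b c b) ?(H (mid a b) (mid b c) a c);
    rewrite /mid; by field.
- rewrite (H (mid b c) (mid c a) b a) ?(H c (mid b c) c b) ?(H (mid c a) c a c);
    rewrite /mid; by field.
- rewrite (H' (mid b c) (mid a b) c a) ?(H' (mid c a) (mid b c) a b)
    ?(H' (mid a b) (mid c a) b c); rewrite /mid; by field.
Qed.

End Segments.

(** * Goursat's theorem and primitives *)

Section Goursat.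
Variable R : realType.
Local Notation C := (R[i]^o).
Implicit Types (f g : C -> C) (a b c z w : C).

Lemma geometric_small (q K e : R) : 0 <= q < 1 -> 0 < e ->
  exists N, forall n, (N <= n)%N -> K * q ^+ n <= e.
Proof.
move=> /andP[q0 q1] e0; have : (geometric K q) @ \oo --> 0.
  by apply: cvg_geometric; rewrite ger0_norm.
move=> /cvgrPdist_le /(_ e e0) [N _ hN]; exists N => n /hN /=.
by rewrite sub0r normrN; apply: le_trans; exact: ler_norm.
Qed.

(** If the bound failed, it would fail with the same constant on one of the
    four half-size triangles, hence on triangles shrinking to a point of the
    disk; near that point the function is affine up to an error that is small
    against the perimeter, and affine functions have integral zero. *)
Lemma tri_small f a b c (e : R) : holomorphic f ->
  disk a -> disk b -> disk c -> 0 < e ->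
  cabs (tri f a b c) <= e * per a b c ^+ 2.
Proof.
move=> hf ha hb hc e0; rewrite leNgt; apply/negP => bad.
have cf := holomorphic_dcontinuous hf.
pose T := (C * C * C)%type.
pose rho := Num.max (cabs a) (Num.max (cabs b) (cabs c)).
have rho1 : rho < 1 by rewrite /rho !gt_max ha hb hc.
pose inv (t : T) := [/\ cabs t.1.1 <= rho, cabs t.1.2 <= rho, cabs t.2 <= rho &
  e * per t.1.1 t.1.2 t.2 ^+ 2 < cabs (tri f t.1.1 t.1.2 t.2)].
pose P (t : T) := per t.1.1 t.1.2 t.2.
have step : forall t : T, exists t' : T, inv t ->
    [/\ inv t', P t' = P t / 2 & cabs (t'.1.1 - t.1.1) <= P t].
  move=> [[x y] z]; have [|nh] := pselect (inv (x, y, z)); last by exists (x, y, z).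
  rewrite /inv /P /= => -[hx hy hz hbad].
  have [dx [dy dz]] : disk x /\ (disk y /\ disk z).
    by split; [|split]; apply: le_lt_trans rho1.
  have M (u v : C) : cabs u <= rho -> cabs v <= rho -> cabs (mid u v) <= rho.
    move=> hu hv; have := @cabs_mid R rho 0 u v; rewrite !subr0; exact.
  have Mx := M _ _ hx hy; have My := M _ _ hy hz; have Mz := M _ _ hz hx.
  have [p1 p2 p3 p4] := per_half x y z.
  have p0 := per_ge0 x y z.
  have HM (u v : C) : cabs (mid u v - u) = cabs (v - u) / 2.
    have -> : mid u v - u = (v - u) / 2 by rewrite /mid; field.
    by rewrite cabsM cabsV -(rmorph_nat (real_complex R)) cabs_real normr_nat.
  have HM' (u v : C) : cabs (mid v u - u) = cabs (v - u) / 2.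
    by rewrite (_ : mid v u = mid u v) // /mid addrC.
  have L1 : cabs (mid x y - x) <= per x y z.
    rewrite HM /per; have := cabs_ge0 (y - x); have := cabs_ge0 (z - y).
    by have := cabs_ge0 (x - z); lra.
  have L2 : cabs (mid z x - x) <= per x y z.
    rewrite HM' /per (cabs_sym z x); have := cabs_ge0 (y - x).
    by have := cabs_ge0 (z - y); have := cabs_ge0 (x - z); lra.
  have [k1|b1] := leP (cabs (tri f x (mid x y) (mid z x))) (e * (per x y z / 2) ^+ 2);
    last first.
    by exists (x, mid x y, mid z x) => /= _; rewrite p1 subrr cabs0; split.
  have [k2|b2] := leP (cabs (tri f (mid x y) y (mid y z))) (e * (per x y z / 2) ^+ 2);
    last by exists (mid x y, y, mid y z) => /= _; rewrite p2; split.
  have [k3|b3] := leP (cabs (tri f (mid z x) (mid y z) z)) (e * (per x y z / 2) ^+ 2);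
    last by exists (mid z x, mid y z, z) => /= _; rewrite p3; split.
  have [k4|b4] := leP (cabs (tri f (mid x y) (mid y z) (mid z x))) (e * (per x y z / 2) ^+ 2);
    last by exists (mid x y, mid y z, mid z x) => /= _; rewrite p4; split.
  exfalso; move: hbad; rewrite ltNge => /negP; apply.
  rewrite (tri_subdivision cf dx dy dz).
  apply: le_trans (cabsD _ _) _; apply: le_trans (lerD (cabsD _ _) (lexx _)) _.
  apply: le_trans (lerD (lerD (cabsD _ _) (lexx _)) (lexx _)) _.
  apply: le_trans (lerD (lerD (lerD k1 k2) k3) k4) _.
  by rewrite le_eqVlt; apply/orP; left; apply/eqP; field.
have [F hF] := choice step.
pose t n := iter n F (a, b, c).
have t0 : inv (t 0%N) by rewrite /inv /t /= /rho !le_max !lexx !orbT.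
have tinv n : inv (t n).
  by elim: n => // n IH; have [] := hF _ IH.
have tS n : P (t n.+1) = P (t n) / 2 by have [] := hF _ (tinv n).
have tD n : cabs ((t n.+1).1.1 - (t n).1.1) <= P (t n).
  by have [] := hF _ (tinv n).
have P0 n : 0 <= P (t n) by exact: per_ge0.
have tE n : P (t n) = P (t 0%N) * (2^-1) ^+ n.
  by elim: n => [|n IH]; rewrite ?expr0 ?mulr1 // tS IH exprS; field.
pose x n := (t n).1.1.
have xD n k : cabs (x (n + k)%N - x n) <= 2 * P (t n) - 2 * P (t (n + k)%N).
  elim: k => [|k IH]; first by rewrite addn0 !subrr cabs0.
  have -> : x (n + k.+1)%N - x n = (x (n + k).+1 - x (n + k)%N) + (x (n + k)%N - x n).
    by rewrite addnS; ring.
  apply: le_trans (cabsD _ _) _; apply: le_trans (lerD (tD _) IH) _.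
  by rewrite addnS tS; lra.
have xD' n m : (n <= m)%N -> cabs (x m - x n) <= 2 * P (t n).
  by move=> /subnKC <-; apply: le_trans (xD _ _) _; rewrite lerBlDr lerDl mulr_ge0.
have small (d : R) : 0 < d -> exists n, P (t n) <= d.
  move=> d0; have h2 : 0 <= (2^-1 : R) < 1 by rewrite invr_ge0 ler0n invf_lt1 ?ltr1n.
  have [N hN] := geometric_small (P (t 0%N)) h2 d0.
  by exists N; rewrite tE; apply: hN.
have [l hl] : exists l : C, forall d : R, 0 < d -> exists N, forall n, (N <= n)%N ->
    cabs (x n - l) <= d.
  apply: C_cauchy => d d0; have [|N hN] := small (d / 4); first by rewrite divr_gt0.
  exists N => n m hn hm.
  have -> : x n - x m = (x n - x N) - (x m - x N) by ring.
  apply: le_trans (cabsB _ _) _.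
  apply: le_trans (lerD (xD' _ _ hn) (xD' _ _ hm)) _; lra.
have ln n : cabs (x n - l) <= 2 * P (t n).
  apply/ler_addgt0Pr => d /hl[N hN].
  have -> : x n - l = (x (maxn N n) - l) - (x (maxn N n) - x n) by ring.
  apply: le_trans (cabsB _ _) _; rewrite addrC; apply: lerD.
    by apply: xD'; rewrite leq_maxr.
  by apply: hN; rewrite leq_maxl.
have lr : cabs l <= rho.
  apply/ler_addgt0Pr => d /hl[N hN].
  have -> : l = x N - (x N - l) by ring.
  apply: le_trans (cabsB _ _) _; apply: lerD; last exact: hN.
  by have [] := tinv N.
have dl : disk l by apply: le_lt_trans rho1.
have /holomorphic_cdiff/(_ l dl)[d hd] := hf.
have [|r r0 hr] := hd (e / 3); first by rewrite divr_gt0.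
have [|n hn] := small (r / 4); first by rewrite divr_gt0.
have [] := tinv n; have lnn := ln n; have pn := P0 n.
move: lnn hn pn; rewrite /x /P; case: (t n) => [[u v] w] /=.
set p := per u v w; move=> lu hp pn hu hv hw; apply/negP; rewrite -leNgt.
have [du [dv dw]] : disk u /\ (disk v /\ disk w).
  by split; [|split]; apply: le_lt_trans rho1.
have ul : cabs (u - l) <= 3 * p by apply: le_trans lu _; rewrite ler_wpM2r // ler_nat.
have vl : cabs (v - l) <= 3 * p.
  have -> : v - l = (v - u) + (u - l) by ring.
  apply: le_trans (cabsD _ _) _; apply: le_trans (lerD (lexx _) lu) _.
  rewrite /p /per; have := cabs_ge0 (w - v); have := cabs_ge0 (u - w); lra.
have wl : cabs (w - l) <= 3 * p.
  have -> : w - l = - (u - w) + (u - l) by ring.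
  apply: le_trans (cabsD _ _) _; rewrite cabsN; apply: le_trans (lerD (lexx _) lu) _.
  rewrite /p /per; have := cabs_ge0 (w - v); have := cabs_ge0 (v - u); lra.
pose A (z : C) := (f l - d * l) + d * z.
have cA : dcontinuous A.
  move=> z _; apply: (cdiff_continuous (d := 0 + (d * 1 + z * 0))).
  by apply: cdiffD (cdiff_cst _ _) (cdiffM (cdiff_cst d z) (cdiff_id z)).
have cE : dcontinuous (fun z => f z - A z).
  move=> z hz; have /holomorphic_cdiff/(_ z hz)[dz hdz] := hf.
  have E : (fun z => f z - A z) = (fun z => f z + ((- f l + d * l) + (- d) * z)).
    by apply/funext => y; rewrite /A; ring.
  rewrite E; apply: (cdiff_continuous (d := dz + (0 + (- d * 1 + z * 0)))).
  apply: cdiffD => //.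
  by apply: cdiffD (cdiff_cst _ _) (cdiffM (cdiff_cst (- d) z) (cdiff_id z)).
have -> : tri f u v w = tri (fun z => f z - A z) u v w.
  by rewrite triB // tri_affine subr0.
have B (y z : C) : disk y -> disk z -> cabs (y - l) <= 3 * p -> cabs (z - l) <= 3 * p ->
    cabs (seg (fun z => f z - A z) y z) <= e * p * cabs (z - y).
  move=> dy dz hy hz; apply: seg_bound => // s.
  have hs : cabs (sgm y z s - l) <= 3 * p by apply: cabs_sgm.
  have /hr : cabs (sgm y z s - l) < r.
    by apply: le_lt_trans hs _; lra.
  have -> : f (sgm y z s) - f l - d * (sgm y z s - l) = f (sgm y z s) - A (sgm y z s).
    by rewrite /A; ring.
  move=> /le_trans; apply; apply: (@le_trans _ _ (e / 3 * (3 * p))).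
    by rewrite ler_wpM2l // divr_ge0 // ltW.
  by rewrite le_eqVlt; apply/orP; left; apply/eqP; field.
rewrite /tri; apply: le_trans (cabsD _ _) _; apply: le_trans (lerD (cabsD _ _) (lexx _)) _.
apply: le_trans (lerD (lerD (B _ _ du dv ul vl) (B _ _ dv dw vl wl)) (B _ _ dw du wl ul)) _.
by rewrite -!mulrDr -/(per u v w) expr2 mulrA.
Qed.

Theorem goursat f a b c : holomorphic f -> disk a -> disk b -> disk c ->
  tri f a b c = 0.
Proof.
move=> hf ha hb hc; apply/eqP; rewrite -cabs_eq0 eq_le cabs_ge0 andbT.
apply/ler_addgt0Pr => e e0; rewrite add0r.
pose k := 1 + per a b c ^+ 2.
have k0 : 0 < k by rewrite ltr_wpDr // sqr_ge0.
apply: le_trans (tri_small hf ha hb hc (divr_gt0 e0 k0)) _.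
rewrite mulrAC -mulrA; apply: ler_piMr; first exact: ltW.
by rewrite ler_pdivrMr // mul1r /k lerDr.
Qed.

Lemma primitive_ex f : holomorphic f ->
  exists H : C -> C, (forall z, disk z -> cdiff H z (f z)) /\
    (forall z w, disk z -> disk w -> H w - H z = seg f z w).
Proof.
move=> hf; have cf := holomorphic_dcontinuous hf.
have h0 : disk (0 : C) := @disk0 R.
have D z w : disk z -> disk w -> seg f 0 w - seg f 0 z = seg f z w.
  move=> hz hw; have := goursat hf h0 hz hw.
  rewrite /tri (seg_rev cf h0 hw) => h; apply/eqP; rewrite eq_sym -subr_eq0.
  by apply/eqP; rewrite -[RHS]h; ring.
exists (fun z => seg f 0 z); split=> // z hz e e0.
have [r1 r10 h1] := disk_ball hz; have [r2 r20 h2] := cf z hz e e0.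
exists (Num.min r1 r2); first by rewrite lt_min r10.
move=> w; rewrite lt_min => /andP[/h1 hw w2]; rewrite D //.
have -> : seg f z w - f z * (w - z) = seg (fun y => f y - f z) z w.
  rewrite segB //; last by move=> y _; exact: (cdiff_continuous (cdiff_cst (f z) y)).
  by rewrite /seg cint_cst // rmorph1 mulr1 [f z * _]mulrC.
apply: seg_bound => //.
  move=> y hy d d0; have [s s0 hs] := cf y hy d d0; exists s => // v /hs.
  by rewrite opprB addrA subrK.
move=> u; apply: h2; apply: le_lt_trans w2.
by apply: cabs_sgm; rewrite ?subrr ?cabs0 ?cabs_ge0.
Qed.

End Goursat.

(** * Means over circles *)

Section CircleMeans.
Variable R : realType.
Local Notation C := (R[i]^o).
Implicit Types (f g H : C -> C) (phi psi U V : R -> C) (z w : C) (r : R).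

Local Notation tau := (2 * pi : R).

Lemma tau_gt0 : 0 < tau.
Proof. by rewrite mulr_gt0 // pi_gt0. Qed.

Definition rmean (u : R -> R) : R := tau^-1 * rint tau u.

Definition mean phi : C := (tau^-1)%:C * cint tau phi.

Lemma mean_eq phi psi : (forall t, phi t = psi t) -> mean phi = mean psi.
Proof. by move=> h; congr (_ * _); apply: cint_eq => t _. Qed.

Lemma rmean_eq (u v : R -> R) : (forall t, u t = v t) -> rmean u = rmean v.
Proof. by move=> h; congr (_ * _); apply: rint_eq => t _. Qed.

Lemma meanD phi psi : cc phi -> cc psi ->
  mean (fun t => phi t + psi t) = mean phi + mean psi.
Proof. by move=> h1 h2; rewrite /mean cintD // mulrDr. Qed.

Lemma meanB phi psi : cc phi -> cc psi ->
  mean (fun t => phi t - psi t) = mean phi - mean psi.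
Proof. by move=> h1 h2; rewrite /mean cintB // mulrBr. Qed.

Lemma meanZ (c : C) phi : cc phi -> mean (fun t => c * phi t) = c * mean phi.
Proof. by move=> h; rewrite /mean cintZ // mulrCA. Qed.

Lemma mean_cst (c : C) : mean (fun=> c) = c.
Proof.
rewrite /mean cint_cst ?ltW ?tau_gt0 // mulrCA -rmorphM /= mulVf ?mulr1 //.
by rewrite gt_eqF // tau_gt0.
Qed.

Lemma mean_conj phi : cc phi -> mean (fun t => (phi t)^*) = (mean phi)^*.
Proof. by move=> h; rewrite /mean cint_conj // rmorphM /= oppr0. Qed.

Lemma rmean_le (u v : R -> R) : continuous u -> continuous v ->
  (forall t, u t <= v t) -> rmean u <= rmean v.
Proof.
move=> cu cv h; rewrite /rmean ler_pM2l ?invr_gt0 ?tau_gt0 //.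
by apply: rint_le.
Qed.

Lemma rmean_cst (c : R) : rmean (fun=> c) = c.
Proof.
rewrite /rmean rint_cst ?ltW ?tau_gt0 // mulrCA mulVf ?mulr1 //.
by rewrite gt_eqF // tau_gt0.
Qed.

Lemma rmeanZ (c : R) u : continuous u -> rmean (fun t => c * u t) = c * rmean u.
Proof. by move=> h; rewrite /rmean rintZ // mulrCA. Qed.

Lemma rmeanD u v : continuous u -> continuous v ->
  rmean (fun t => u t + v t) = rmean u + rmean v.
Proof. by move=> cu cv; rewrite /rmean rintD // mulrDr. Qed.

Lemma mean_norm phi : cc phi -> cabs (mean phi) <= rmean (fun t => cabs (phi t)).
Proof.
move=> h; rewrite /mean cabsM cabs_real ger0_norm; last first.
  by rewrite invr_ge0 ltW // tau_gt0.
by rewrite /rmean ler_pM2l ?invr_gt0 ?tau_gt0 // cint_norm.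
Qed.

Lemma rmean_ge0 (u : R -> R) : (forall t, 0 <= u t) -> 0 <= rmean u.
Proof.
move=> h; apply: mulr_ge0; first by rewrite invr_ge0 ltW // tau_gt0.
by apply: Rintegral_ge0 => t _.
Qed.

Lemma mean_bound phi (M : R) : cc phi -> (forall t, cabs (phi t) <= M) ->
  cabs (mean phi) <= M.
Proof.
move=> h hM; apply: le_trans (mean_norm h) _; rewrite -[X in _ <= X]rmean_cst.
by apply: rmean_le => //; [exact: cc_cabs|apply: cst_continuous].
Qed.

Lemma mean_mul_bound U V (k : R) : cc U -> cc V -> (forall t, cabs (V t) <= k) ->
  cabs (mean (fun t => U t * V t)) <= k * rmean (fun t => cabs (U t)).
Proof.
move=> hU hV hk; apply: le_trans (mean_norm (ccM hU hV)) _.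
rewrite -rmeanZ; last exact: cc_cabs.
apply: rmean_le => [||t].
- by apply: cc_cabs; exact: ccM.
- by apply: rcontM; [apply: cst_continuous|exact: cc_cabs].
by rewrite cabsM mulrC ler_wpM2r ?cabs_ge0.
Qed.

Lemma mean_FTC phi psi : cc psi -> (forall t, rdiff phi t (psi t)) ->
  phi tau = phi 0 -> mean psi = 0.
Proof.
move=> c h e; rewrite /mean (cint_FTC tau_gt0 c (fun t _ => h t)) e subrr.
by rewrite mulr0.
Qed.

Local Notation circ := (@circle_point R).

Lemma cabs_circ r t : 0 <= r -> cabs (circ r t : C) = r.
Proof.
move=> r0; apply/eqP; rewrite -(@eqrXn2 _ 2) ?cabs_ge0 //; apply/eqP.
rewrite cabs_sqr /= !exprMn -mulrDr.
by rewrite (_ : cos t ^+ 2 + sin t ^+ 2 = 1) ?mulr1 // cos2Dsin2.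
Qed.

Lemma disk_circ r t : 0 <= r < 1 -> disk (circ r t : C).
Proof. by case/andP=> r0 r1; rewrite /disk /= cabs_circ. Qed.

Lemma circ_neq0 r t : 0 < r -> (circ r t : C) != 0.
Proof. by move=> r0; rewrite -cabs_gt0 cabs_circ // ltW. Qed.

Lemma circ_period r : (circ r tau : C) = circ r 0.
Proof.
have -> : tau = 0 + pi *+ 2 by rewrite add0r mulr_natl.
by rewrite /circle_point cosD2pi sinD2pi.
Qed.

Definition icpx : C := 0 +i* 1.

Lemma rdiff_circ r t : rdiff (fun s => circ r s : C) t (icpx * circ r t).
Proof.
move=> e e0; pose k := 2 * (1 + `|r|).
have k0 : 0 < k by rewrite mulr_gt0 // ltr_wpDr.
have ek : 0 < e / k by rewrite divr_gt0.
have [r1 r10 h1] := is_derive_epsP (is_derive_cos t) ek.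
have [r2 r20 h2] := is_derive_epsP (is_derive_sin t) ek.
exists (Num.min r1 r2); first by rewrite lt_min r10.
move=> s; rewrite lt_min => /andP[/h1 l1 /h2 l2].
have -> : circ r s - circ r t - icpx * circ r t * (s - t)%:C =
  (r * (cos s - cos t - - sin t * (s - t))) +i* (r * (sin s - sin t - cos t * (s - t))).
  by apply: complex_ext; rewrite /= ; ring.
apply: le_trans (cabs_ReIm _) _; rewrite /= !normrM.
apply: (@le_trans _ _ (`|r| * (e / k * `|s - t|) + `|r| * (e / k * `|s - t|))).
  by apply: lerD; rewrite ler_wpM2l.
have -> : `|r| * (e / k * `|s - t|) + `|r| * (e / k * `|s - t|) =
   (2 * `|r| / k) * (e * `|s - t|) by ring.
apply: ler_piMl; first by rewrite mulr_ge0 // ltW.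
by rewrite ler_pdivrMr // mul1r /k ler_wpM2l // lerDr.
Qed.

Lemma cc_circ r : cc (fun t => circ r t : C).
Proof.
split=> t; apply: cvgM; try exact: cvg_cst.
- exact: continuous_cos.
- exact: continuous_sin.
Qed.

Lemma cc_on_circ f r : dcontinuous f -> 0 <= r < 1 -> cc (fun t => f (circ r t)).
Proof.
by move=> cf hr; apply: cc_dcomp => // [t|]; [exact: disk_circ|exact: cc_circ].
Qed.

(** Cauchy's theorem for circles: the integrand is the derivative of a
    primitive along a closed curve. *)
Lemma mean_holo0 f r : holomorphic f -> 0 <= r < 1 ->
  mean (fun t => f (circ r t) * circ r t) = 0.
Proof.
move=> hf hr; have [H [hH _]] := primitive_ex hf.
have cf := cc_on_circ (holomorphic_dcontinuous hf) hr.
have cfc : cc (fun t => f (circ r t) * circ r t) by apply: ccM => //; exact: cc_circ.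
have I0 : icpx != 0 by rewrite eq_complex /= oner_eq0 andbF.
apply: (mulfI I0); rewrite mulr0 -meanZ //.
apply: (@mean_FTC (fun t => H (circ r t))).
- exact: ccZ.
- move=> t; rewrite mulrCA; apply: rdiff_comp; last exact: rdiff_circ.
  by apply: hH; exact: disk_circ.
- by rewrite circ_period.
Qed.

Lemma cdiff_expr z k : cdiff (fun w : C => w ^+ k) z (z ^+ k.-1 *+ k).
Proof.
elim: k => [|k IH]; first by rewrite mulr0n; exact: cdiff_cst.
have E : (fun w : C => w ^+ k.+1) = (fun w => w * w ^+ k).
  by apply/funext => w; rewrite exprS.
rewrite E; have := cdiffM (cdiff_id z) IH; rewrite mulr1.
rewrite [X in cdiff _ _ X -> _](_ : _ = z ^+ k.+1.-1 *+ k.+1) //.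
case: k {IH E} => [|k]; first by rewrite mulr0n mulr0 add0r.
by rewrite [in RHS]mulrSr /= mulrnAr -exprS.
Qed.

Lemma holomorphic_expr k : holomorphic (fun w : C => w ^+ k).
Proof. by apply/holomorphic_cdiff => z _; exists (z ^+ k.-1 *+ k); exact: cdiff_expr. Qed.

Lemma mean_expr r k : 0 <= r < 1 -> mean (fun t => (circ r t : C) ^+ k.+1) = 0.
Proof.
move=> hr; rewrite -(mean_holo0 (@holomorphic_expr k) hr).
by apply: mean_eq => t; rewrite exprSr.
Qed.

Lemma circ_sub_ge r z t : 0 <= r -> r - cabs z <= cabs (circ r t - z).
Proof. by move=> r0; rewrite -{1}(cabs_circ t r0) cabs_sub_ge. Qed.

Lemma circ_sub_neq0 r z t : cabs z < r -> circ r t - z != 0.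
Proof.
move=> zr; have r0 : 0 <= r by apply: le_trans (ltW zr); exact: cabs_ge0.
by rewrite -cabs_gt0; apply: lt_le_trans (circ_sub_ge z t r0); rewrite subr_gt0.
Qed.

Lemma cc_circ_sub r z : cabs z < r -> cc (fun t => (circ r t - z)^-1).
Proof.
move=> zr; apply: ccV => [t|]; first exact: circ_sub_neq0.
by apply: ccB; [exact: cc_circ|exact: cc_cst].
Qed.

Lemma divC_conj (z c : C) : c != 0 -> z / c = z / (cabs c ^+ 2)%:C * (c^*)%C.
Proof.
move=> c0; rewrite -mulc_conj.
have : ((c^*)%C : C) != 0 by rewrite -cabs_eq0 cabs_conj cabs_eq0.
by set d : C := (c^*)%C => d0; field; rewrite c0 d0.
Qed.

(** Expanding the kernel in powers of z / zeta, whose means vanish, leaves a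
    geometrically small remainder. *)
Lemma mean_kernel r z : cabs z < r < 1 ->
  mean (fun t => circ r t / (circ r t - z)) = 1.
Proof.
case/andP=> zr r1; have r0 : 0 < r by apply: le_lt_trans zr; exact: cabs_ge0.
have hr : 0 <= r < 1 by rewrite ltW.
have ck : cc (fun t => circ r t / (circ r t - z)).
  by apply: ccM; [exact: cc_circ|exact: cc_circ_sub].
have cz : cc (fun t => z / circ r t).
  by apply: ccZ; apply: ccV; [move=> t; exact: circ_neq0|exact: cc_circ].
have m0 k : mean (fun t => (z / circ r t) ^+ k.+1) = 0.
  have -> : mean (fun t => (z / circ r t) ^+ k.+1)
     = mean (fun t => (z ^+ k.+1 / (r ^+ 2)%:C ^+ k.+1) * ((circ r t : C) ^+ k.+1)^*).
    apply: mean_eq => t; rewrite divC_conj ?circ_neq0 // (cabs_circ t (ltW r0)).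
    by rewrite [in RHS](rmorphXn (@conjc R)) exprMn expr_div_n.
  rewrite meanZ; last by apply: cc_conj; apply: ccX; exact: cc_circ.
  rewrite mean_conj ?mean_expr //; last by apply: ccX; exact: cc_circ.
  by rewrite conjc0 mulr0.
have E N : mean (fun t => circ r t / (circ r t - z)) =
    1 + mean (fun t => (z / circ r t) ^+ N.+1 * (circ r t / (circ r t - z))).
  elim: N => [|N IH].
    rewrite -(mean_cst 1) -meanD; first last.
    - by apply: ccM => //; exact: ccX.
    - exact: cc_cst.
    apply: mean_eq => t; have c0 := circ_neq0 t r0; have c1 := circ_sub_neq0 t zr.
    by field; rewrite c0 c1.
  rewrite IH -[X in _ = _ + X]add0r -(m0 N) -meanD; first last.
  - by apply: ccM => //; exact: ccX.
  - exact: ccX.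
  congr (_ + _); apply: mean_eq => t.
  have c0 := circ_neq0 t r0; have c1 := circ_sub_neq0 t zr.
  rewrite (exprS _ N.+1); set u := (z / _) ^+ N.+1.
  by field; rewrite c0 c1.
apply/eqP; rewrite -subr_eq0 -cabs_eq0 eq_le cabs_ge0 andbT.
apply/ler_addgt0Pr => e e0; rewrite add0r.
have q01 : 0 <= cabs z / r < 1.
  by rewrite divr_ge0 ?cabs_ge0 ?ltW //= ltr_pdivrMr // mul1r.
have [N hN] := geometric_small (r / (r - cabs z)) q01 e0.
rewrite (E N) addrAC subrr add0r; apply: mean_bound => [|t].
  by apply: ccM => //; exact: ccX.
apply: le_trans (hN N.+1 _); last by [].
rewrite cabsM cabsX !cabsM !cabsV (cabs_circ t (ltW r0)).
rewrite [X in X <= _]mulrC; apply: ler_wpM2r.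
  by apply: exprn_ge0; apply: divr_ge0; [exact: cabs_ge0|exact: ltW].
apply: ler_wpM2l; first exact: ltW.
rewrite lef_pV2 ?posrE ?subr_gt0 ?cabs_gt0 ?circ_sub_neq0 //.
by apply: circ_sub_ge; exact: ltW.
Qed.

(** The error of the expansion is (w - z)^2 times the mean against an explicit
    bounded kernel. *)
Lemma cauchy_transform_cdiff U r z : cc U -> cabs z < r ->
  cdiff (fun w => mean (fun t => U t * (circ r t / (circ r t - w)))) z
        (mean (fun t => U t * (circ r t / (circ r t - z) ^+ 2))).
Proof.
move=> cU zr; have r0 : 0 < r by apply: le_lt_trans zr; exact: cabs_ge0.
pose d := (r - cabs z) / 2; have d0 : 0 < d by rewrite divr_gt0 ?subr_gt0.
pose k := r / (d * d ^+ 2).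
have k0 : 0 < k by rewrite divr_gt0 // mulr_gt0 ?exprn_gt0.
pose m := rmean (fun t => cabs (U t)).
have m0 : 0 <= m by apply: rmean_ge0 => t; exact: cabs_ge0.
have K0 : 0 < 1 + k * m by rewrite ltr_wpDr // mulr_ge0 // ltW.
move=> e e0; exists (Num.min d (e / (1 + k * m))).
  by rewrite lt_min d0 divr_gt0.
move=> w; rewrite lt_min => /andP[wd we].
have wr : cabs w + d <= r.
  have : cabs w <= cabs z + cabs (w - z) by rewrite -{1}(subrK z w) addrC cabsD.
  by rewrite /d in wd *; lra.
have wr' : cabs w < r by rewrite (lt_le_trans _ wr) // ltrDl.
have cw := cc_circ_sub wr'; have cz := cc_circ_sub zr; have cC := cc_circ r.
have cz2 : cc (fun t => (circ r t - z) ^- 2).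
  by rewrite (_ : (fun t => _) = (fun t => (circ r t - z)^-1 ^+ 2));
    [exact: ccX|apply/funext => t; rewrite exprVn].
rewrite -meanB; [|by apply: ccM => //; exact: ccM..].
rewrite [X in cabs (X - _)](_ : _ = mean (fun t =>
  U t * (circ r t / (circ r t - w)) - U t * (circ r t / (circ r t - z)))) //.
rewrite mulrC -meanZ; last by apply: ccM => //; exact: ccM.
rewrite -meanB; first last.
- by apply: ccZ; apply: ccM => //; exact: ccM.
- by apply: ccB; apply: ccM => //; exact: ccM.
rewrite (_ : mean _ = (w - z) ^+ 2 * mean (fun t => U t *
     (circ r t / (circ r t - w) * (circ r t - z) ^- 2))); last first.
  rewrite -meanZ; last by apply: ccM => //; apply: ccM => //; exact: ccM.
  apply: mean_eq => t.
  have c1 := circ_sub_neq0 t zr; have c2 := circ_sub_neq0 t wr'.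
  by field; rewrite c1 c2.
rewrite cabsM cabsX expr2 -mulrA mulrC.
rewrite ler_wpM2r ?cabs_ge0 //; apply: (@le_trans _ _ (cabs (w - z) * (k * m))).
  rewrite ler_wpM2l ?cabs_ge0 //; apply: mean_mul_bound => // [|t].
    by apply: ccM => //; exact: ccM.
  rewrite !cabsM !cabsV cabsX (cabs_circ t (ltW r0)) -mulrA -invfM /k.
  apply: ler_wpM2l; first exact: ltW.
  rewrite lef_pV2 ?posrE ?mulr_gt0 ?exprn_gt0 ?cabs_gt0 ?circ_sub_neq0
    ?subr_gt0 //.
  have b1 : d <= cabs (circ r t - w).
    by apply: le_trans (circ_sub_ge w t (ltW r0)); rewrite lerBrDr addrC.
  have b2 : d <= cabs (circ r t - z).
    by apply: le_trans (circ_sub_ge z t (ltW r0)); rewrite /d; lra.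
  apply: ler_pM => //; [exact: ltW|by apply: exprn_ge0; exact: ltW|].
  by rewrite ler_pXn2r // nnegrE ?cabs_ge0 // ltW.
apply: (@le_trans _ _ (cabs (w - z) * (1 + k * m))).
  by rewrite ler_wpM2l ?cabs_ge0 // lerDr.
by rewrite -ler_pdivlMr // ltW.
Qed.

End CircleMeans.

(** * Cauchy's formula and difference quotients *)

Section CauchyFormula.
Variable R : realType.
Local Notation C := (R[i]^o).
Implicit Types (f g H : C -> C) (U V : R -> C) (z w : C) (r : R).
Local Notation circ := (@circle_point R).

Lemma cdiff_affine (p d z : C) : cdiff (fun w : C => p + d * w) z d.
Proof.
have := cdiffD (cdiff_cst p z) (cdiffM (cdiff_cst d z) (cdiff_id z)).
by rewrite mulr1 mulr0 addr0 add0r.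
Qed.

Lemma dcontinuousB f g : dcontinuous f -> dcontinuous g ->
  dcontinuous (fun z => f z - g z).
Proof.
move=> cf cg z hz e e0; have e2 : 0 < e / 2 by rewrite divr_gt0.
have [r r0 hr] := cf z hz _ e2; have [s s0 hs] := cg z hz _ e2.
exists (Num.min r s); first by rewrite lt_min r0.
move=> w; rewrite lt_min => /andP[/hr h1 /hs h2].
have -> : f w - g w - (f z - g z) = (f w - f z) - (g w - g z) by ring.
apply: le_trans (cabsB _ _) _; apply: le_trans (lerD h1 h2) _.
by rewrite -splitr.
Qed.

Lemma cdiff_div_sub H d z w : w != z -> cdiff H w d ->
  exists d', cdiff (fun v => (H v - H z) / (v - z)) w d'.
Proof.
move=> wz hH; have wz0 : w - z != 0 by rewrite subr_eq0.
have d1 : cdiff (fun v => H v - H z) w (d + 0).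
  by apply: (cdiffD hH); exact: cdiff_cst.
have d2 : cdiff (fun v : C => v - z) w (1 + 0).
  by apply: (cdiffD (cdiff_id w)); exact: cdiff_cst.
by eexists; apply: cdiffM d1 (cdiffV _ d2).
Qed.

(** A primitive of a holomorphic function has a second order expansion at each
    point, so its difference quotient has no singularity at all. *)
Lemma primitive_quotient_holo H f z : holomorphic f ->
  (forall z, disk z -> cdiff H z (f z)) ->
  (forall z w, disk z -> disk w -> H w - H z = seg f z w) -> disk z ->
  holomorphic (fun w => if w == z then f z else (H w - H z) / (w - z)).
Proof.
move=> hf hH hs hz; apply/holomorphic_cdiff => w hw.
have [->|wz] := eqVneq w z; last first.
  have [d hd] := cdiff_div_sub wz (hH w hw); exists d.
  have wz1 : 0 < cabs (w - z) by rewrite cabs_gt0 subr_eq0.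
  apply: cdiff_local wz1 _ hd => v hv; case: eqP => // vz; move: hv.
  by rewrite vz cabs_sym ltxx.
have /holomorphic_cdiff/(_ z hz)[d hd] := hf; exists (d / 2) => e e0.
have [r1 r10 h1] := hd e e0; have [r2 r20 h2] := disk_ball hz.
exists (Num.min r1 r2); first by rewrite lt_min r10.
move=> v; rewrite lt_min eqxx => /andP[v1 /h2 v2].
case: eqP => [->|/eqP vz]; first by rewrite !subrr mulr0 subr0 cabs0 mulr0.
have vz0 : v - z != 0 by rewrite subr_eq0.
have cf := holomorphic_dcontinuous hf.
have cA : dcontinuous (fun y => (f z - d * z) + d * y).
  by move=> y _; exact: (cdiff_continuous (cdiff_affine _ _ _)).
have -> : (H v - H z) / (v - z) - f z - d / 2 * (v - z) =
    seg (fun y => f y - ((f z - d * z) + d * y)) z v / (v - z).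
  by rewrite segB // seg_affine -hs //; field.
rewrite cabsM cabsV ler_pdivrMr ?cabs_gt0 //; apply: seg_bound => //.
  exact: dcontinuousB.
move=> u; have su : cabs (sgm z v u - z) <= cabs (v - z).
  by apply: cabs_sgm; rewrite ?subrr ?cabs0 ?cabs_ge0.
have := h1 (sgm z v u) (le_lt_trans su v1).
rewrite (_ : f _ - f z - _ = f (sgm z v u) - (f z - d * z + d * sgm z v u)).
  by move=> /le_trans; apply; rewrite ler_wpM2l // ltW.
by ring.
Qed.

Lemma cc_cauchy U r z : cc U -> cabs z < r ->
  cc (fun t => U t * (circ r t / (circ r t - z))).
Proof.
by move=> cU zr; do 2 (apply: ccM => //); [exact: cc_circ|exact: cc_circ_sub].
Qed.

Lemma cauchy_primitive H f r z : holomorphic f ->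
  (forall z, disk z -> cdiff H z (f z)) ->
  (forall z w, disk z -> disk w -> H w - H z = seg f z w) -> cabs z < r < 1 ->
  H z = mean (fun t => H (circ r t) * (circ r t / (circ r t - z))).
Proof.
move=> hf hH hs /andP[zr r1].
have r0 : 0 < r by apply: le_lt_trans zr; exact: cabs_ge0.
have hr : 0 <= r < 1 by rewrite ltW.
have hz : disk z by rewrite /disk /= (lt_trans zr).
have cH : dcontinuous H by move=> y /hH; exact: cdiff_continuous.
have cHc : cc (fun t => H (circ r t)) := cc_on_circ cH hr.
have := mean_holo0 (primitive_quotient_holo hf hH hs hz) hr.
rewrite (_ : mean _ = mean (fun t => H (circ r t) * (circ r t / (circ r t - z)) -
    H z * (circ r t / (circ r t - z)))).
  rewrite meanB; [|exact: cc_cauchy|by apply: cc_cauchy => //; exact: cc_cst].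
  rewrite meanZ; last by apply: ccM; [exact: cc_circ|exact: cc_circ_sub].
  by rewrite mean_kernel ?zr // mulr1 => /eqP; rewrite subr_eq0 => /eqP ->.
apply: mean_eq => t; have c1 := circ_sub_neq0 t zr.
rewrite -[circ r t == z](subr_eq0 (circ r t)) (negbTE c1).
by field.
Qed.

(** Only the primitive H is known to have a holomorphic derivative at first, so
    the formula is obtained for H, differentiated, and brought back to f = H'. *)
Theorem cauchy_formula f r z : holomorphic f -> cabs z < r < 1 ->
  f z = mean (fun t => f (circ r t) * (circ r t / (circ r t - z))).
Proof.
move=> hf hzr; have /andP[zr r1] := hzr; have [H [hH hs]] := primitive_ex hf.
have r0 : 0 < r by apply: le_lt_trans zr; exact: cabs_ge0.
have hr : 0 <= r < 1 by rewrite ltW.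
have hz : disk z by rewrite /disk /= (lt_trans zr).
have cH : dcontinuous H by move=> y /hH; exact: cdiff_continuous.
have cHc : cc (fun t => H (circ r t)) := cc_on_circ cH hr.
have cfc := cc_on_circ (holomorphic_dcontinuous hf) hr.
have cC := cc_circ r; have cz := cc_circ_sub zr.
have cz2 : cc (fun t => (circ r t - z) ^- 2).
  by rewrite (_ : (fun t => _) = (fun t => (circ r t - z)^-1 ^+ 2));
    [exact: ccX|apply/funext => t; rewrite exprVn].
(* the Cauchy formula for the primitive, differentiated at z *)
have E1 : f z = mean (fun t => H (circ r t) * (circ r t / (circ r t - z) ^+ 2)).
  apply: (cdiff_unique (hH z hz)).
  have [s s0 hsr] : exists2 s, 0 < s & forall w, cabs (w - z) < s -> cabs w < r.
    exists (r - cabs z); first by rewrite subr_gt0.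
    move=> w; rewrite ltrBrDr => h; apply: le_lt_trans h.
    by rewrite -{1}(subrK z w) cabsD.
  apply: cdiff_local s0 _ (cauchy_transform_cdiff cHc zr) => w /hsr wr.
  by rewrite -(cauchy_primitive hf hH hs) // wr.
(* integration by parts: H / (zeta - z) is a closed curve, so the mean of its
   derivative vanishes *)
pose P w := H w * (w - z)^-1.
have dP t : cdiff P (circ r t)
   (H (circ r t) * (- ((circ r t - z) ^- 2 * (1 + 0))) + (circ r t - z)^-1 * f (circ r t)).
  apply: cdiffM; first by apply: hH; exact: disk_circ.
  apply: (cdiffV (f := fun w => w - z)); first exact: circ_sub_neq0.
  by apply: (cdiffD (cdiff_id _)); exact: cdiff_cst.
have I0 : icpx R != 0 by rewrite eq_complex /= oner_eq0 andbF.
have E2 : mean (fun t => f (circ r t) * (circ r t / (circ r t - z)) -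
     H (circ r t) * (circ r t / (circ r t - z) ^+ 2)) = 0.
  apply: (mulfI I0); rewrite mulr0 -meanZ; last first.
    by apply: ccB; apply: ccM => //; exact: ccM.
  apply: (@mean_FTC R (fun t => P (circ r t))).
  - by apply: ccZ; apply: ccB; apply: ccM => //; exact: ccM.
  - move=> t; have := rdiff_comp (dP t) (rdiff_circ r t).
    set u := (X in rdiff _ _ X -> _); set v := (X in _ -> rdiff _ _ X).
    suff -> : u = v by [].
    by rewrite /u /v; have c1 := circ_sub_neq0 t zr; field.
  - by rewrite circ_period.
move: E2; rewrite meanB; [|by apply: ccM => //; exact: ccM..].
by rewrite -E1 => /eqP; rewrite subr_eq0 => /eqP.
Qed.

Lemma cauchy_bound f r z : holomorphic f -> cabs z < r < 1 ->
  cabs (f z) <= r / (r - cabs z) * rmean (fun t => cabs (f (circ r t))).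
Proof.
move=> hf hzr; have /andP[zr r1] := hzr; rewrite (cauchy_formula hf hzr).
have r0 : 0 < r by apply: le_lt_trans zr; exact: cabs_ge0.
have hr : 0 <= r < 1 by rewrite ltW.
apply: mean_mul_bound.
- by apply: cc_on_circ => //; exact: holomorphic_dcontinuous.
- by apply: ccM; [exact: cc_circ|exact: cc_circ_sub].
move=> t; rewrite cabsM cabsV (cabs_circ t (ltW r0)); apply: ler_wpM2l; first exact: ltW.
rewrite lef_pV2 ?posrE ?subr_gt0 ?cabs_gt0 ?circ_sub_neq0 //.
by apply: circ_sub_ge; exact: ltW.
Qed.

(** The difference quotient with its removable singularity filled in. *)
Definition dquot f z w : C :=
  if w == z then derive1 f z else (f w - f z) / (w - z).

Lemma radius_between z w : disk z -> disk w ->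
  exists2 r, r < 1 & cabs z < r /\ cabs w < r.
Proof.
rewrite /disk /= => hz hw; set m := Num.max (cabs z) (cabs w).
have m1 : m < 1 by rewrite gt_max hz.
exists ((m + 1) / 2); first by lra.
have : cabs z <= m by rewrite le_max lexx.
have : cabs w <= m by rewrite le_max lexx orbT.
by split; lra.
Qed.

Lemma dquot_cauchy f r z w : holomorphic f -> cabs z < r < 1 -> cabs w < r ->
  dquot f z w =
  mean (fun t => f (circ r t) / (circ r t - z) * (circ r t / (circ r t - w))).
Proof.
move=> hf hzr wr; have /andP[zr r1] := hzr.
have r0 : 0 < r by apply: le_lt_trans zr; exact: cabs_ge0.
have hr : 0 <= r < 1 by rewrite ltW.
have hz : disk z by rewrite /disk /= (lt_trans zr).
have cfc := cc_on_circ (holomorphic_dcontinuous hf) hr.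
have cC := cc_circ r; have cz := cc_circ_sub zr; have cw := cc_circ_sub wr.
rewrite /dquot; case: eqP => [->|/eqP wz].
  rewrite (@mean_eq _ _ (fun t => f (circ r t) * (circ r t / (circ r t - z) ^+ 2))).
    apply: derive1_cdiff.
    have [s s0 hsr] : exists2 s, 0 < s & forall v, cabs (v - z) < s -> cabs v < r.
      exists (r - cabs z); first by rewrite subr_gt0.
      move=> v; rewrite ltrBrDr => h; apply: le_lt_trans h.
      by rewrite -{1}(subrK z v) cabsD.
    apply: cdiff_local s0 _ (cauchy_transform_cdiff cfc zr) => v /hsr vr.
    by rewrite -cauchy_formula // vr.
  by move=> t; have c1 := circ_sub_neq0 t zr; field.
have wz0 : w - z != 0 by rewrite subr_eq0.
have wr1 : cabs w < r < 1 by rewrite wr.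
rewrite (cauchy_formula hf wr1) (cauchy_formula hf hzr) -meanB; first last.
- exact: cc_cauchy.
- exact: cc_cauchy.
rewrite mulrC -meanZ; last by apply: ccB; exact: cc_cauchy.
apply: mean_eq => t; have c1 := circ_sub_neq0 t zr; have c2 := circ_sub_neq0 t wr.
by field; rewrite c1 c2.
Qed.

(** The quotient is itself a Cauchy transform, on every circle around z and w. *)
Theorem dquot_holo f z : holomorphic f -> disk z -> holomorphic (dquot f z).
Proof.
move=> hf hz; apply/holomorphic_cdiff => w hw.
have [r r1 [zr wr]] := radius_between hz hw.
have r0 : 0 < r by apply: le_lt_trans zr; exact: cabs_ge0.
have hr : 0 <= r < 1 by rewrite ltW.
have cfc := cc_on_circ (holomorphic_dcontinuous hf) hr.
have cU : cc (fun t => f (circ r t) / (circ r t - z)).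
  by apply: ccM => //; exact: cc_circ_sub.
have rw0 : 0 < r - cabs w by rewrite subr_gt0.
eexists; apply: cdiff_local rw0 _ (cauchy_transform_cdiff cU wr) => v.
rewrite ltrBrDr => h; rewrite -dquot_cauchy ?zr //.
by apply: le_lt_trans h; rewrite -{1}(subrK w v) cabsD.
Qed.

Lemma dquotE f z w : f w = f z + (w - z) * dquot f z w.
Proof.
rewrite /dquot; case: eqP => [->|/eqP wz]; first by rewrite subrr mul0r addr0.
by rewrite mulrC divfK ?subr_eq0 // addrC subrK.
Qed.

End CauchyFormula.

(** * Taylor coefficients and Bessel's inequality *)

Section TaylorCoefficients.
Variable R : realType.
Local Notation C := (R[i]^o).
Implicit Types (f g h u v : C -> C) (z w : C) (r M e : R).
Local Notation circ := (@circle_point R).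

(** The k-th backward shift of the Taylor series of f; its value at 0 is the k-th
    Taylor coefficient. *)
Definition qiter k f : C -> C := iter k (fun h => dquot h 0) f.

Lemma qiterS k f : qiter k.+1 f = dquot (qiter k f) 0.
Proof. by []. Qed.

Lemma qiter_holo k f : holomorphic f -> holomorphic (qiter k f).
Proof.
move=> hf; elim: k => [|k IH]; first exact: hf.
by rewrite qiterS; exact: (dquot_holo IH (@disk0 R)).
Qed.

Lemma dquot0E f w : f w = f 0 + w * dquot f 0 w.
Proof. by rewrite {1}(dquotE f 0 w) subr0. Qed.

Lemma taylorE k f w :
  f w = \sum_(j < k) qiter j f 0 * w ^+ j + w ^+ k * qiter k f w.
Proof.
elim: k => [|k IH]; first by rewrite big_ord0 add0r expr0 mul1r.
rewrite {1}IH big_ord_recr /= {1}(dquot0E (qiter k f) w) exprSr.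
by rewrite -addrA; congr (_ + _); ring.
Qed.

Definition bounded_on_disk M f := forall z, disk z -> cabs (f z) <= M.

Definition inner r u v : C := mean (fun t => u (circ r t) * (v (circ r t))^*).

Definition msq r u : R := rmean (fun t => cabs (u (circ r t)) ^+ 2).

Lemma mean_real (x : R -> R) : mean (fun t => (x t)%:C) = (rmean x)%:C.
Proof.
have E : cint (2 * pi) (fun t => (x t)%:C) = (rint (2 * pi) x)%:C.
  apply: complex_ext => //=; rewrite rint_cst ?mul0r //.
  by apply: ltW; exact: tau_gt0.
by rewrite /mean E -rmorphM.
Qed.

Lemma inner_msq r u : inner r u u = (msq r u)%:C.
Proof. by rewrite -mean_real; apply: mean_eq => t; rewrite mulc_conj. Qed.

Lemma cc_inner r u v : holomorphic u -> holomorphic v -> 0 <= r < 1 ->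
  cc (fun t => u (circ r t) * (v (circ r t))^*).
Proof.
by move=> hu hv hr; apply: ccM; [|apply: cc_conj]; apply: cc_on_circ => //;
  exact: holomorphic_dcontinuous.
Qed.

(** Splitting off the constant terms: the cross terms are means of z h(z), which
    vanish by Cauchy's theorem. Iterating gives the Taylor expansion of the inner
    product, hence Parseval's identity with remainder. *)
Lemma inner_step r u v : holomorphic u -> holomorphic v -> 0 <= r < 1 ->
  inner r u v = u 0 * (v 0)^* + (r ^+ 2)%:C * inner r (dquot u 0) (dquot v 0).
Proof.
move=> hu hv hr; have /andP[r0 r1] := hr.
have hU := dquot_holo hu (@disk0 R); have hV := dquot_holo hv (@disk0 R).
have cU := cc_on_circ (holomorphic_dcontinuous hU) hr.
have cV := cc_on_circ (holomorphic_dcontinuous hV) hr.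
have cC := cc_circ r.
rewrite /inner (@mean_eq _ _ (fun t => (u 0 * (v 0)^* +
    (v 0)^* * (dquot u 0 (circ r t) * circ r t)) +
    (u 0 * (dquot v 0 (circ r t) * circ r t)^* +
    (r ^+ 2)%:C * (dquot u 0 (circ r t) * (dquot v 0 (circ r t))^*)))); last first.
  move=> t.
  have -> : (r ^+ 2)%:C = (circ r t : C) * ((circ r t)^*)%C by rewrite mulc_conj cabs_circ.
  rewrite {1}(dquot0E u) {1}(dquot0E v) !(rmorphD (@conjc R)) !(rmorphM (@conjc R)).
  ring.
have c1 : cc (fun t => dquot u 0 (circ r t) * circ r t) by exact: ccM.
have c2 : cc (fun t => (dquot v 0 (circ r t) * circ r t)^*) by apply: cc_conj; exact: ccM.
have c3 : cc (fun t => dquot u 0 (circ r t) * (dquot v 0 (circ r t))^*).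
  by apply: ccM => //; exact: cc_conj.
rewrite meanD; last 2 first.
- by apply: ccD; [exact: cc_cst|exact: ccZ].
- by apply: ccD; exact: ccZ.
rewrite meanD; [|exact: cc_cst|exact: ccZ].
rewrite meanD; [|exact: ccZ..].
rewrite mean_cst !meanZ // (mean_holo0 hU hr) mean_conj; last exact: ccM.
by rewrite (mean_holo0 hV hr) conjc0 !mulr0 addr0 add0r.
Qed.

Lemma inner_expand k r u v : holomorphic u -> holomorphic v -> 0 <= r < 1 ->
  inner r u v = \sum_(j < k) qiter j u 0 * (qiter j v 0)^* * (r ^+ (2 * j))%:C
     + (r ^+ (2 * k))%:C * inner r (qiter k u) (qiter k v).
Proof.
move=> hu hv hr; elim: k => [|k IH].
  by rewrite big_ord0 add0r muln0 expr0 rmorph1 mul1r.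
rewrite IH big_ord_recr /= (inner_step (@qiter_holo k u hu) (@qiter_holo k v hv) hr).
rewrite -addrA; congr (_ + _); rewrite mulrDr mulrC; congr (_ + _).
by rewrite mulrA -rmorphM /= -exprD mulnS addnC.
Qed.

Lemma msq_expand k r u : holomorphic u -> 0 <= r < 1 ->
  msq r u = \sum_(j < k) cabs (qiter j u 0) ^+ 2 * r ^+ (2 * j)
     + r ^+ (2 * k) * msq r (qiter k u).
Proof.
move=> hu hr; apply: (@complexI R); rewrite -inner_msq (inner_expand k hu hu hr).
rewrite rmorphD rmorphM /= inner_msq rmorph_sum /=; congr (_ + _).
by apply: eq_bigr => j _; rewrite mulc_conj -rmorphM.
Qed.

Lemma msq_ge0 r u : 0 <= msq r u.
Proof. by apply: rmean_ge0 => t; rewrite sqr_ge0. Qed.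

Lemma cont_sqr (x : R -> R) : continuous x -> continuous (fun t => x t ^+ 2).
Proof.
move=> cx; rewrite (_ : (fun t => _) = (fun t => x t * x t)); first exact: rcontM.
by apply/funext => t; rewrite expr2.
Qed.

Lemma msq_cont r u : holomorphic u -> 0 <= r < 1 ->
  continuous (fun t => cabs (u (circ r t)) ^+ 2).
Proof.
move=> hu hr; apply: cont_sqr; apply: cc_cabs; apply: cc_on_circ => //.
exact: holomorphic_dcontinuous.
Qed.

Lemma msq_bound r u M : holomorphic u -> 0 <= r < 1 ->
  (forall t, cabs (u (circ r t)) <= M) -> msq r u <= M ^+ 2.
Proof.
move=> hu hr hM; rewrite -[X in _ <= X]rmean_cst; apply: rmean_le.
- exact: msq_cont.
- by apply: cst_continuous.
move=> t; rewrite ler_pXn2r ?nnegrE ?cabs_ge0 //.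
by apply: le_trans (hM t); exact: cabs_ge0.
Qed.

Lemma bounded_msq r u M : holomorphic u -> 0 <= r < 1 ->
  bounded_on_disk M u -> msq r u <= M ^+ 2.
Proof. by move=> hu hr hM; apply: msq_bound => // t; apply: hM; exact: disk_circ. Qed.

Lemma coef_sum_ge0 k r u : 0 <= r ->
  0 <= \sum_(j < k) cabs (qiter j u 0) ^+ 2 * r ^+ (2 * j).
Proof.
by move=> r0; apply: sumr_ge0 => j _; rewrite mulr_ge0 ?sqr_ge0 ?exprn_ge0.
Qed.

Lemma qiter_msq k r u M : holomorphic u -> 0 <= r < 1 ->
  bounded_on_disk M u -> r ^+ (2 * k) * msq r (qiter k u) <= M ^+ 2.
Proof.
move=> hu hr hM; apply: le_trans (bounded_msq hu hr hM).
rewrite (msq_expand k hu hr) lerDr coef_sum_ge0 //.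
by case/andP: hr.
Qed.

Lemma exprn_near1 r k : 0 <= r <= 1 -> 1 - r ^+ k <= k%:R * (1 - r).
Proof.
move=> /andP[r0 r1]; elim: k => [|k IH]; first by rewrite expr0 subrr mul0r.
have -> : 1 - r ^+ k.+1 = (1 - r ^+ k) + r ^+ k * (1 - r) by rewrite exprSr; ring.
have -> : k.+1%:R * (1 - r) = k%:R * (1 - r) + (1 - r).
  by rewrite -natr1 mulrDl mul1r.
by apply: lerD => //; rewrite ler_piMl ?subr_ge0 ?exprn_ile1.
Qed.

(** Bessel's inequality, by letting the radius tend to one. *)
Lemma coef_sum_bound k u M : holomorphic u -> bounded_on_disk M u ->
  \sum_(j < k) cabs (qiter j u 0) ^+ 2 <= M ^+ 2.
Proof.
move=> hu hM; set S := \sum_(j < k) _.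
have S0 : 0 <= S by apply: sumr_ge0 => j _; exact: sqr_ge0.
apply/ler_addgt0Pr => e e0.
pose m : R := 1 + (2 * k)%:R * S.
have m0 : 0 < m by rewrite ltr_wpDr // mulr_ge0.
pose d := Num.min 1 (e / m).
have d0 : 0 < d by rewrite lt_min ltr01 divr_gt0.
have d1 : d <= 1 by rewrite ge_min lexx.
have hr : 0 <= 1 - d < 1 by rewrite subr_ge0 d1 /= ltrBlDr ltrDl.
have A : S * (1 - d) ^+ (2 * k) <= M ^+ 2.
  apply: le_trans (bounded_msq hu hr hM); rewrite (msq_expand k hu hr).
  apply: (@le_trans _ _ (\sum_(j < k) cabs (qiter j u 0) ^+ 2 * (1 - d) ^+ (2 * j))).
    rewrite mulr_suml; apply: ler_sum => j _; rewrite ler_wpM2l ?sqr_ge0 //.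
    by apply: ler_wiXn2l; rewrite ?subr_ge0 // ?lerBlDr ?lerDl ?ltW // leq_mul2l /= ltnW.
  by rewrite lerDl mulr_ge0 ?msq_ge0 // exprn_ge0 // subr_ge0.
have B : 1 - (1 - d) ^+ (2 * k) <= (2 * k)%:R * d.
  have -> : d = 1 - (1 - d) by ring.
  rewrite {1}(_ : 1 - (1 - (1 - d)) = 1 - d); last by ring.
  by apply: exprn_near1; rewrite subr_ge0 d1 /= lerBlDr lerDl ltW.
have -> : S = S * (1 - d) ^+ (2 * k) + S * (1 - (1 - d) ^+ (2 * k)) by ring.
apply: lerD => //; apply: (@le_trans _ _ (S * ((2 * k)%:R * d))).
  by rewrite ler_wpM2l.
apply: (@le_trans _ _ (m * d)).
  rewrite mulrA; apply: ler_wpM2r; first exact: ltW.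
  by rewrite /m [S * _]mulrC lerDr.
have : d <= e / m by rewrite ge_min lexx orbT.
by rewrite ler_pdivlMr // mulrC.
Qed.

(** From |x| <= x^2 / (2 c) + c / 2. *)
Lemma rmean_le_msq r u (c : R) : holomorphic u -> 0 <= r < 1 -> 0 < c ->
  msq r u <= c ^+ 2 -> rmean (fun t => cabs (u (circ r t))) <= c.
Proof.
move=> hu hr c0 hc.
have ca : continuous (fun t => cabs (u (circ r t))).
  apply: cc_cabs; apply: cc_on_circ => //; exact: holomorphic_dcontinuous.
have c2 := msq_cont hu hr.
apply: (@le_trans _ _ (rmean (fun t => (2 * c)^-1 * cabs (u (circ r t)) ^+ 2 + c / 2))).
  apply: rmean_le => //.
    by apply: rcontD; [apply: rcontM => //; apply: cst_continuous|apply: cst_continuous].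
  move=> t; set x := cabs _; rewrite -subr_ge0.
  have -> : (2 * c)^-1 * x ^+ 2 + c / 2 - x = (2 * c)^-1 * (x - c) ^+ 2.
    by field; rewrite gt_eqF.
  by rewrite mulr_ge0 ?sqr_ge0 // invr_ge0 mulr_ge0 // ltW.
rewrite rmeanD; [|by apply: rcontM => //; apply: cst_continuous|by apply: cst_continuous].
rewrite rmean_cst rmeanZ // -/(msq r u).
have : (2 * c)^-1 * msq r u <= (2 * c)^-1 * c ^+ 2.
  by rewrite ler_wpM2l // invr_ge0 mulr_ge0 // ltW.
have -> : (2 * c)^-1 * c ^+ 2 = c / 2 by field; rewrite gt_eqF.
lra.
Qed.

Lemma qiter_bound k r u M z : holomorphic u -> bounded_on_disk M u -> 0 < M ->
  cabs z < r < 1 -> cabs (qiter k u z) <= r / (r - cabs z) * (M / r ^+ k).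
Proof.
move=> hu hM M0 hzr; have /andP[zr r1] := hzr.
have r0 : 0 < r by apply: le_lt_trans zr; exact: cabs_ge0.
have hr : 0 <= r < 1 by rewrite ltW.
apply: le_trans (cauchy_bound (@qiter_holo k u hu) hzr) _.
apply: ler_wpM2l; first by apply: divr_ge0; [exact: ltW|rewrite subr_ge0 ltW].
apply: (rmean_le_msq (@qiter_holo k u hu) hr).
  by rewrite divr_gt0 // exprn_gt0.
have := @qiter_msq k r u M hu hr hM.
by rewrite expr_div_n -exprM mulnC ler_pdivlMr ?exprn_gt0 // mulrC.
Qed.

Lemma taylor_tail u M (rho e : R) : holomorphic u -> bounded_on_disk M u -> 0 < M ->
  0 <= rho < 1 -> 0 < e -> exists N, forall k, (N <= k)%N ->
  forall z, cabs z <= rho -> cabs (z ^+ k * qiter k u z) <= e.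
Proof.
move=> hu hM M0 /andP[p0 p1] e0.
have [r r1 pr] : exists2 r, r < 1 & rho < r by exists ((1 + rho) / 2); lra.
have r0 : 0 < r by apply: le_lt_trans pr.
have q01 : 0 <= rho / r < 1.
  by rewrite divr_ge0 ?(ltW r0) //= ltr_pdivrMr // mul1r.
have [N hN] := geometric_small (r / (r - rho) * M) q01 e0.
exists N => k hk z hz; apply: le_trans (hN k hk); rewrite cabsM cabsX.
have zr : cabs z < r < 1 by rewrite (le_lt_trans hz pr).
have X := qiter_bound k hu hM M0 zr.
apply: (@le_trans _ _ (rho ^+ k * (r / (r - rho) * (M / r ^+ k)))); last first.
  rewrite expr_div_n; set i := (r - rho)^-1; set j := (r ^+ k)^-1; set x := rho ^+ k.
  by rewrite le_eqVlt; apply/orP; left; apply/eqP; ring.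
apply: ler_pM; rewrite ?exprn_ge0 ?cabs_ge0 //.
  by rewrite lerXn2r ?nnegrE ?cabs_ge0.
apply: le_trans X _; apply: ler_wpM2r.
  by apply: divr_ge0; [exact: ltW|apply: exprn_ge0; exact: ltW].
apply: ler_wpM2l; first exact: ltW.
rewrite lef_pV2 ?posrE ?subr_gt0 //; last by case/andP: zr.
by rewrite lerB.
Qed.

End TaylorCoefficients.

(** * Weak convergence and the Banach-Saks argument *)

Section WeakConvergence.
Variable R : realType.
Local Notation C := (R[i]^o).
Implicit Types (f g h v : C -> C) (z w : C) (r M e : R) (u : nat -> C -> C).
Local Notation circ := (@circle_point R).

Lemma bounded_partial_sums (S : nat -> R) (K e : R) :
  (forall k, S k <= K) -> 0 < e -> exists N, forall k, S k <= S N + e.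
Proof.
move=> hS e0; pose A := [set x | exists k, x = S k].
have hA : has_sup A by split; [exists (S 0%N), 0%N|exists K => _ [k ->]].
have [x [N ->] hN] := sup_adherent e0 hA.
exists N => k; apply: (@le_trans _ _ (sup A)); last by rewrite -lerBlDr ltW.
by apply: sup_upper_bound => //; exists k.
Qed.

(** Bessel's inequality makes the tail of the coefficients small, uniformly in
    the radius of the circle. *)
Lemma tail_msq v M e : holomorphic v -> bounded_on_disk M v -> 0 < M -> 0 < e ->
  exists N, forall r, 0 <= r < 1 -> r ^+ (2 * N) * msq r (qiter N v) <= e.
Proof.
move=> hv hM M0 e0.
pose S k := \sum_(j < k) cabs (qiter j v 0) ^+ 2.
have hS k : S k <= M ^+ 2 by exact: coef_sum_bound.
have e2 : 0 < e / 2 by rewrite divr_gt0.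
have [N hN] := bounded_partial_sums hS e2; exists N => r hr.
pose c := Num.min 1 (e / 2).
have c0 : 0 < c by rewrite lt_min ltr01.
have c1 : c ^+ 2 <= e / 2.
  have ce : c <= e / 2 by rewrite ge_min lexx orbT.
  apply: le_trans ce; rewrite expr2 ler_piMl // ?(ltW c0) //.
  by rewrite ge_min lexx.
have [K hK] := taylor_tail hv hM M0 hr c0.
pose k := maxn K N; have Nk : (N <= k)%N by rewrite leq_maxr.
have /andP[r0 r1] := hr.
have T : r ^+ (2 * k) * msq r (qiter k v) <= e / 2.
  apply: le_trans c1.
  have hq : holomorphic (fun w => w ^+ k * qiter k v w).
    apply/holomorphic_cdiff => z hz.
    have /holomorphic_cdiff/(_ z hz)[d hd] := @qiter_holo R k v hv.
    by eexists; exact: cdiffM (cdiff_expr z k) hd.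
  have -> : r ^+ (2 * k) * msq r (qiter k v) = msq r (fun w => w ^+ k * qiter k v w).
    rewrite /msq -rmeanZ; last exact: (msq_cont (@qiter_holo R k v hv) hr).
    apply: rmean_eq => t; rewrite cabsM cabsX exprMn (cabs_circ t r0).
    by rewrite -exprM mulnC.
  apply: (msq_bound hq hr) => t; apply: hK; first by rewrite leq_maxl.
  by rewrite cabs_circ.
have E1 := msq_expand N hv hr; have E2 := msq_expand k hv hr.
have -> : r ^+ (2 * N) * msq r (qiter N v) = msq r v -
    \sum_(j < N) cabs (qiter j v 0) ^+ 2 * r ^+ (2 * j).
  by rewrite E1 addrC addKr.
have L : \sum_(j < k) cabs (qiter j v 0) ^+ 2 * r ^+ (2 * j) -
   \sum_(j < N) cabs (qiter j v 0) ^+ 2 * r ^+ (2 * j) <= S k - S N.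
  rewrite /S -!(big_mkord xpredT (fun j => cabs (qiter j v 0) ^+ 2 * r ^+ (2 * j))).
  rewrite -!(big_mkord xpredT (fun j => cabs (qiter j v 0) ^+ 2)).
  rewrite !(big_cat_nat (leq0n N) Nk) /= [X in X <= _]addrAC subrr add0r [X in _ <= X]addrAC subrr add0r.
  apply: ler_sum => j _; rewrite ler_piMr ?sqr_ge0 //.
  by apply: exprn_ile1 => //; exact: ltW.
rewrite E2 addrAC; apply: le_trans (lerD L T) _.
have := hN k; lra.
Qed.

Definition pointwise0 u := forall z, disk z -> forall e, 0 < e ->
  exists N, forall m, (N <= m)%N -> cabs (u m z) <= e.

(** The Taylor coefficients of a bounded sequence that tends to zero pointwise
    tend to zero. *)
Lemma qiter_pointwise0 k u M : (forall m, holomorphic (u m)) ->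
  (forall m, bounded_on_disk M (u m)) -> 0 < M -> pointwise0 u ->
  pointwise0 (fun m => qiter k (u m)).
Proof.
move=> hu hM M0 h0; elim: k => [|k IH]; first exact: h0.
have D z : disk z -> z != 0 -> forall e, 0 < e ->
    exists N, forall m, (N <= m)%N -> cabs (qiter k.+1 (u m) z) <= e.
  move=> hz z0 e e0; have zp : 0 < cabs z by rewrite cabs_gt0.
  have e2 : 0 < e * cabs z / 2 by rewrite divr_gt0 // mulr_gt0.
  have [N1 h1] := IH z hz _ e2; have [N2 h2] := IH 0 (@disk0 R) _ e2.
  exists (maxn N1 N2) => m; rewrite geq_max => /andP[/h1 l1 /h2 l2].
  rewrite qiterS /dquot (negbTE z0) subr0 cabsM cabsV ler_pdivrMr //.
  apply: le_trans (cabsB _ _) _; apply: le_trans (lerD l1 l2) _.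
  by rewrite -splitr.
move=> z hz; have [->|z0] := eqVneq z 0; last exact: D.
move=> e e0.
(* at the origin, compare with a nearby point through the next quotient *)
pose r1 : R := 2^-1.
have r10 : 0 < r1 by rewrite invr_gt0.
have r14 : 4^-1 < r1 by rewrite /r1 ltf_pV2 ?posrE // ltr_nat.
have r11 : r1 < 1 by rewrite /r1 invf_lt1 ?ltr1n.
have [B B0 BE] : exists2 B, 0 < B & B = r1 / (r1 - 4^-1) * (M / r1 ^+ k.+2).
  eexists; last reflexivity.
  apply: mulr_gt0; apply: divr_gt0 => //; last exact: exprn_gt0.
  by rewrite subr_gt0.
pose x := Num.min (4^-1) (e / (2 * B)).
have x0 : 0 < x by rewrite lt_min invr_gt0 /= ltr0n /= divr_gt0 // mulr_gt0.
have x4 : x <= 4^-1 by rewrite ge_min lexx.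
have xB : x * B <= e / 2.
  have : x <= e / (2 * B) by rewrite ge_min lexx orbT.
  rewrite ler_pdivlMr ?mulr_gt0 // => h.
  by rewrite ler_pdivlMr // mulrAC -mulrA.
have cx : cabs (x%:C : C) = x by rewrite cabs_real gtr0_norm.
have dx : disk (x%:C : C).
  by rewrite /disk /= cx (le_lt_trans x4) // (lt_trans r14).
have xn0 : (x%:C : C) != 0 by rewrite -cabs_gt0 cx.
have e2 : 0 < e / 2 by rewrite divr_gt0.
have [N hN] := D _ dx xn0 _ e2; exists N => m /hN hm.
have E := dquot0E (qiter k.+1 (u m)) x%:C.
have -> : qiter k.+1 (u m) 0 = qiter k.+1 (u m) x%:C - x%:C * qiter k.+2 (u m) x%:C.
  by rewrite E addrK.
apply: le_trans (cabsB _ _) _; rewrite [e]splitr; apply: lerD => //.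
rewrite cabsM cx; apply: le_trans xB; rewrite ler_wpM2l ?(ltW x0) //.
have xr : cabs (x%:C : C) < r1 < 1 by rewrite cx (le_lt_trans x4).
apply: le_trans (qiter_bound k.+2 (hu m) (hM m) M0 xr) _; rewrite BE cx.
apply: ler_wpM2r; first by rewrite divr_ge0 ?exprn_ge0 ?(ltW M0) ?(ltW r10).
apply: ler_wpM2l; first exact: ltW.
have xr1 : x < r1 by rewrite (le_lt_trans x4).
by rewrite lef_pV2 ?posrE ?subr_gt0 // lerB.
Qed.

Lemma finite_pointwise0 (n : nat) (x : nat -> nat -> R) e : 0 < e ->
  (forall j, exists N, forall m, (N <= m)%N -> x j m <= e) ->
  exists N, forall m, (N <= m)%N -> forall j, (j < n)%N -> x j m <= e.
Proof.
move=> e0 h; elim: n => [|n [N hN]]; first by exists 0%N.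
have [N' hN'] := h n; exists (maxn N N') => m; rewrite geq_max => /andP[h1 h2] j.
by rewrite ltnS leq_eqVlt => /orP[/eqP ->|/(hN m h1)] //; exact: hN'.
Qed.

Lemma inner_bound r g v (s : R) : holomorphic g -> holomorphic v -> 0 <= r < 1 -> 0 < s ->
  cabs (inner r g v) <= (s * msq r g + msq r v / s) / 2.
Proof.
move=> hg hv hr s0; apply: le_trans (mean_norm (cc_inner hg hv hr)) _.
have c1 := msq_cont hg hr; have c2 := msq_cont hv hr.
have C1 : continuous (fun t => (s / 2) * cabs (g (circ r t)) ^+ 2).
  by apply: rcontM => //; apply: cst_continuous.
have C2 : continuous (fun t => (2 * s)^-1 * cabs (v (circ r t)) ^+ 2).
  by apply: rcontM => //; apply: cst_continuous.
apply: (@le_trans _ _ (rmean (fun t => s / 2 * cabs (g (circ r t)) ^+ 2 +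
   (2 * s)^-1 * cabs (v (circ r t)) ^+ 2))).
  apply: rmean_le; [by apply: cc_cabs; exact: cc_inner|exact: rcontD|].
  move=> t; rewrite cabsM cabs_conj; set a := cabs _; set b := cabs _.
  rewrite -subr_ge0.
  have -> : s / 2 * a ^+ 2 + (2 * s)^-1 * b ^+ 2 - a * b =
     (2 * s)^-1 * (s * a - b) ^+ 2 by field; rewrite gt_eqF.
  by rewrite mulr_ge0 ?sqr_ge0 // invr_ge0 mulr_ge0 // ltW.
rewrite rmeanD // !rmeanZ // -/(msq r g) -/(msq r v).
by rewrite le_eqVlt; apply/orP; left; apply/eqP; field; rewrite gt_eqF.
Qed.

(** Bounded pointwise convergence to zero is weak convergence: the inner
    products with a fixed bounded function tend to zero, uniformly over all
    circles. *)
Lemma inner_small u M v M' e : (forall m, holomorphic (u m)) ->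
  (forall m, bounded_on_disk M (u m)) -> 0 < M -> pointwise0 u ->
  holomorphic v -> bounded_on_disk M' v -> 0 < M' -> 0 < e ->
  exists m, forall r, 0 <= r < 1 -> cabs (inner r (u m) v) <= e.
Proof.
move=> hu hM M0 h0 hv hM' M'0 e0.
pose s := e / (2 * M ^+ 2).
have s0 : 0 < s by rewrite divr_gt0 // mulr_gt0 // exprn_gt0.
have se : 0 < s * (e / 2) by rewrite mulr_gt0 // divr_gt0.
have [N hN] := tail_msq hv hM' M'0 se.
pose T := 1 + \sum_(j < N) cabs (qiter j v 0).
have T0 : 0 < T by rewrite ltr_wpDr // sumr_ge0 // => j _; exact: cabs_ge0.
have eT : 0 < e / 2 / T by rewrite !divr_gt0.
have [m hm] : exists m, forall j, (j < N)%N -> cabs (qiter j (u m) 0) <= e / 2 / T.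
  have [|m hm] := @finite_pointwise0 N (fun j m => cabs (qiter j (u m) 0)) _ eT.
    by move=> j; exact: (qiter_pointwise0 j hu hM M0 h0 (@disk0 R) eT).
  by exists m => j hj; apply: hm.
exists m => r hr; have /andP[r0 r1] := hr.
rewrite (inner_expand N (hu m) hv hr).
apply: le_trans (cabsD _ _) _; rewrite [e]splitr; apply: lerD.
  apply: (@le_trans _ _ (\sum_(j < N) e / 2 / T * cabs (qiter j v 0))).
    apply: (@le_trans _ _ (\sum_(j < N)
        cabs (qiter j (u m) 0 * (qiter j v 0)^* * (r ^+ (2 * j))%:C))).
      elim/big_ind2: _ => [|x1 x2 y1 y2 h1 h2|//]; first by rewrite cabs0.
      by apply: le_trans (cabsD _ _) _; exact: lerD.
    apply: ler_sum => j _; rewrite !cabsM cabs_conj cabs_real.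
    rewrite ger0_norm ?exprn_ge0 //.
    apply: (@le_trans _ _ (cabs (qiter j (u m) 0) * cabs (qiter j v 0))).
      by rewrite ler_piMr ?mulr_ge0 ?cabs_ge0 // exprn_ile1 // ltW.
    by rewrite ler_wpM2r ?cabs_ge0 // hm.
  rewrite -mulr_sumr mulrAC ler_pdivrMr //.
  by rewrite ler_wpM2l ?divr_ge0 ?(ltW e0) // lerDr.
rewrite cabsM cabs_real ger0_norm ?exprn_ge0 //.
have hqu := @qiter_holo R N (u m) (hu m); have hqv := @qiter_holo R N v hv.
apply: le_trans (ler_wpM2l _ (inner_bound hqu hqv hr s0)) _; first exact: exprn_ge0.
have A := qiter_msq N (hu m) hr (hM m); have B := hN r hr.
set p := r ^+ (2 * N) in A B *; set a := msq r _ in A *; set b := msq r _ in B *.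
have -> : p * ((s * a + b / s) / 2) = (s * (p * a) + (p * b) / s) / 2.
  by set i := s^-1; field.
have A' : s * (p * a) <= e / 2.
  apply: le_trans (ler_wpM2l (ltW s0) A) _.
  rewrite /s le_eqVlt; apply/orP; left; apply/eqP; field.
  by rewrite gt_eqF.
have B' : p * b / s <= e / 2 by rewrite ler_pdivrMr // [_ * s]mulrC.
lra.
Qed.

Definition sumf u (s : seq nat) z : C := \sum_(m <- s) u m z.

Lemma sumf_cons u m s z : sumf u (m :: s) z = u m z + sumf u s z.
Proof. by rewrite /sumf big_cons. Qed.

Lemma sumf_holo u s : (forall m, holomorphic (u m)) -> holomorphic (sumf u s).
Proof.
move=> hu; elim: s => [|m s IH].
  apply: (holomorphic_eq (f := fun=> 0)) => [z _|]; first by rewrite /sumf big_nil.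
  by apply/holomorphic_cdiff => z _; exists 0; exact: cdiff_cst.
apply: (holomorphic_eq (f := fun z => u m z + sumf u s z)) => [z _|].
  by rewrite sumf_cons.
apply/holomorphic_cdiff => z hz.
have /holomorphic_cdiff/(_ z hz)[d1 hd1] := hu m.
have /holomorphic_cdiff/(_ z hz)[d2 hd2] := IH.
by exists (d1 + d2); exact: cdiffD.
Qed.

Lemma sumf_bounded u s M : (forall m, bounded_on_disk M (u m)) ->
  bounded_on_disk ((size s)%:R * M) (sumf u s).
Proof.
move=> hM z hz; elim: s => [|m s IH].
  by rewrite /sumf big_nil cabs0 mul0r.
rewrite sumf_cons /= -natr1 mulrDl mul1r [X in _ <= X]addrC.
by apply: le_trans (cabsD _ _) _; apply: lerD => //; exact: hM.
Qed.

Lemma msqD r f g : holomorphic f -> holomorphic g -> 0 <= r < 1 ->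
  msq r (fun z => f z + g z) <= msq r f + msq r g + 2 * cabs (inner r f g).
Proof.
move=> hf hg hr.
have c1 := msq_cont hf hr; have c2 := msq_cont hg hr.
have ci := cc_inner hf hg hr.
have [ci1 _] := ci.
have c3 : continuous (fun t => 2 * complex.Re (f (circ r t) * (g (circ r t))^*)).
  by apply: rcontM => //; apply: cst_continuous.
have E : msq r (fun z => f z + g z) = msq r f + msq r g + 2 * complex.Re (inner r f g).
  have -> : complex.Re (inner r f g) =
      rmean (fun t => complex.Re (f (circ r t) * (g (circ r t))^*)).
    by rewrite /inner /mean creM /= mul0r subr0.
  rewrite /msq -rmeanZ // -!rmeanD //; last exact: rcontD.
  apply: rmean_eq => t; rewrite !cabs_sqr creD cimD creM.
  by case: (g _) => x y /=; ring.
by rewrite E lerD2l ler_wpM2l // (le_trans (ler_norm _)) // absRe_cabs.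
Qed.

(** Greedy choice, each new term being almost orthogonal to the sum of the
    earlier ones. *)
Lemma almost_orthogonal u M : (forall m, holomorphic (u m)) ->
  (forall m, bounded_on_disk M (u m)) -> 0 < M -> pointwise0 u ->
  forall L, exists2 s, size s = L & forall r, 0 <= r < 1 ->
    msq r (sumf u s) <= L%:R * (M ^+ 2 + 1).
Proof.
move=> hu hM M0 h0; elim=> [|L [s sL hs]].
  exists [::] => // r hr; rewrite mul0r.
  apply: (@le_trans _ _ (0 ^+ 2)); last by rewrite expr0n.
  apply: msq_bound => //; first exact: sumf_holo.
  by move=> t; rewrite /sumf big_nil cabs0.
have hS := @sumf_holo u s hu.
have hB : bounded_on_disk (L%:R * M + 1) (sumf u s).
  move=> z hz; apply: le_trans (sumf_bounded s hM hz) _.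
  by rewrite sL lerDl.
have B0 : 0 < L%:R * M + 1 by rewrite ltr_wpDl // mulr_ge0 // ltW.
have h2 : 0 < 2^-1 :> R by rewrite invr_gt0.
have [m hm] := inner_small hu hM M0 h0 hS hB B0 h2.
exists (m :: s) => [|r hr]; first by rewrite /= sL.
have -> : sumf u (m :: s) = fun z => u m z + sumf u s z.
  by apply/funext => z; rewrite sumf_cons.
apply: le_trans (msqD (hu m) hS hr) _.
have := hm r hr; have := hs r hr; have := bounded_msq (hu m) hr (hM m).
have -> : L.+1%:R * (M ^+ 2 + 1) = L%:R * (M ^+ 2 + 1) + (M ^+ 2 + 1).
  by rewrite -natr1; ring.
by move=> a b c; move: (L%:R * _) b => y b; lra.
Qed.

(** Averages of L almost orthogonal functions have mean square of order 1 / L. *)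
Theorem banach_saks u M e : (forall m, holomorphic (u m)) ->
  (forall m, bounded_on_disk M (u m)) -> 0 < M -> pointwise0 u -> 0 < e ->
  exists s, (0 < size s)%N /\ forall r, 0 <= r < 1 ->
    msq r (fun z => ((size s)%:R^-1)%:C * sumf u s z) <= e.
Proof.
move=> hu hM M0 h0 e0.
pose K := M ^+ 2 + 1; have K0 : 0 < K by rewrite ltr_wpDl // sqr_ge0.
pose L := (Num.bound (K / e)).+1.
have hL : K / e < L%:R.
  have := archi_boundP (ltW (divr_gt0 K0 e0)) => /lt_trans; apply.
  by rewrite ltr_nat.
have [s sL hs] := almost_orthogonal hu hM M0 h0 L.
exists s; rewrite sL; split=> // r hr.
have L0 : 0 < L%:R :> R by rewrite ltr0n.
have -> : msq r (fun z => (L%:R^-1)%:C * sumf u s z) = (L%:R^-1) ^+ 2 * msq r (sumf u s).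
  rewrite /msq -rmeanZ; last by apply: (msq_cont _ hr); exact: sumf_holo.
  by apply: rmean_eq => t; rewrite cabsM exprMn cabs_real ger0_norm // invr_ge0 ler0n.
apply: le_trans (ler_wpM2l (sqr_ge0 _) (hs r hr)) _; rewrite -/K.
have -> : L%:R^-1 ^+ 2 * (L%:R * K) = K / L%:R by field; rewrite gt_eqF.
by rewrite ler_pdivrMr // mulrC -ler_pdivrMr // ltW.
Qed.

End WeakConvergence.

(** * Bounded pointwise convergence *)

Section BoundedConvergence.
Variable R : realType.
Local Notation C := (R[i]^o).
Implicit Types (f g h v : C -> C) (z w : C) (r M e : R) (u : nat -> C -> C).
Local Notation circ := (@circle_point R).

Lemma hardy_ooP f : hardy +oo%E f <->
  holomorphic f /\ exists2 M : R, 0 < M & bounded_on_disk M f.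
Proof.
split=> [[hf]|[hf [M M0 hM]]]; last first.
  split=> //; apply: (@le_lt_trans _ _ (M%:E)); last by rewrite ltry.
  by apply: ge_ereal_sup => _ [z hz <-]; rewrite lee_fin; exact: hM.
rewrite /hardy_norm; set S := ereal_sup _ => hS; split=> //.
have H z : disk z -> ((cabs (f z))%:E <= S)%E.
  by move=> hz; apply: ereal_sup_ubound; exists z.
have S0 : (0 <= S)%E.
  by apply: le_trans (H 0 (@disk0 R)); rewrite lee_fin cabs_ge0.
have Sf : S \is a fin_num by rewrite ge0_fin_numE.
exists (1 + fine S); first by rewrite ltr_wpDr // fine_ge0.
move=> z /H; rewrite -{1}(fineK Sf) lee_fin => h; apply: le_trans h _.
by rewrite lerDr.
Qed.

Lemma hardy_oo_eq f g : (forall z, disk z -> f z = g z) ->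
  hardy +oo%E f -> hardy +oo%E g.
Proof.
move=> E /hardy_ooP[hf [M M0 hM]]; apply/hardy_ooP; split.
  exact: holomorphic_eq hf.
by exists M => // z hz; rewrite -E //; exact: hM.
Qed.

Lemma hardy_ooD f g : hardy +oo%E f -> hardy +oo%E g ->
  hardy +oo%E (fun z => f z + g z).
Proof.
move=> /hardy_ooP[hf [M M0 hM]] /hardy_ooP[hg [N N0 hN]]; apply/hardy_ooP; split.
  apply/holomorphic_cdiff => z hz.
  have /holomorphic_cdiff/(_ z hz)[d1 h1] := hf.
  have /holomorphic_cdiff/(_ z hz)[d2 h2] := hg.
  by exists (d1 + d2); exact: cdiffD.
exists (M + N); first by rewrite addr_gt0.
by move=> z hz; apply: le_trans (cabsD _ _) (lerD (hM z hz) (hN z hz)).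
Qed.

Lemma hardy_ooM f g : hardy +oo%E f -> hardy +oo%E g ->
  hardy +oo%E (fun z => f z * g z).
Proof.
move=> /hardy_ooP[hf [M M0 hM]] /hardy_ooP[hg [N N0 hN]]; apply/hardy_ooP; split.
  apply/holomorphic_cdiff => z hz.
  have /holomorphic_cdiff/(_ z hz)[d1 h1] := hf.
  have /holomorphic_cdiff/(_ z hz)[d2 h2] := hg.
  by eexists; exact: cdiffM h1 h2.
exists (M * N); first by rewrite mulr_gt0.
by move=> z hz; rewrite cabsM ler_pM ?cabs_ge0 ?hM ?hN.
Qed.

Lemma hardy_oo_cst (c : C) : hardy +oo%E (fun=> c).
Proof.
apply/hardy_ooP; split.
  by apply/holomorphic_cdiff => z _; exists 0; exact: cdiff_cst.
exists (1 + cabs c) => [|z _]; first by rewrite ltr_wpDr ?cabs_ge0.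
by rewrite lerDr.
Qed.

Lemma hardy_oo_id : hardy +oo%E (fun z : C => z).
Proof.
apply/hardy_ooP; split.
  by apply/holomorphic_cdiff => z _; exists 1; exact: cdiff_id.
by exists 1 => // z /ltW.
Qed.

(** The constant depends on the bound of f only, not on f itself. *)
Lemma dquot_lipschitz f M r d z w w' : holomorphic f -> bounded_on_disk M f ->
  0 < M -> r < 1 -> 0 < d -> cabs z + d <= r -> cabs w + d <= r -> cabs w' + d <= r ->
  cabs (dquot f z w - dquot f z w') <= M * r / d ^+ 3 * cabs (w - w').
Proof.
move=> hf hM M0 r1 d0 zd wd wd'.
have lt x : cabs x + d <= r -> cabs x < r by move=> h; rewrite (lt_le_trans _ h) // ltrDl.
have zr := lt _ zd; have wr := lt _ wd; have wr' := lt _ wd'.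
have r0 : 0 < r by apply: le_lt_trans zr; exact: cabs_ge0.
have hr : 0 <= r < 1 by rewrite ltW.
have ge x t : cabs x + d <= r -> d <= cabs (circ r t - x).
  by move=> h; apply: le_trans (circ_sub_ge x t (ltW r0)); rewrite lerBrDr addrC.
have cfc := cc_on_circ (holomorphic_dcontinuous hf) hr.
have cU : cc (fun t => f (circ r t) / (circ r t - z)).
  by apply: ccM => //; exact: cc_circ_sub.
rewrite !(dquot_cauchy (r := r)) ?zr // -meanB; [|exact: cc_cauchy..].
apply: mean_bound => [|t]; first by apply: ccB; exact: cc_cauchy.
have c1 := circ_sub_neq0 t zr; have c2 := circ_sub_neq0 t wr.
have c3 := circ_sub_neq0 t wr'.
have -> : f (circ r t) / (circ r t - z) * (circ r t / (circ r t - w)) -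
   f (circ r t) / (circ r t - z) * (circ r t / (circ r t - w')) =
   f (circ r t) * circ r t * ((circ r t - z) * (circ r t - w) * (circ r t - w'))^-1 * (w - w').
  by field; rewrite c1 c2 c3.
rewrite !cabsM cabsV !cabsM (cabs_circ t (ltW r0)); apply: ler_wpM2r; first exact: cabs_ge0.
apply: ler_pM.
- by rewrite mulr_ge0 ?cabs_ge0 // ltW.
- by rewrite invr_ge0 !mulr_ge0 ?cabs_ge0.
- by apply: ler_wpM2r; [exact: ltW|apply: hM; exact: disk_circ].
rewrite lef_pV2 ?posrE ?exprn_gt0 ?mulr_gt0 ?cabs_gt0 //.
have -> : d ^+ 3 = d * d * d by ring.
have dd := ltW d0.
apply: ler_pM; [by apply: mulr_ge0|by []| |exact: ge].
by apply: ler_pM; [by []|by []|exact: ge|exact: ge].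
Qed.

Lemma bp_bound u f : bp_cvg u f -> exists2 M : R, 0 < M &
  (forall k, bounded_on_disk M (u k)) /\ bounded_on_disk M f.
Proof.
move=> [[M hM] hl]; exists (1 + `|M|); first by rewrite ltr_wpDr.
have B k : bounded_on_disk (1 + `|M|) (u k).
  move=> z hz; apply: le_trans (hM k z hz) _; apply: le_trans (ler_norm _) _.
  by rewrite lerDr.
split=> // z hz; apply/ler_addgt0Pr => e e0.
have /cvg_seqC_P/(_ e e0)[N hN] := hl z hz.
have -> : f z = u N z - (u N z - f z) by ring.
by apply: le_trans (cabsB _ _) _; apply: lerD; [exact: B|exact: hN].
Qed.

(** A bounded pointwise limit of holomorphic functions is holomorphic: the
    difference quotients are Lipschitz with a constant independent of the
    function, so the quotient of the limit is Lipschitz too and extends to the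
    centre. *)
Theorem bp_hardy_oo u f : (forall k, holomorphic (u k)) -> bp_cvg u f ->
  hardy +oo%E f.
Proof.
move=> hu hbp; have [M M0 [hM hMf]] := bp_bound hbp; have [_ hl] := hbp.
apply/hardy_ooP; split; last by exists M.
apply/holomorphic_cdiff => z hz; rewrite /disk /= in hz.
pose d := (1 - cabs z) / 3; pose r := cabs z + 2 * d.
have d0 : 0 < d by rewrite divr_gt0 // subr_gt0.
have r1 : r < 1 by rewrite /r /d; lra.
have zd : cabs z + d <= r by rewrite /r; lra.
have wd w : cabs (w - z) <= d -> cabs w + d <= r.
  move=> h; have : cabs w <= cabs (w - z) + cabs z by rewrite -{1}(subrK z w) cabsD.
  by rewrite /r; lra.
have dk x : cabs x + d <= r -> disk x.
  by move=> h; apply: le_lt_trans r1; apply: le_trans h; rewrite lerDl ltW.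
have hzd := dk z zd.
pose K := M * r / d ^+ 3.
pose F w := (f w - f z) / (w - z).
have r0 : 0 <= r by rewrite /r addr_ge0 ?cabs_ge0 // mulr_ge0 // ltW.
have K0 : 0 <= K.
  by rewrite /K; apply: divr_ge0; [apply: mulr_ge0 => //; exact: ltW|apply: exprn_ge0; exact: ltW].
have cvF w : w != z -> cabs (w - z) <= d -> forall e, 0 < e -> exists N, forall k,
    (N <= k)%N -> cabs (dquot (u k) z w - F w) <= e.
  move=> wz hw e e0.
  have wp : 0 < cabs (w - z) by rewrite cabs_gt0 subr_eq0.
  have e2 : 0 < e * cabs (w - z) / 2 by rewrite divr_gt0 // mulr_gt0.
  have /cvg_seqC_P/(_ _ e2)[N1 h1] := hl z hzd.
  have /cvg_seqC_P/(_ _ e2)[N2 h2] := hl w (dk w (wd w hw)).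
  exists (maxn N1 N2) => k; rewrite geq_max => /andP[/h1 l1 /h2 l2].
  rewrite /dquot (negbTE wz) /F -mulrBl cabsM cabsV ler_pdivrMr //.
  have -> : u k w - u k z - (f w - f z) = (u k w - f w) - (u k z - f z) by ring.
  apply: le_trans (cabsB _ _) _; apply: le_trans (lerD l2 l1) _.
  by rewrite -splitr.
have LF w w' : w != z -> w' != z -> cabs (w - z) <= d -> cabs (w' - z) <= d ->
    cabs (F w - F w') <= K * cabs (w - w').
  move=> wz wz' hw hw'; apply/ler_addgt0Pr => e e0.
  have e2 : 0 < e / 2 by rewrite divr_gt0.
  have [N1 h1] := cvF w wz hw _ e2; have [N2 h2] := cvF w' wz' hw' _ e2.
  pose k := maxn N1 N2; have l1 := h1 k (leq_maxl _ _); have l2 := h2 k (leq_maxr _ _).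
  have l3 := @dquot_lipschitz (u k) M r d z w w' (hu k) (hM k) M0 r1 d0 zd (wd _ hw) (wd _ hw').
  have -> : F w - F w' = (dquot (u k) z w - dquot (u k) z w')
     - (dquot (u k) z w - F w) + (dquot (u k) z w' - F w') by ring.
  apply: le_trans (cabsD _ _) _; apply: le_trans (lerD (cabsB _ _) l2) _.
  apply: le_trans (lerD (lerD l3 l1) (lexx _)) _.
  by rewrite -addrA -splitr.
pose x n : C := z + (d / n.+1%:R)%:C.
have xz n : x n - z = (d / n.+1%:R)%:C by rewrite /x addrC addKr.
have cx n : cabs (x n - z) = d / n.+1%:R.
  by rewrite xz cabs_real ger0_norm // divr_ge0 // ltW.
have xn n : x n != z by rewrite -subr_eq0 -cabs_gt0 cx divr_gt0.
have xd n : cabs (x n - z) <= d.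
  by rewrite cx ler_pdivrMr // ler_peMr ?(ltW d0) // ler1n.
have xs (e : R) : 0 < e -> exists N, forall n, (N <= n)%N -> cabs (x n - z) <= e.
  move=> e0; exists (Num.bound (d / e)) => n hn; rewrite cx.
  rewrite ler_pdivrMr // mulrC -ler_pdivrMr //.
  have := archi_boundP (ltW (divr_gt0 d0 e0)) => /ltW /le_trans; apply.
  by rewrite ler_nat ltnW.
have [l hlim] : exists l : C, forall e, 0 < e -> exists N, forall n, (N <= n)%N ->
    cabs (F (x n) - l) <= e.
  apply: C_cauchy => e e0.
  have K1 : 0 < 2 * (1 + K) by rewrite mulr_gt0 // ltr_wpDr.
  have [N hN] := xs _ (divr_gt0 e0 K1); exists N => n m hn hm.
  apply: le_trans (LF _ _ (xn n) (xn m) (xd n) (xd m)) _.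
  have -> : x n - x m = (x n - z) - (x m - z) by ring.
  apply: (@le_trans _ _ ((1 + K) * (e / (2 * (1 + K)) + e / (2 * (1 + K))))).
    apply: ler_pM => //; rewrite ?cabs_ge0 ?lerDr //.
    by apply: le_trans (cabsB _ _) _; apply: lerD; exact: hN.
  by rewrite le_eqVlt; apply/orP; left; apply/eqP; field; rewrite gt_eqF // ltr_wpDr.
have Fl w : w != z -> cabs (w - z) <= d -> cabs (F w - l) <= K * cabs (w - z).
  move=> wz hw; apply/ler_addgt0Pr => e e0.
  have e2 : 0 < e / 2 by rewrite divr_gt0.
  have K1 : 0 < 2 * (1 + K) by rewrite mulr_gt0 // ltr_wpDr.
  have [N1 h1] := hlim _ e2; have [N2 h2] := xs _ (divr_gt0 e0 K1).
  pose n := maxn N1 N2; have l1 := h1 n (leq_maxl _ _); have l2 := h2 n (leq_maxr _ _).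
  have -> : F w - l = (F w - F (x n)) + (F (x n) - l) by ring.
  apply: le_trans (cabsD _ _) _.
  apply: le_trans (lerD (LF _ _ wz (xn n) hw (xd n)) l1) _.
  have -> : w - x n = (w - z) - (x n - z) by ring.
  apply: (@le_trans _ _ (K * (cabs (w - z) + e / (2 * (1 + K))) + e / 2)).
    rewrite lerD2r ler_wpM2l //; apply: le_trans (cabsB _ _) _.
    by rewrite lerD2l.
  have : K * (e / (2 * (1 + K))) <= e / 2.
    apply: (@le_trans _ _ ((1 + K) * (e / (2 * (1 + K))))).
      by apply: ler_wpM2r; [rewrite ltW // divr_gt0|rewrite lerDr].
    by rewrite le_eqVlt; apply/orP; left; apply/eqP; field; rewrite gt_eqF // ltr_wpDr.
  by rewrite mulrDr; lra.
exists l => e e0; have K1 : 0 < 1 + K by rewrite ltr_wpDr.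
exists (Num.min d (e / (1 + K))); first by rewrite lt_min d0 divr_gt0.
move=> w; rewrite lt_min => /andP[wd1 we].
have [->|wz] := eqVneq w z; first by rewrite !subrr mulr0 subr0 cabs0 mulr0.
have wz0 : w - z != 0 by rewrite subr_eq0.
have -> : f w - f z - l * (w - z) = (F w - l) * (w - z) by rewrite /F; field.
rewrite cabsM ler_wpM2r ?cabs_ge0 //; apply: le_trans (Fl w wz (ltW wd1)) _.
apply: (@le_trans _ _ ((1 + K) * cabs (w - z))).
  by rewrite ler_wpM2r ?cabs_ge0 // lerDr.
by rewrite mulrC -ler_pdivlMr // ltW.
Qed.

(** Dilating first makes the Taylor sums converge uniformly on the closed
    disk, so that they stay within a fixed distance of the dilated function. *)
Theorem bp_polynomials g : hardy +oo%E g ->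
  exists q : nat -> {poly R[i]}, bp_cvg (fun m z => (q m).[z]) g.
Proof.
move=> /hardy_ooP[hg [M M0 hM]].
pose rho (m : nat) : R := 1 - m.+1%:R^-1.
have rho01 m : 0 <= rho m < 1.
  by rewrite subr_ge0 invf_le1 // ler1n /= ltrBlDr ltrDl invr_gt0.
have [q hq] : exists q : nat -> {poly R[i]}, forall m z, disk z ->
    cabs (g ((rho m)%:C * z) - (q m).[z]) <= m.+1%:R^-1.
  have H m : exists P : {poly R[i]}, forall z : C, disk z ->
      cabs (g ((rho m)%:C * z) - P.[z]) <= m.+1%:R^-1.
    have m0 : 0 < m.+1%:R^-1 :> R by rewrite invr_gt0.
    have [N hN] := taylor_tail hg hM M0 (rho01 m) m0.
    exists (\poly_(j < N) (qiter j g 0 * (rho m)%:C ^+ j)) => z hz.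
    have -> : (\poly_(j < N) (qiter j g 0 * (rho m)%:C ^+ j)).[z] =
        \sum_(j < N) qiter j g 0 * ((rho m)%:C * z) ^+ j.
      by rewrite horner_poly; apply: eq_bigr => j _; rewrite exprMn mulrA.
    rewrite {1}(taylorE N g) addrAC subrr add0r; apply: hN => //.
    have /andP[p0 p1] := rho01 m.
    by rewrite cabsM cabs_real ger0_norm // ler_piMr // ltW.
  by have [q hq] := choice H; exists q.
exists q; split.
  exists (M + 1) => m z hz.
  have -> : (q m).[z] = g ((rho m)%:C * z) - (g ((rho m)%:C * z) - (q m).[z]).
    by rewrite opprB addrC subrK.
  apply: le_trans (cabsB _ _) _; apply: lerD.
    apply: hM; rewrite /disk /= cabsM cabs_real.
    have /andP[p0 p1] := rho01 m; rewrite ger0_norm //.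
    apply: le_lt_trans hz; rewrite ler_piMl ?cabs_ge0 //; exact: ltW.
  by apply: le_trans (hq m z hz) _; rewrite invf_le1 // ler1n.
move=> z hz; apply/cvg_seqC_P => e e0; have e2 : 0 < e / 2 by rewrite divr_gt0.
have [s s0 hs] := holomorphic_dcontinuous hg hz e2.
pose t := Num.min s (e / 2); have t0 : 0 < t by rewrite lt_min s0.
exists (Num.bound t^-1) => m hm.
have mt : m.+1%:R^-1 < t.
  rewrite -[t]invrK ltf_pV2 ?posrE ?invr_gt0 //.
  have := archi_boundP (ltW _ : 0 <= t^-1); rewrite invr_gt0 => /(_ t0) /lt_le_trans; apply.
  by rewrite ler_nat ltnW.
move: (mt); rewrite lt_min => /andP[m1 m2].
have -> : (q m).[z] - g z = (g ((rho m)%:C * z) - g z) - (g ((rho m)%:C * z) - (q m).[z]).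
  by set A := g (_ * z); set B := _.[z]; ring.
apply: le_trans (cabsB _ _) _; rewrite [e]splitr; apply: lerD; last first.
  by apply: le_trans (hq m z hz) _; exact: ltW.
apply: hs; have -> : (rho m)%:C * z - z = (- m.+1%:R^-1)%:C * z.
  by rewrite /rho rmorphB rmorphN rmorph1; ring.
rewrite cabsM cabs_real normrN ger0_norm ?invr_ge0 //; apply: le_lt_trans m1.
by rewrite ler_piMr ?invr_ge0 //; exact: ltW.
Qed.

End BoundedConvergence.

(** * Hardy norms of finite order *)

Section HardyNorms.
Variable R : realType.
Local Notation C := (R[i]^o).
Implicit Types (f g h v : C -> C) (z w : C) (q r M e : R) (u : nat -> C -> C).
Local Notation circ := (@circle_point R).
Local Notation mu := (@lebesgue_measure R).

Lemma ler_powR2 q (x y : R) : 0 <= q -> 0 <= x -> x <= y -> x `^ q <= y `^ q.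
Proof.
by move=> q0 x0 xy; apply: ge0_ler_powR => //; rewrite nnegrE // (le_trans x0).
Qed.

Lemma powR_inv q (x : R) : 0 < q -> 0 <= x -> (x `^ q^-1) `^ q = x.
Proof. by move=> q0 x0; rewrite -powRrM mulVf ?gt_eqF // powRr1. Qed.

Lemma powR_inv' q (x : R) : 0 < q -> 0 <= x -> (x `^ q) `^ q^-1 = x.
Proof. by move=> q0 x0; rewrite -powRrM mulfV ?gt_eqF // powRr1. Qed.

Lemma powR_continuous q (x : R -> R) : 0 < q -> (forall t, 0 <= x t) ->
  continuous x -> continuous (fun t => x t `^ q).
Proof.
move=> q0 x0 cx t; have [xt|xt] := eqVneq (x t) 0.
  apply/cvgrPdist_le => e e0.
  have e1 : 0 < e `^ q^-1 by rewrite powR_gt0.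
  have /cvgrPdist_lt/(_ _ e1) := cx t; apply: filterS => s.
  rewrite xt powR0 ?gt_eqF // !sub0r !normrN ger0_norm // => /ltW h.
  rewrite ger0_norm ?powR_ge0 //; apply: le_trans (ler_powR2 (ltW q0) (x0 s) h) _.
  by rewrite powR_inv // ltW.
have xp : 0 < x t by rewrite lt_def xt x0.
have H : \forall s \near t, expR (q * ln (x s)) = x s `^ q.
  have /cvgrPdist_lt/(_ _ xp) := cx t; apply: filterS => s hs.
  rewrite /powR ifF //; apply/negbTE/eqP => xs.
  by move: hs; rewrite xs subr0 ger0_norm ?ltxx // ltW.
have E : x t `^ q = expR (q * ln (x t)) by rewrite /powR (negbTE xt).
apply: cvg_trans; first by apply: near_eq_cvg; exact: H.
rewrite E; apply: continuous_cvg; first exact: continuous_expR.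
apply: cvgM; first exact: cvg_cst.
by apply: continuous_cvg; [exact: continuous_ln|exact: cx].
Qed.

(** The integral means of the Hardy norm as real numbers. *)
Definition pmean q r f : R := rmean (fun t => cabs (f (circ r t)) `^ q).

Lemma pmean_cont q r f : holomorphic f -> 0 <= r < 1 -> 0 < q ->
  continuous (fun t => cabs (f (circ r t)) `^ q).
Proof.
move=> hf hr q0; apply: powR_continuous => // [t|]; first exact: cabs_ge0.
by apply: cc_cabs; apply: cc_on_circ => //; exact: holomorphic_dcontinuous.
Qed.

Lemma hardy_meanE q r f : holomorphic f -> 0 <= r < 1 -> 0 < q ->
  hardy_mean q r f = (pmean q r f)%:E.
Proof.
move=> hf hr q0; rewrite /hardy_mean /pmean /rmean EFinM; congr (_ * _)%E.
rewrite /rint /Rintegral fineK //; apply: integrable_fin_num => //.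
by apply: continuous_integrable; exact: pmean_cont.
Qed.

Lemma pmean_ge0 q r f : 0 <= pmean q r f.
Proof. by apply: rmean_ge0 => t; exact: powR_ge0. Qed.

Lemma hardy_norm_le q f (d : R) : holomorphic f -> 0 < q -> 0 <= d ->
  (forall r, 0 <= r < 1 -> pmean q r f <= d `^ q) ->
  (hardy_norm q%:E f <= d%:E)%E.
Proof.
move=> hf q0 d0 h; apply: ge_ereal_sup => _ [r hr <-].
have {}hr : 0 <= r < 1 by move: hr; rewrite /= in_itv.
rewrite hardy_meanE // poweR_EFin lee_fin -[d](powR_inv' q0) //.
by apply: ler_powR2; rewrite ?pmean_ge0 ?h // invr_ge0 ltW.
Qed.

Lemma hardy_norm_ge q f (d : R) : holomorphic f -> 0 < q ->
  (hardy_norm q%:E f < d%:E)%E -> forall r, 0 <= r < 1 -> pmean q r f <= d `^ q.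
Proof.
move=> hf q0 h r hr.
have : (poweR (hardy_mean q r f) q^-1 <= hardy_norm q%:E f)%E.
  by apply: ereal_sup_ubound; exists r => //=; rewrite in_itv.
move=> /le_lt_trans/(_ h); rewrite hardy_meanE // poweR_EFin lte_fin => /ltW l.
rewrite -[X in X <= _](powR_inv q0) ?pmean_ge0 //.
by apply: ler_powR2; rewrite ?powR_ge0 // ltW.
Qed.

Lemma holomorphicB f g : holomorphic f -> holomorphic g ->
  holomorphic (fun z => f z - g z).
Proof.
move=> hf hg; apply: (holomorphic_eq (f := fun z => f z + (-1) * g z)) => [z _|].
  by rewrite mulN1r.
apply/holomorphic_cdiff => z hz.
have /holomorphic_cdiff/(_ z hz)[d1 h1] := hf.
have /holomorphic_cdiff/(_ z hz)[d2 h2] := hg.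
by eexists; apply: cdiffD h1 (cdiffM (cdiff_cst (-1) z) h2).
Qed.

Lemma holomorphicZ (c : C) f : holomorphic f -> holomorphic (fun z => c * f z).
Proof.
move=> hf; apply/holomorphic_cdiff => z hz.
have /holomorphic_cdiff/(_ z hz)[d1 h1] := hf.
by eexists; exact: cdiffM (cdiff_cst c z) h1.
Qed.

Lemma bounded_pmean q r f M : holomorphic f -> 0 <= r < 1 -> 0 < q ->
  bounded_on_disk M f -> pmean q r f <= M `^ q.
Proof.
move=> hf hr q0 hM; rewrite -[X in _ <= X]rmean_cst; apply: rmean_le.
- exact: pmean_cont.
- by apply: cst_continuous.
by move=> t; apply: ler_powR2; rewrite ?cabs_ge0 ?(ltW q0) //; apply: hM; exact: disk_circ.
Qed.

Lemma hardy_oo_sub q f : 0 < q -> hardy +oo%E f -> hardy q%:E f.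
Proof.
move=> q0 /hardy_ooP[hf [M M0 hM]]; split=> //.
apply: (@le_lt_trans _ _ M%:E); last by rewrite ltry.
apply: hardy_norm_le => //; first exact: ltW.
by move=> r hr; exact: bounded_pmean.
Qed.

Lemma hardy_closureP q (A : set (C -> C)) f : 0 < q ->
  (forall h, A h -> holomorphic h) -> hardy q%:E f ->
  hardy_closure q%:E A f <-> (forall e, 0 < e -> exists2 h, A h &
    forall r, 0 <= r < 1 -> pmean q r (fun z => f z - h z) <= e).
Proof.
move=> q0 hA hf; have [hhf _] := hf; split=> [[_ H] e e0|H].
  have [|h Ah hn] := H (e `^ q^-1); first by rewrite powR_gt0.
  exists h => // r hr.
  have := hardy_norm_ge (holomorphicB hhf (hA _ Ah)) q0 hn hr.
  by rewrite powR_inv // ltW.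
split=> // e e0; have [|h Ah hn] := H ((e / 2) `^ q).
  by rewrite powR_gt0 // divr_gt0.
exists h => //; apply: (@le_lt_trans _ _ (e / 2)%:E).
  apply: (hardy_norm_le (holomorphicB hhf (hA _ Ah)) q0) => [|r hr]; last exact: hn.
  by rewrite ltW // divr_gt0.
by rewrite lte_fin ltr_pdivrMr // ltr_pMr // ltr1n.
Qed.

Lemma powRD_le q (x y : R) : 0 <= q -> 0 <= x -> 0 <= y ->
  (x + y) `^ q <= 2 `^ q * (x `^ q + y `^ q).
Proof.
move=> q0 x0 y0; wlog xy : x y x0 y0 / x <= y => [H|].
  have [|/ltW] := leP x y; first exact: H.
  by move=> yx; rewrite addrC [x `^ q + _]addrC; exact: H.
apply: (@le_trans _ _ ((2 * y) `^ q)).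
  by apply: ler_powR2; rewrite ?addr_ge0 // mulrDl mul1r lerD2r.
by rewrite powRM // ler_wpM2l ?powR_ge0 // lerDr powR_ge0.
Qed.

Lemma pmeanD q r f g : holomorphic f -> holomorphic g -> 0 <= r < 1 -> 0 < q ->
  pmean q r (fun z => f z + g z) <= 2 `^ q * (pmean q r f + pmean q r g).
Proof.
move=> hf hg hr q0.
have hfg : holomorphic (fun z => f z + g z).
  apply/holomorphic_cdiff => z hz.
  have /holomorphic_cdiff/(_ z hz)[d1 h1] := hf.
  have /holomorphic_cdiff/(_ z hz)[d2 h2] := hg.
  by eexists; exact: cdiffD h1 h2.
have c1 := pmean_cont hf hr q0; have c2 := pmean_cont hg hr q0.
have c12 := rcontD c1 c2.
rewrite /pmean -rmeanD // -rmeanZ //; apply: rmean_le => [||t].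
- exact: (pmean_cont hfg hr q0).
- by apply: rcontM => //; apply: cst_continuous.
apply: le_trans (powRD_le (ltW q0) (cabs_ge0 _) (cabs_ge0 _)).
by apply: ler_powR2; rewrite ?cabs_ge0 ?(ltW q0) ?cabsD.
Qed.

Lemma pmeanZ q r (c : C) f : holomorphic f -> 0 <= r < 1 -> 0 < q ->
  pmean q r (fun z => c * f z) = cabs c `^ q * pmean q r f.
Proof.
move=> hf hr q0; rewrite /pmean -rmeanZ; last exact: pmean_cont.
by apply: rmean_eq => t; rewrite cabsM powRM ?cabs_ge0.
Qed.

(** For 0 <= x <= M and any s > 0, x^q <= s^q + (M^q / s^2) x^2. *)
Lemma pmean_le_msq q M e : 0 < q -> 0 < M -> 0 < e -> exists2 d, 0 < d &
  forall f, holomorphic f -> bounded_on_disk M f -> forall r, 0 <= r < 1 ->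
    msq r f <= d -> pmean q r f <= e.
Proof.
move=> q0 M0 e0; pose s := (e / 2) `^ q^-1.
have e2 : 0 < e / 2 by rewrite divr_gt0.
have s0 : 0 < s by rewrite powR_gt0.
have Mq : 0 < M `^ q by rewrite powR_gt0.
have sE : s `^ q = e / 2 by rewrite powR_inv // ltW.
exists (e / 2 * (s ^+ 2 / M `^ q)) => [|f hf hM r hr hd].
  by rewrite mulr_gt0 // divr_gt0 // exprn_gt0.
have c2 := msq_cont hf hr.
have cm : continuous (fun t => M `^ q / s ^+ 2 * cabs (f (circ r t)) ^+ 2).
  by apply: rcontM => //; apply: cst_continuous.
apply: (@le_trans _ _ (rmean (fun t => e / 2 +
    M `^ q / s ^+ 2 * cabs (f (circ r t)) ^+ 2))).
  apply: rmean_le => [||t].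
  - exact: pmean_cont.
  - by apply: rcontD => //; apply: cst_continuous.
  set x := cabs _; have x0 : 0 <= x by exact: cabs_ge0.
  have xM : x <= M by apply: hM; exact: disk_circ.
  have [xs|sx] := leP x s.
    apply: (@le_trans _ _ (s `^ q)); first by apply: ler_powR2 => //; exact: ltW.
    by rewrite sE lerDl mulr_ge0 ?sqr_ge0 // divr_ge0 ?sqr_ge0 // ltW.
  apply: (@le_trans _ _ (M `^ q)); first by apply: ler_powR2 => //; exact: ltW.
  apply: (@le_trans _ _ (M `^ q / s ^+ 2 * x ^+ 2)); last by rewrite lerDr ltW.
  rewrite mulrAC ler_pdivlMr ?exprn_gt0 // ler_pM2l //.
  by rewrite ler_pXn2r ?nnegrE // ltW.
rewrite rmeanD //; last by apply: cst_continuous.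
rewrite rmean_cst rmeanZ // -/(msq r f).
have : M `^ q / s ^+ 2 * msq r f <= e / 2.
  apply: (@le_trans _ _ (M `^ q / s ^+ 2 * (e / 2 * (s ^+ 2 / M `^ q)))).
    by rewrite ler_wpM2l // divr_ge0 ?sqr_ge0 // ltW.
  rewrite le_eqVlt; apply/orP; left; apply/eqP; field.
  by rewrite !gt_eqF.
lra.
Qed.

End HardyNorms.

(** * Norm closure and point evaluation *)

Section NormClosure.
Variable R : realType.
Local Notation C := (R[i]^o).
Implicit Types (f g h v : C -> C) (z w : C) (q r M e : R) (u : nat -> C -> C).
Local Notation circ := (@circle_point R).

(** Bounded pointwise limits stay in the norm closure: by the Banach-Saks
    argument, suitable averages converge in the mean of order two, and boundedness
    turns this into convergence in the mean of every finite order. *)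
Theorem bp_closure_sub q (A : set (C -> C)) f : 0 < q ->
  A `<=` hardy +oo%E -> A (fun=> 0) ->
  (forall g h, A g -> A h -> A (fun z => g z + h z)) ->
  (forall (c : C) g, A g -> A (fun z => c * g z)) ->
  smallest (@bp_closed R) A f -> hardy_closure q%:E A f.
Proof.
move=> q0 Aoo A0 AD AZ.
pose S := [set g : C -> C | hardy +oo%E g /\ forall e, 0 < e -> exists2 h, A h &
    forall r, 0 <= r < 1 -> pmean q r (fun z => g z - h z) <= e].
have hA h : A h -> holomorphic h by move=> /Aoo /hardy_ooP[].
have q2 : 0 < 2 `^ q :> R by rewrite powR_gt0.
have E0 g r : pmean q r (fun z => g z - g z) = 0.
  rewrite /pmean (_ : (fun t => _) = fun=> 0) ?rmean_cst //.
  by apply/funext => t; rewrite subrr cabs0 powR0 // gt_eqF.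
have AS : A `<=` S.
  move=> g Ag; split; first exact: Aoo.
  by move=> e e0; exists g => // r hr; rewrite E0 ltW.
have hS g : S g -> holomorphic g by move=> [/hardy_ooP[]].
have SD g h : S g -> S h -> S (fun z => g z + h z).
  move=> [g1 g2] [h1 h2]; split; first exact: hardy_ooD.
  move=> e e0; have e2 : 0 < e / 2 / 2 `^ q by rewrite !divr_gt0.
  have [g' Ag hg] := g2 _ e2; have [h' Ah hh] := h2 _ e2.
  exists (fun z => g' z + h' z) => [|r hr]; first exact: AD.
  have H1 := holomorphicB (hS _ (conj g1 g2)) (hA _ Ag).
  have H2 := holomorphicB (hS _ (conj h1 h2)) (hA _ Ah).
  have -> : (fun z => g z + h z - (g' z + h' z)) =
      (fun z => (g z - g' z) + (h z - h' z)) by apply/funext => z; ring.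
  apply: le_trans (pmeanD H1 H2 hr q0) _.
  apply: le_trans (ler_wpM2l (ltW q2) (lerD (hg r hr) (hh r hr))) _.
  by rewrite le_eqVlt; apply/orP; left; apply/eqP; field; rewrite gt_eqF.
have SZ (c : C) g : S g -> S (fun z => c * g z).
  move=> [g1 g2]; split; first by apply: hardy_ooM => //; exact: hardy_oo_cst.
  move=> e e0; pose k := 1 + cabs c `^ q.
  have k0 : 0 < k by rewrite ltr_wpDr // powR_ge0.
  have [g' Ag hg] := g2 _ (divr_gt0 e0 k0).
  exists (fun z => c * g' z) => [|r hr]; first exact: AZ.
  have H1 := holomorphicB (hS _ (conj g1 g2)) (hA _ Ag).
  have -> : (fun z => c * g z - c * g' z) = (fun z => c * (g z - g' z)).
    by apply/funext => z; ring.
  rewrite (pmeanZ c H1 hr q0).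
  apply: (@le_trans _ _ (k * (e / k))); last by rewrite mulrCA divff ?mulr1 // gt_eqF.
  by apply: ler_pM; rewrite ?powR_ge0 ?pmean_ge0 ?hg // /k lerDr.
have S0 : S (fun=> 0) by exact: AS.
suff SB : bp_closed S.
  move=> hf; have [foo fS] : S f by apply: (smallest_sub SB AS).
  by apply/hardy_closureP => //; exact: hardy_oo_sub.
split; first by move=> g [].
move=> u g uS goo hbp; split=> // e e0.
have [hg _] := (hardy_ooP g).1 goo.
have [M M0 [uM gM]] := bp_bound hbp; have [_ hl] := hbp.
pose w m (z : C) : C := u m z - g z.
have hw m : holomorphic (w m) := holomorphicB (hS _ (uS m)) hg.
have wM m : bounded_on_disk (2 * M) (w m).
  move=> z hz; apply: le_trans (cabsB _ _) _; rewrite mulrDl mul1r.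
  by apply: lerD; [exact: uM|exact: gM].
have M2 : 0 < 2 * M by rewrite mulr_gt0.
have w0 : pointwise0 w by move=> z hz d d0; have /cvg_seqC_P/(_ d d0) := hl z hz.
have e2 : 0 < e / 2 / 2 `^ q by rewrite !divr_gt0.
have [d d0 hd] := pmean_le_msq q0 M2 e2.
have [s [s0 hs]] := banach_saks hw wM M2 w0 d0.
pose c : C := ((size s)%:R^-1)%:C.
have n0 : 0 < (size s)%:R :> R by rewrite ltr0n.
pose v (z : C) := c * sumf w s z.
have hv : holomorphic v := (@holomorphicZ R c _ (@sumf_holo R w s hw)).
have vM : bounded_on_disk (2 * M) v.
  move=> z hz; rewrite /v cabsM cabs_real ger0_norm ?invr_ge0 ?(ltW n0) //.
  by rewrite mulrC ler_pdivrMr // mulrC; exact: sumf_bounded.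
have U_S : S (fun z => c * sumf u s z).
  apply: SZ; elim: (s) => [|m s' IH].
    by rewrite (_ : sumf u [::] = fun=> 0) //; apply/funext => z; rewrite /sumf big_nil.
  have -> : sumf u (m :: s') = fun z => u m z + sumf u s' z.
    by apply/funext => z; rewrite sumf_cons.
  exact: (SD _ _ (uS m) IH).
have vE z : v z = c * sumf u s z - g z.
  have : sumf w s z = sumf u s z - (size s)%:R * g z.
    elim: (s) => [|m s' IH]; first by rewrite /sumf !big_nil mul0r subr0.
    by rewrite !sumf_cons IH /= -natr1 /w; ring.
  rewrite /v => ->; rewrite mulrBr mulrA /c -(rmorph_nat (real_complex R)).
  by rewrite -rmorphM /= mulVf ?gt_eqF // rmorph1 mul1r.
have [h Ah hh] := U_S.2 _ e2; exists h => // r hr.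
have H1 := holomorphicB (hS _ U_S) (hA _ Ah).
have H2 := @holomorphicZ R (-1) v hv.
have -> : (fun z => g z - h z) = (fun z => (c * sumf u s z - h z) + (-1) * v z).
  by apply/funext => z; rewrite vE; ring.
apply: le_trans (pmeanD H1 H2 hr q0) _.
rewrite (pmeanZ (-1) hv hr q0) cabsN cabs1 powR1 mul1r.
have hdr := hd v hv vM r hr (hs r hr).
apply: le_trans (ler_wpM2l (ltW q2) (lerD (hh r hr) hdr)) _.
by rewrite le_eqVlt; apply/orP; left; apply/eqP; field; rewrite gt_eqF.
Qed.

(** From x^s <= a^s + x^q / a^(q - s) for every a > 0. *)
Lemma pmean_le_pmean q s e : 0 < s <= q -> 0 < e -> exists2 d, 0 < d &
  forall f r, holomorphic f -> 0 <= r < 1 -> pmean q r f <= d -> pmean s r f <= e.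
Proof.
move=> /andP[s0 sq] e0; have q0 : 0 < q by apply: lt_le_trans sq.
have e2 : 0 < e / 2 by rewrite divr_gt0.
pose a := (e / 2) `^ s^-1; have a0 : 0 < a by rewrite powR_gt0.
pose c := a `^ (q - s); have c0 : 0 < c by rewrite powR_gt0.
have aE : a `^ s = e / 2 by rewrite powR_inv // ltW.
exists (e / 2 * c) => [|f r hf hr hd]; first by rewrite mulr_gt0.
have cq := pmean_cont hf hr q0.
have cm : continuous (fun t => c^-1 * cabs (f (circ r t)) `^ q).
  by apply: rcontM => //; apply: cst_continuous.
apply: (@le_trans _ _ (rmean (fun t => e / 2 + c^-1 * cabs (f (circ r t)) `^ q))).
  apply: rmean_le => [||t].
  - exact: (pmean_cont hf hr s0).
  - by apply: rcontD => //; apply: cst_continuous.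
  set x := cabs _; have x0 : 0 <= x by exact: cabs_ge0.
  have [xa|ax] := leP x a.
    apply: (@le_trans _ _ (a `^ s)); first by apply: ler_powR2 => //; exact: ltW.
    by rewrite aE lerDl mulr_ge0 ?powR_ge0 // invr_ge0 ltW.
  apply: (@le_trans _ _ (c^-1 * x `^ q)); last by rewrite lerDr ltW.
  rewrite mulrC ler_pdivlMr //.
  have xn : x != 0 by rewrite gt_eqF // (lt_trans a0).
  have -> : x `^ q = x `^ s * x `^ (q - s).
    by rewrite -powRD ?xn ?implybT // addrC subrK.
  rewrite ler_wpM2l ?powR_ge0 //; apply: ler_powR2; rewrite ?subr_ge0 ?(ltW a0) //.
  exact: ltW.
rewrite rmeanD //; last by apply: cst_continuous.
rewrite rmean_cst rmeanZ // -/(pmean q r f).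
have : c^-1 * pmean q r f <= e / 2 by rewrite mulrC ler_pdivrMr.
lra.
Qed.

(** With S the supremum of (rho - |w|)^(1/s) |f w|, splitting |f| into
    |f|^s and |f|^(1 - s) in the Cauchy estimate gives S <= K S^(1 - s) d, an
    inequality that bounds S although |f|^s need not dominate |f|. *)
Lemma point_evaluation_small_order s z e : 0 < s <= 1 -> disk z -> 0 < e ->
  exists2 d, 0 < d & forall f, holomorphic f ->
    (forall r, 0 <= r < 1 -> pmean s r f <= d) -> cabs (f z) <= e.
Proof.
move=> /andP[s0 s1] hz e0; rewrite /disk /= in hz.
have [rho zr rho1] : exists2 rho, cabs z < rho & rho < 1.
  by exists ((1 + cabs z) / 2); lra.
pose l := rho - cabs z; have l0 : 0 < l by rewrite subr_gt0.
pose a := s^-1; have a0 : 0 < a by rewrite invr_gt0.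
pose K := 2 `^ a; have K0 : 0 < K by rewrite powR_gt0.
have la0 : 0 < l `^ a by rewrite powR_gt0.
have el0 : 0 < (e * l `^ a) `^ s by rewrite powR_gt0 // mulr_gt0.
exists ((e * l `^ a) `^ s / K) => [|f hf hd]; first by rewrite divr_gt0.
set d := _ / K in hd; have d0 : 0 < d by rewrite divr_gt0.
pose v w := (rho - cabs w) `^ a * cabs (f w).
have [r1 rr1 r11] : exists2 r1, rho < r1 & r1 < 1 by exists ((1 + rho) / 2); lra.
have rho0 : 0 < rho by apply: le_lt_trans zr; exact: cabs_ge0.
pose B := r1 / (r1 - rho) * rmean (fun t => cabs (f (circ r1 t))).
have vB w : cabs w < rho -> v w <= rho `^ a * B.
  move=> hw; apply: ler_pM; rewrite ?powR_ge0 ?cabs_ge0 //.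
    apply: ler_powR2; rewrite ?subr_ge0 ?(ltW a0) ?(ltW hw) //.
    by rewrite lerBlDr lerDl cabs_ge0.
  have hwr : cabs w < r1 < 1 by rewrite (lt_trans hw).
  have wr1 : cabs w < r1 by rewrite (lt_trans hw).
  apply: le_trans (cauchy_bound hf hwr) _; apply: ler_wpM2r.
    by apply: rmean_ge0 => t; exact: cabs_ge0.
  apply: ler_wpM2l; first by rewrite ltW // (lt_trans rho0).
  by rewrite lef_pV2 ?posrE ?subr_gt0 // lerB // ltW.
pose V := [set x | exists2 w, cabs w < rho & x = v w].
have supV : has_sup V.
  by split; [exists (v z), z|exists (rho `^ a * B) => _ [w hw ->]; exact: vB].
pose S := sup V.
have vS w : cabs w < rho -> v w <= S.
  by move=> hw; apply: sup_upper_bound => //; exists w.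
have v0 w : 0 <= v w by rewrite mulr_ge0 ?powR_ge0 ?cabs_ge0.
have S0 : 0 <= S by apply: le_trans (v0 z) (vS z zr).
have key w : cabs w < rho -> v w <= K * S `^ (1 - s) * d.
  move=> hw; pose t := rho - cabs w; have t0 : 0 < t by rewrite subr_gt0.
  have [r rE] : exists r, r = cabs w + t / 2 by eexists.
  have hr : cabs w < r < 1 by rewrite rE /t; have := cabs_ge0 w; lra.
  have r0 : 0 < r by case/andP: hr => h _; apply: le_lt_trans h; exact: cabs_ge0.
  have hr' : 0 <= r < 1 by case/andP: hr => _ ->; rewrite ltW.
  have rrho : r < rho by rewrite rE; move: t0; rewrite /t; lra.
  pose X := S * (2 / t) `^ a.
  have t2 : 0 < 2 / t by rewrite divr_gt0.
  have t2E : (t / 2) `^ a * (2 / t) `^ a = 1.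
    rewrite -powRM ?divr_ge0 ?(ltW t0) // (_ : t / 2 * (2 / t) = 1) ?powR1 //.
    by field; rewrite gt_eqF.
  have xX (y : R) : cabs (f (circ r y)) <= X.
    have := vS (circ r y); rewrite /v (cabs_circ y (ltW r0)) => /(_ rrho).
    have -> : rho - r = t / 2 by rewrite rE /t; field.
    move=> h; have := ler_wpM2l (powR_ge0 (2 / t) a) h.
    by rewrite mulrA [_ `^ a * _ `^ a]mulrC t2E mul1r /X [S * _]mulrC.
  have xm (y : R) : cabs (f (circ r y)) <= X `^ (1 - s) * cabs (f (circ r y)) `^ s.
    set x := cabs _; have x0 : 0 <= x by exact: cabs_ge0.
    have [->|xn] := eqVneq x 0; first by rewrite mulr_ge0 ?powR_ge0.
    have E : x = x `^ (1 - s) * x `^ s.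
      by rewrite -powRD ?xn ?implybT // subrK powRr1.
    apply: (@le_trans _ _ (x `^ (1 - s) * x `^ s)); first by rewrite -E.
    apply: ler_wpM2r; first exact: powR_ge0.
    by apply: ler_powR2 => //; [rewrite subr_ge0|exact: xX].
  have mX : rmean (fun y => cabs (f (circ r y))) <= X `^ (1 - s) * d.
    have cs := pmean_cont hf hr' s0.
    apply: le_trans (ler_wpM2l (powR_ge0 _ _) (hd r hr')).
    rewrite /pmean -rmeanZ //; apply: rmean_le => //.
      by apply: cc_cabs; exact: (cc_on_circ (holomorphic_dcontinuous hf) hr').
    by apply: rcontM => //; apply: cst_continuous.
  have fw : cabs (f w) <= 2 / t * (X `^ (1 - s) * d).
    apply: le_trans (cauchy_bound hf hr) _; apply: ler_pM => //.
    - by rewrite divr_ge0 ?(ltW r0) // subr_ge0 ltW //; case/andP: hr.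
    - by apply: rmean_ge0 => y; exact: cabs_ge0.
    have -> : r - cabs w = t / 2 by rewrite rE addrC addKr.
    rewrite invf_div; apply: ler_piMl; first exact: ltW.
    by case/andP: hr => _ /ltW.
  have XE : 2 / t * X `^ (1 - s) = S `^ (1 - s) * (2 / t) `^ a.
    rewrite /X powRM ?powR_ge0 // -powRrM mulrCA; congr (_ * _).
    rewrite -{1}[2 / t]powRr1 ?(ltW t2) // -powRD; last first.
      by rewrite (gt_eqF t2) implybT.
    by congr (_ `^ _); rewrite /a; field; rewrite gt_eqF.
  apply: le_trans (ler_wpM2l (powR_ge0 _ _) fw) _.
  have tK : t `^ a * (2 / t) `^ a = K.
    rewrite -powRM ?(ltW t0) ?(ltW t2) // (_ : t * (2 / t) = 2) //.
    by field; rewrite gt_eqF.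
  rewrite [2 / t * _]mulrA XE -/t -tK; set A := t `^ a; set B' := (2 / t) `^ a.
  by rewrite le_eqVlt; apply/orP; left; apply/eqP; ring.
have SK : S <= K * S `^ (1 - s) * d.
  apply: ge_sup; first by exists (v z), z.
  by move=> _ [w hw ->]; exact: key.
have Sb : S <= e * l `^ a.
  have [->|Sn] := eqVneq S 0; first by rewrite mulr_ge0 ?powR_ge0 // ltW.
  have Sp : 0 < S by rewrite lt_def Sn.
  have Ss : S `^ s <= (e * l `^ a) `^ s.
    have E : S = S `^ (1 - s) * S `^ s by rewrite -powRD ?Sn ?implybT // subrK powRr1.
    have P : 0 < S `^ (1 - s) by rewrite powR_gt0.
    rewrite -(ler_pM2l P) -E; apply: le_trans SK _.
    rewrite le_eqVlt; apply/orP; left; apply/eqP.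
    by rewrite /d; field; rewrite gt_eqF.
  rewrite -[S](powR_inv' s0) // -[X in _ <= X](powR_inv' s0); last first.
    by rewrite mulr_ge0 ?powR_ge0 // ltW.
  by apply: ler_powR2; rewrite ?powR_ge0 // invr_ge0 ltW.
have := le_trans (vS z zr) Sb; rewrite /v -/l mulrC.
by rewrite ler_pM2r.
Qed.

(** Orders above one are reduced to order one. *)
Theorem point_evaluation q z e : 0 < q -> disk z -> 0 < e ->
  exists2 d, 0 < d & forall f, holomorphic f ->
    (forall r, 0 <= r < 1 -> pmean q r f <= d) -> cabs (f z) <= e.
Proof.
move=> q0 hz e0; pose s := Num.min q 1.
have s0 : 0 < s by rewrite lt_min q0 ltr01.
have sq : 0 < s <= q by rewrite s0 ge_min lexx.
have s1 : 0 < s <= 1 by rewrite s0 ge_min lexx orbT.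
have [d1 d10 h1] := point_evaluation_small_order s1 hz e0.
have [d d0 h] := pmean_le_pmean sq d10; exists d => // f hf hd.
by apply: h1 => // r hr; apply: (h f r hf hr); exact: hd.
Qed.

End NormClosure.

(** * The bounded pointwise closure of the algebra *)

Section BoundedClosure.
Variable R : realType.
Local Notation C := (R[i]^o).
Implicit Types (f h k : C -> C) (z w : C) (p q : {poly R[i]}).

Lemma cdiff_horner p z : cdiff (fun w : C => p.[w]) z p^`().[z].
Proof.
elim/poly_ind: p => [|p c IH].
  rewrite deriv0 horner0 (_ : (fun w => _) = fun=> 0); first exact: cdiff_cst.
  by apply/funext => w; rewrite horner0.
have -> : (fun w : C => (p * 'X + c%:P).[w]) = fun w => p.[w] * w + c.
  by apply/funext => w; rewrite hornerMXaddC.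
have := cdiffD (cdiffM IH (cdiff_id z)) (cdiff_cst c z).
by rewrite derivMXaddC hornerD hornerMX addr0 mulr1 [z * _]mulrC.
Qed.

Lemma hardy_oo_horner p h : hardy +oo%E h -> hardy +oo%E (fun z => p.[h z]).
Proof.
move=> hh; elim/poly_ind: p => [|p c IH].
  apply: hardy_oo_eq (hardy_oo_cst (0 : C)) => z _; by rewrite horner0.
apply: (@hardy_oo_eq _ (fun z => p.[h z] * h z + c)).
  by move=> z _; rewrite hornerMXaddC.
by apply: hardy_ooD; [exact: hardy_ooM|exact: hardy_oo_cst].
Qed.

Variables (b g : C -> C).
Hypotheses (hb : hardy +oo%E b) (hg : hardy +oo%E g).

Lemma algebra_cst (c : C) : poly_algebra b g (fun=> c).
Proof. by exists (c%:P)%:P; apply/funext => z; rewrite !hornerC. Qed.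

Lemma algebra_b : poly_algebra b g b.
Proof. by exists ('X)%:P; apply/funext => z; rewrite hornerC hornerX. Qed.

Lemma algebra_g : poly_algebra b g g.
Proof. by exists 'X; apply/funext => z; rewrite hornerX hornerC. Qed.

Lemma algebraD h k : poly_algebra b g h -> poly_algebra b g k ->
  poly_algebra b g (fun z => h z + k z).
Proof.
by move=> [P ->] [Q ->]; exists (P + Q); apply/funext => z; rewrite !hornerD.
Qed.

Lemma algebraM h k : poly_algebra b g h -> poly_algebra b g k ->
  poly_algebra b g (fun z => h z * k z).
Proof.
by move=> [P ->] [Q ->]; exists (P * Q); apply/funext => z; rewrite !hornerM.
Qed.

Lemma algebra_hardy : poly_algebra b g `<=` hardy +oo%E.
Proof.
move=> h [P ->]; elim/poly_ind: P => [|P c IH].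
  apply: hardy_oo_eq (hardy_oo_cst (0 : C)) => z _; by rewrite !horner0.
apply: (@hardy_oo_eq _ (fun z => P.[(g z)%:P].[b z] * g z + c.[b z])).
  by move=> z _; rewrite hornerMXaddC hornerD hornerM hornerC.
by apply: hardy_ooD; [exact: hardy_ooM|exact: hardy_oo_horner].
Qed.

Definition bpc : set (C -> C) := smallest (@bp_closed R) (poly_algebra b g).

Lemma bpc_sub : poly_algebra b g `<=` bpc.
Proof. by move=> h hh S [_]; apply. Qed.

Lemma bpc_hardy : bpc `<=` hardy +oo%E.
Proof.
apply: smallest_sub; last exact: algebra_hardy.
by split.
Qed.

Lemma bpc_lim (u : nat -> C -> C) f : (forall m, bpc (u m)) -> bp_cvg u f -> bpc f.
Proof.
move=> hu hbp.
have hf : hardy +oo%E f.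
  by apply: bp_hardy_oo hbp => m; have /hardy_ooP[] := bpc_hardy (hu m).
move=> S hS; have [[_ SB] AS] := hS; apply: (SB u) => // m; exact: (hu m S hS).
Qed.

Lemma bpc_eq h f : (forall z, disk z -> h z = f z) -> bpc h -> bpc f.
Proof.
move=> E hh; apply: (@bpc_lim (fun=> h)) => //.
have /hardy_ooP[_ [M M0 hM]] := bpc_hardy hh; split; first by exists M.
by move=> z hz; rewrite -E //; exact: cvg_cst.
Qed.

(** An operation that preserves the algebra and bounded pointwise convergence in
    each argument preserves the closure. *)
Lemma bpc_op (op : C -> C -> C) :
  (forall h k, hardy +oo%E h -> hardy +oo%E k -> hardy +oo%E (fun z => op (h z) (k z))) ->
  (forall h k, poly_algebra b g h -> poly_algebra b g k ->
     poly_algebra b g (fun z => op (h z) (k z))) ->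
  (forall (u : nat -> C -> C) h k, hardy +oo%E k -> bp_cvg u h ->
     bp_cvg (fun m z => op (u m z) (k z)) (fun z => op (h z) (k z))) ->
  (forall (u : nat -> C -> C) h k, hardy +oo%E k -> bp_cvg u h ->
     bp_cvg (fun m z => op (k z) (u m z)) (fun z => op (k z) (h z))) ->
  forall h k, bpc h -> bpc k -> bpc (fun z => op (h z) (k z)).
Proof.
move=> opH opA opl opr.
have step1 k : poly_algebra b g k -> forall h, bpc h -> bpc (fun z => op (h z) (k z)).
  move=> Ak h hh.
  suff [] : [set f | hardy +oo%E f /\ bpc (fun z => op (f z) (k z))] h by [].
  apply: smallest_sub hh; last first.
    by move=> f Af; split; [exact: algebra_hardy|apply: bpc_sub; exact: opA].
  split; first by move=> f [].
  move=> u f hu hf hbp; split=> //.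
  apply: (@bpc_lim (fun m z => op (u m z) (k z))); first by move=> m; have [] := hu m.
  by apply: opl => //; exact: algebra_hardy.
move=> h k hh hk.
suff [] : [set f | hardy +oo%E f /\ bpc (fun z => op (h z) (f z))] k by [].
apply: smallest_sub hk; last first.
  by move=> f Af; split; [exact: algebra_hardy|exact: step1].
split; first by move=> f [].
move=> u f hu hf hbp; split=> //.
apply: (@bpc_lim (fun m z => op (h z) (u m z))); first by move=> m; have [] := hu m.
by apply: opr => //; exact: bpc_hardy.
Qed.

Lemma bp_cvgD (u : nat -> C -> C) h k : hardy +oo%E k -> bp_cvg u h ->
  bp_cvg (fun m z => u m z + k z) (fun z => h z + k z).
Proof.
move=> /hardy_ooP[_ [M M0 hM]] [[N hN] hl]; split.
  exists (N + M) => m z hz; apply: le_trans (cabsD _ _) _.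
  by apply: lerD; [exact: hN|exact: hM].
by move=> z hz; apply: cvgD; [exact: hl|exact: cvg_cst].
Qed.

Lemma bp_cvgM (u : nat -> C -> C) h k : hardy +oo%E k -> bp_cvg u h ->
  bp_cvg (fun m z => u m z * k z) (fun z => h z * k z).
Proof.
move=> /hardy_ooP[_ [M M0 hM]] [[N hN] hl]; split.
  exists (N * M) => m z hz; rewrite cabsM.
  by apply: ler_pM; rewrite ?cabs_ge0 ?hN ?hM.
by move=> z hz; apply: cvgM; [exact: hl|exact: cvg_cst].
Qed.

Lemma bpcD h k : bpc h -> bpc k -> bpc (fun z => h z + k z).
Proof.
apply: (@bpc_op (fun x y => x + y)).
- by move=> *; exact: hardy_ooD.
- by move=> *; exact: algebraD.
- by move=> *; exact: bp_cvgD.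
move=> u f f' hf' hbp; have := bp_cvgD hf' hbp.
have -> : (fun (m : nat) (z : C) => u m z + f' z) = fun m z => f' z + u m z.
  by apply/funext => m; apply/funext => z; rewrite addrC.
by have -> : (fun z : C => f z + f' z) = fun z => f' z + f z
  by apply/funext => z; rewrite addrC.
Qed.

Lemma bpcM h k : bpc h -> bpc k -> bpc (fun z => h z * k z).
Proof.
apply: (@bpc_op (fun x y => x * y)).
- by move=> *; exact: hardy_ooM.
- by move=> *; exact: algebraM.
- by move=> *; exact: bp_cvgM.
move=> u f f' hf' hbp; have := bp_cvgM hf' hbp.
have -> : (fun (m : nat) (z : C) => u m z * f' z) = fun m z => f' z * u m z.
  by apply/funext => m; apply/funext => z; rewrite mulrC.
by have -> : (fun z : C => f z * f' z) = fun z => f' z * f z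
  by apply/funext => z; rewrite mulrC.
Qed.

Lemma bpc_cst (c : C) : bpc (fun=> c).
Proof. by apply: bpc_sub; exact: algebra_cst. Qed.

Lemma bpc_horner p h : bpc h -> bpc (fun z => p.[h z]).
Proof.
move=> hh; elim/poly_ind: p => [|p c IH].
  by apply: bpc_eq (bpc_cst 0) => z _; rewrite horner0.
apply: (@bpc_eq (fun z => p.[h z] * h z + c)).
  by move=> z _; rewrite hornerMXaddC.
by apply: bpcD; [exact: bpcM|exact: bpc_cst].
Qed.

Lemma bpc_sum (I : Type) (s : seq I) (F : I -> C -> C) : (forall i, bpc (F i)) ->
  bpc (fun z => \sum_(i <- s) F i z).
Proof.
move=> hF; elim: s => [|i s IH].
  by apply: bpc_eq (bpc_cst 0) => z _; rewrite big_nil.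
apply: (@bpc_eq (fun z => F i z + \sum_(i <- s) F i z)).
  by move=> z _; rewrite big_cons.
exact: bpcD.
Qed.

Lemma bpc_prod (I : Type) (s : seq I) (F : I -> C -> C) : (forall i, bpc (F i)) ->
  bpc (fun z => \prod_(i <- s) F i z).
Proof.
move=> hF; elim: s => [|i s IH].
  by apply: bpc_eq (bpc_cst 1) => z _; rewrite big_nil.
apply: (@bpc_eq (fun z => F i z * \prod_(i <- s) F i z)).
  by move=> z _; rewrite big_cons.
exact: bpcM.
Qed.

Lemma bpc_b : bpc b. Proof. exact: bpc_sub algebra_b. Qed.
Lemma bpc_g : bpc g. Proof. exact: bpc_sub algebra_g. Qed.

(** The geometric series in c b converges boundedly. *)
Lemma bpc_inv_1sub (c : C) : cabs c < 1 -> (forall z, disk z -> cabs (b z) < 1) ->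
  bpc (fun z => (1 - c * b z)^-1).
Proof.
move=> c1 b1.
pose u (m : nat) (z : C) := \sum_(i < m) (c * b z) ^+ i.
have cb z : disk z -> cabs (c * b z) <= cabs c.
  by move=> hz; rewrite cabsM ler_piMr ?cabs_ge0 // ltW // b1.
have c10 : 0 < 1 - cabs c by rewrite subr_gt0.
have dn z : disk z -> 1 - cabs c <= cabs (1 - c * b z).
  move=> hz; apply: le_trans (cabs_sub_ge 1 _); rewrite cabs1 lerB //; exact: cb.
have d0 z : disk z -> 1 - c * b z != 0.
  by move=> hz; rewrite -cabs_gt0 (lt_le_trans _ (dn z hz)).
have uE m z : disk z -> u m z = (1 - (c * b z) ^+ m) / (1 - c * b z).
  move=> hz; apply: (mulIf (d0 z hz)); rewrite divfK ?d0 //.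
  rewrite mulrC -[1 in RHS](expr1n _ m) subrXX; congr (_ * _).
  by apply: eq_bigr => i _; rewrite expr1n mul1r.
apply: (@bpc_lim u) => [m|].
  apply: (@bpc_eq (fun z => (\poly_(i < m) c ^+ i).[b z])).
    by move=> z _; rewrite horner_poly; apply: eq_bigr => i _; rewrite exprMn.
  by apply: bpc_horner; exact: bpc_b.
split.
  exists (2 / (1 - cabs c)) => m z hz; rewrite uE // cabsM cabsV.
  apply: ler_pM; rewrite ?invr_ge0 ?cabs_ge0 //.
    apply: le_trans (cabsB _ _) _; rewrite cabs1 cabsX.
    have : cabs (c * b z) ^+ m <= 1.
      by apply: exprn_ile1; [exact: cabs_ge0|apply: le_trans (cb z hz) (ltW c1)].
    lra.
  by rewrite lef_pV2 ?posrE ?dn // (lt_le_trans c10) // dn.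
move=> z hz; apply/cvg_seqC_P => e e0.
have q01 : 0 <= cabs c < 1 by rewrite cabs_ge0.
have [N hN] := geometric_small (1 - cabs c)^-1 q01 e0; exists N => m /hN h.
have -> : u m z - (1 - c * b z)^-1 = - ((1 - c * b z)^-1 * (c * b z) ^+ m).
  by rewrite uE // mulrBl mul1r addrAC subrr add0r mulrC.
rewrite cabsN cabsM cabsV cabsX; apply: le_trans h; apply: ler_pM.
- by rewrite invr_ge0 cabs_ge0.
- by rewrite exprn_ge0 ?cabs_ge0.
- by rewrite lef_pV2 ?posrE ?dn // (lt_le_trans c10) // dn.
by rewrite lerXn2r ?nnegrE ?cabs_ge0 ?cb.
Qed.

End BoundedClosure.

(** * Fibres of the Blaschke product *)

Section BlaschkeFibres.
Variable R : realType.
Local Notation C := (R[i]^o).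
Variables (n : nat) (a : 'I_n -> C).
Hypotheses (hn : (0 < n)%N) (ha : forall j, disk (a j)).
Implicit Types (z w x : C) (p q : {poly R[i]}).

Local Notation b := (blaschke a).

Definition bnum : {poly R[i]} := \prod_(j < n) ((a j)%:P + (-1)%:P * 'X).
Definition bden : {poly R[i]} := \prod_(j < n) (1%:P + (- (a j)^*)%:P * 'X).

Lemma bnumE z : bnum.[z] = \prod_(j < n) (a j - z).
Proof.
rewrite horner_prod; apply: eq_bigr => j _.
by rewrite hornerD hornerM !hornerC hornerX mulN1r.
Qed.

Lemma bdenE z : bden.[z] = \prod_(j < n) (1 - (a j)^* * z).
Proof.
rewrite horner_prod; apply: eq_bigr => j _.
by rewrite hornerD hornerM !hornerC hornerX mulNr.
Qed.

Lemma blaschkeE z : b z = bnum.[z] / bden.[z].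
Proof. by rewrite bnumE bdenE -prodf_div. Qed.

(** Each Blaschke factor maps the disk to itself and its complement to its
    complement. *)
Lemma factor_identity (c z : C) :
  cabs (1 - c^* * z) ^+ 2 - cabs (c - z) ^+ 2 =
  (1 - cabs c ^+ 2) * (1 - cabs z ^+ 2).
Proof. by case: c => c1 c2; case: z => z1 z2; rewrite !cabs_sqr /=; ring. Qed.

Lemma factor_le (c z : C) : disk c -> disk z -> cabs (c - z) < cabs (1 - c^* * z).
Proof.
move=> hc hz; rewrite -(@ltr_pXn2r _ 2) ?nnegrE ?cabs_ge0 //.
rewrite -subr_gt0 factor_identity mulr_gt0 // subr_gt0 exprn_ilt1 ?cabs_ge0 //.
Qed.

Lemma factor_ge (c z : C) : disk c -> ~ disk z -> cabs (1 - c^* * z) <= cabs (c - z).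
Proof.
move=> hc /negP; rewrite -leNgt => hz.
rewrite -(@ler_pXn2r _ 2) ?nnegrE ?cabs_ge0 //.
rewrite -subr_le0 factor_identity mulr_ge0_le0 //.
  by rewrite subr_ge0 exprn_ile1 ?cabs_ge0 // ltW.
by rewrite subr_le0 exprn_ege1.
Qed.

Lemma cabs_prod (F : 'I_n -> C) : cabs (\prod_j F j) = \prod_j cabs (F j).
Proof.
elim/big_rec2: _ => [|j x y _ <-]; first exact: cabs1.
by rewrite cabsM.
Qed.

Lemma bden_neq0 z : disk z -> bden.[z] != 0.
Proof.
move=> hz; rewrite bdenE; apply/prodf_neq0 => j _.
rewrite -cabs_gt0; apply: le_lt_trans (factor_le (ha j) hz); exact: cabs_ge0.
Qed.

Lemma prodr_lt (F G : 'I_n -> R) : (forall j, 0 <= F j < G j) ->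
  \prod_j F j < \prod_j G j.
Proof.
move=> h; case: n hn F G h => // m _ F G h.
by apply: ltr_prod => [|j _]; [apply/hasP; exists ord0; rewrite ?mem_index_enum|exact: h].
Qed.

Lemma blaschke_lt1 z : disk z -> cabs (b z) < 1.
Proof.
move=> hz; rewrite blaschkeE cabsM cabsV ltr_pdivrMr ?cabs_gt0 ?bden_neq0 //.
rewrite mul1r bnumE bdenE !cabs_prod; apply: prodr_lt => j.
by rewrite cabs_ge0 factor_le.
Qed.

Lemma hardy_oo_blaschke : hardy +oo%E b.
Proof.
apply/hardy_ooP; split; last by exists 1 => // z /blaschke_lt1 /ltW.
apply: (holomorphic_eq (f := fun z => bnum.[z] * (bden.[z])^-1)).
  by move=> z _; rewrite blaschkeE.
apply/holomorphic_cdiff => z hz; eexists.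
exact: cdiffM (cdiff_horner bnum z) (cdiffV (bden_neq0 hz) (cdiff_horner bden z)).
Qed.

(** Applied to the numerator and the denominator of the Blaschke product, this
    shows that every fibre polynomial has degree exactly n. *)
Lemma linear_prod (I : Type) (s : seq I) (u v : I -> R[i]) :
  let P := \prod_(i <- s) ((u i)%:P + (v i)%:P * 'X) in
  (size P <= (size s).+1)%N /\ P`_(size s) = \prod_(i <- s) v i.
Proof.
elim: s => [|i s [IH1 IH2]] /=.
  by rewrite !big_nil size_poly1 coef1.
rewrite !big_cons; set P := \prod_(j <- s) _ in IH1 IH2 *.
have sl : (size ((u i)%:P + (v i)%:P * 'X)%R <= 2)%N.
  apply: (leq_trans (size_polyD _ _)); rewrite geq_max.
  rewrite (leq_trans (size_polyC_leq1 _)) //=.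
  by rewrite mul_polyC (leq_trans (size_scale_leq _ _)) // size_polyX.
split.
  apply: (leq_trans (size_polyMleq _ _)); move: sl IH1.
  by set k1 := size _; set k2 := size P; lia.
have PS : P`_(size s).+1 = 0 by apply: nth_default.
rewrite mulrDl coefD coefCM PS mulr0 add0r -mulrA coefCM.
by rewrite coefXM /= IH2.
Qed.

(** Its roots are the points at which the Blaschke product takes the value b z,
    with multiplicity. *)
Definition fibre z : {poly R[i]} := bnum - (b z)%:P * bden.

(** The top coefficient of the denominator. *)
Definition ctop : C := \prod_(j < n) (- (a j)^*).

(** The leading coefficient of the fibre polynomial at z. *)
Definition ltop z : C := (-1) ^+ n - b z * ctop.

Lemma enum_size : size (index_enum ('I_n : finType)) = n.
Proof. by rewrite -[RHS]card_ord cardT enumT. Qed.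

Lemma ctop_lt1 : cabs ctop < 1.
Proof.
have : \prod_(j < n) cabs (- (a j)^*) < \prod_(j < n) (1 : R).
  by apply: (@prodr_lt _ (fun=> 1)) => j; rewrite cabs_ge0 cabsN cabs_conj ha.
by rewrite big1_eq -cabs_prod.
Qed.

Lemma ltop_neq0 z : disk z -> ltop z != 0.
Proof.
move=> hz; rewrite subr_eq0; apply/eqP => h.
have : cabs ((-1 : C) ^+ n) < 1.
  rewrite h cabsM; apply: le_lt_trans ctop_lt1.
  by rewrite ler_piMl ?cabs_ge0 // ltW // blaschke_lt1.
by rewrite cabsX cabsN cabs1 expr1n ltxx.
Qed.

Lemma fibre_coef z : (size (fibre z) <= n.+1)%N /\ (fibre z)`_n = ltop z.
Proof.
have [s1 c1] := linear_prod (index_enum ('I_n : finType)) (fun j => a j) (fun=> -1).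
have [s2 c2] := linear_prod (index_enum ('I_n : finType)) (fun=> 1) (fun j => - (a j)^*).
rewrite enum_size in s1 c1 s2 c2; rewrite /fibre; split.
  apply: (leq_trans (size_polyD _ _)); rewrite geq_max s1 size_polyN mul_polyC.
  exact: leq_trans (size_scale_leq _ _) s2.
by rewrite coefB coefCM c1 c2 prodr_const card_ord.
Qed.

Lemma fibre_lead z : disk z -> size (fibre z) = n.+1 /\ lead_coef (fibre z) = ltop z.
Proof.
move=> hz; have [s c] := fibre_coef z; have l := ltop_neq0 hz.
have E : size (fibre z) = n.+1.
  apply/eqP; rewrite eqn_leq s ltnNge; apply/negP => h.
  by move: l; rewrite -c nth_default ?eqxx.
by rewrite lead_coefE E.
Qed.

Lemma fibre_neq0 z : disk z -> fibre z != 0.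
Proof. by move=> hz; rewrite -size_poly_gt0 (fibre_lead hz).1. Qed.

Definition fibre_roots z : seq R[i] := sval (closed_field_poly_normal (fibre z)).

Lemma fibreE z : disk z -> fibre z = ltop z *: \prod_(x <- fibre_roots z) ('X - x%:P).
Proof.
move=> hz; rewrite -(fibre_lead hz).2.
exact: (svalP (closed_field_poly_normal (fibre z))).
Qed.

Lemma size_rs z : disk z -> size (fibre_roots z) = n.
Proof.
move=> hz; have [s _] := fibre_lead hz.
move: s; rewrite (fibreE hz) size_scale ?ltop_neq0 // size_prod_XsubC => -[].
by [].
Qed.

Lemma fibre_horner z x : (fibre z).[x] = bnum.[x] - b z * bden.[x].
Proof. by rewrite hornerD hornerN hornerM hornerC. Qed.

Lemma mem_rs z x : disk z -> (x \in fibre_roots z) = ((fibre z).[x] == 0).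
Proof.
move=> hz; rewrite (fibreE hz) hornerZ mulf_eq0 (negbTE (ltop_neq0 hz)) /=.
by rewrite -root_prod_XsubC.
Qed.

(** Off the disk the numerator dominates the denominator, so all n solutions of
    B x = B z lie in the disk. *)
Lemma rs_disk z x : disk z -> x \in fibre_roots z -> disk x /\ b x = b z.
Proof.
move=> hz; rewrite mem_rs // fibre_horner subr_eq0 => /eqP E.
have hx : disk x.
  apply: contrapT => nx.
  have L : cabs bden.[x] <= cabs bnum.[x].
    rewrite bnumE bdenE !cabs_prod; apply: ler_prod => j _.
    by rewrite cabs_ge0 factor_ge.
  have nz : 0 < cabs bnum.[x].
    rewrite cabs_gt0 bnumE; apply/prodf_neq0 => j _; rewrite subr_eq0.
    by apply/eqP => ax; apply: nx; rewrite -ax.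
  have b1 := blaschke_lt1 hz.
  have : cabs bnum.[x] < cabs bnum.[x]; last by rewrite ltxx.
  rewrite {1}E cabsM; apply: (@le_lt_trans _ _ (cabs (b z) * cabs bnum.[x])).
    by rewrite ler_wpM2l ?cabs_ge0.
  by rewrite gtr_pMl.
by split=> //; rewrite blaschkeE E mulfK // bden_neq0.
Qed.

Lemma rs_mem z x : disk z -> disk x -> b x = b z -> x \in fibre_roots z.
Proof.
move=> hz hx E; rewrite mem_rs // fibre_horner -E blaschkeE divfK ?subrr //.
exact: bden_neq0.
Qed.

Lemma rs_self z : disk z -> z \in fibre_roots z.
Proof. by move=> hz; exact: rs_mem. Qed.

Variable g : C -> C.
Hypothesis hg : hardy +oo%E g.
Local Notation W := (bpc b g).

Let hb := hardy_oo_blaschke.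

Lemma bpc_inv_ltop : W (fun z => (ltop z)^-1).
Proof.
pose c : C := (-1) ^+ n * ctop.
have s2 : (-1 : C) ^+ n * (-1) ^+ n = 1 by rewrite -exprMn mulrNN mulr1 expr1n.
have c1 : cabs c < 1 by rewrite cabsM cabsX cabsN cabs1 expr1n mul1r ctop_lt1.
apply: (@bpc_eq _ _ _ hb hg (fun z => (-1) ^+ n * (1 - c * b z)^-1)); last first.
  apply: (bpcM hb hg); first exact: bpc_cst.
  by apply: (bpc_inv_1sub hb hg c1) => z; exact: blaschke_lt1.
move=> z hz; have -> : ltop z = (-1) ^+ n * (1 - c * b z).
  by rewrite mulrBr mulr1 /c !mulrA s2 mul1r [ctop * _]mulrC.
by rewrite invfM invr_sign.
Qed.

(** The product of the values of a polynomial over a fibre is a rational function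
    of B: factor the polynomial and exchange the two products. *)
Lemma bpc_norm p : W (fun z => \prod_(x <- fibre_roots z) p.[x]).
Proof.
have [s hs] := closed_field_poly_normal p; set c := lead_coef p in hs.
apply: (@bpc_eq _ _ _ hb hg (fun z => c ^+ n * \prod_(y <- s)
    ((-1) ^+ n * ((bnum.[y] - b z * bden.[y]) * (ltop z)^-1)))); last first.
  apply: (bpcM hb hg); first exact: bpc_cst.
  apply: (bpc_prod hb hg) => y; apply: (bpcM hb hg); first exact: bpc_cst.
  apply: (bpcM hb hg); last exact: bpc_inv_ltop.
  apply: (@bpc_eq _ _ _ hb hg (fun z => bnum.[y] + b z * (- bden.[y]))).
    by move=> z _; rewrite mulrN.
  apply: (bpcD hb hg); first exact: bpc_cst.
  by apply: (bpcM hb hg); [exact: bpc_b|exact: bpc_cst].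
move=> z hz.
have -> : \prod_(x <- fibre_roots z) p.[x] = \prod_(x <- fibre_roots z) (c * \prod_(y <- s) (x - y)).
  apply: eq_bigr => x _; rewrite {1}hs hornerZ horner_prod; congr (_ * _).
  by apply: eq_bigr => y _; rewrite hornerXsubC.
have PC (k : C) (r : seq R[i]) : \prod_(x <- r) k = k ^+ size r.
  by rewrite big_const_seq count_predT iter_mulr mulr1.
rewrite [in RHS]big_split /= [X in _ = X * _]PC size_rs //; congr (_ * _).
rewrite exchange_big /=; apply: eq_bigr => y _.
have := fibre_horner z y; rewrite (fibreE hz) hornerZ horner_prod => <-.
rewrite [ltop z * _]mulrC mulfK ?ltop_neq0 //.
have -> : (-1) ^+ n = \prod_(x <- fibre_roots z) (-1 : C) by rewrite PC size_rs.
rewrite -big_split /=; apply: eq_bigr => x _.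
by rewrite hornerXsubC mulN1r opprB.
Qed.

(** A polynomial of degree n in T is determined by its values at n + 1 constants,
    so T may be replaced by the function g. *)
Lemma bpc_norm_sub q : W (fun z => \prod_(x <- fibre_roots z) (g z - q.[x])).
Proof.
pose t (i : nat) : R[i] := i%:R.
have tI : injective t.
  by move=> i j /eqP; rewrite /t eqr_nat => /eqP.
pose L (i : 'I_n.+1) : {poly R[i]} := tnth (n.+1.-lagrange t) i.
apply: (@bpc_eq _ _ _ hb hg (fun z => \sum_(i < n.+1)
   (\prod_(x <- fibre_roots z) ((t i)%:P - q).[x]) * (L i).[g z])); last first.
  apply: (bpc_sum hb hg) => i; apply: (bpcM hb hg); first exact: bpc_norm.
  by apply: (bpc_horner hb hg); exact: bpc_g.
move=> z hz; pose Q : {poly R[i]} := \prod_(x <- fibre_roots z) ('X - (q.[x])%:P).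
have sQ : (size Q <= n.+1)%N by rewrite size_prod_XsubC size_rs.
have QE y : Q.[y] = \prod_(x <- fibre_roots z) (y - q.[x]).
  by rewrite horner_prod; apply: eq_bigr => x _; rewrite hornerXsubC.
rewrite -QE {1}(lagrange_gen (ltn0Sn n) tI sQ) horner_sum.
apply: eq_bigr => i _; rewrite hornerM hornerC QE; congr (_ * _).
by apply: eq_bigr => x _; rewrite hornerD hornerN hornerC.
Qed.

Lemma cvg_prod_seq (s : seq R[i]) (F : nat -> R[i] -> C) (G : R[i] -> C) :
  (forall x, x \in s -> F m x @[m --> \oo] --> G x) ->
  (\prod_(x <- s) F m x : C) @[m --> \oo] --> (\prod_(x <- s) G x : C).
Proof.
elim: s => [|x s IH] h.
  have -> : (fun m => \prod_(x <- [::]) F m x : C) = fun=> 1.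
    by apply/funext => m; rewrite big_nil.
  by rewrite big_nil; exact: cvg_cst.
have -> : (fun m => \prod_(y <- x :: s) F m y : C) =
    fun m => F m x * \prod_(y <- s) F m y.
  by apply/funext => m; rewrite big_cons.
rewrite big_cons; apply: cvgM; first by apply: h; rewrite mem_head.
by apply: IH => y ys; apply: h; rewrite in_cons ys orbT.
Qed.

Lemma bounded_prod (s : seq R[i]) (F : R[i] -> C) (K : R) :
  (forall x, x \in s -> cabs (F x) <= K) ->
  cabs (\prod_(x <- s) F x) <= K ^+ size s.
Proof.
elim: s => [|x s IH] h; first by rewrite big_nil cabs1 expr0.
rewrite big_cons cabsM exprS; apply: ler_pM; rewrite ?cabs_ge0 //.
  by apply: h; rewrite mem_head.
by apply: IH => y ys; apply: h; rewrite in_cons ys orbT.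
Qed.

Lemma bpc_fibre_prod (u : C -> C) : hardy +oo%E u ->
  W (fun z => \prod_(x <- fibre_roots z) (g z - u x)).
Proof.
move=> hu; have [q [[M hM] ql]] := bp_polynomials hu.
have /hardy_ooP[_ [N N0 hN]] := hg.
apply: (bpc_lim hb hg (u := fun m z => \prod_(x <- fibre_roots z) (g z - (q m).[x]))).
  by move=> m; exact: bpc_norm_sub.
split.
  exists ((N + M) ^+ n) => m z hz; rewrite -(size_rs hz); apply: bounded_prod => x xs.
  have [hx _] := rs_disk hz xs.
  by apply: le_trans (cabsB _ _) _; apply: lerD; [exact: hN|exact: hM].
move=> z hz; apply: cvg_prod_seq => x xs; apply: cvgB; first exact: cvg_cst.
by apply: ql; have [] := rs_disk hz xs.
Qed.

(** The product of the numerators in the Gamma function, over the fibre of z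
    deprived of one occurrence of z. *)
Definition Delta z : C := \prod_(x <- rem z (fibre_roots z)) (g z - g x).

Lemma rs_split z (F : R[i] -> C) : disk z ->
  \prod_(x <- fibre_roots z) F x = F z * \prod_(x <- rem z (fibre_roots z)) F x.
Proof. by move=> hz; rewrite (perm_big _ (perm_to_rem (rs_self hz))) big_cons. Qed.

(** Perturbing g by a small multiple of p turns the vanishing factor of the
    product over the whole fibre into that multiple of p. *)
Theorem bpc_Delta p : W (fun z => p.[z] * Delta z).
Proof.
pose e (m : nat) : C := (m.+1%:R^-1 : R)%:C.
have e0 m : e m != 0 by rewrite -cabs_gt0 cabs_real gtr0_norm invr_gt0.
have hp : hardy +oo%E (fun z : C => p.[z]) by apply: hardy_oo_horner; exact: hardy_oo_id.
have /hardy_ooP[_ [M M0 hM]] := hg; have /hardy_ooP[_ [K K0 hK]] := hp.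
apply: (bpc_lim hb hg (u := fun m z =>
   p.[z] * \prod_(x <- rem z (fibre_roots z)) (g z - (g x - e m * p.[x])))).
  move=> m; have hu : hardy +oo%E (fun z => g z + (- e m) * p.[z]).
    by apply: hardy_ooD => //; apply: hardy_ooM => //; exact: hardy_oo_cst.
  apply: (@bpc_eq _ _ _ hb hg (fun z => (e m)^-1 *
      \prod_(x <- fibre_roots z) (g z - (g x + (- e m) * p.[x])))); last first.
    by apply: (bpcM hb hg); [exact: bpc_cst|exact: bpc_fibre_prod].
  move=> z hz; rewrite rs_split //.
  have -> : g z - (g z + - e m * p.[z]) = e m * p.[z] by set y := p.[z]; ring.
  rewrite !mulrA mulVf // mul1r; congr (_ * _); apply: eq_bigr => x _.
  by rewrite mulNr.
have srem z : disk z -> size (rem z (fibre_roots z)) = n.-1.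
  by move=> hz; rewrite size_rem ?rs_self // size_rs.
split.
  exists (K * (M + (M + K)) ^+ n.-1) => m z hz; rewrite cabsM -(srem z hz).
  apply: ler_pM; rewrite ?cabs_ge0 ?hK //; apply: bounded_prod => x /mem_rem xs.
  have [hx _] := rs_disk hz xs.
  apply: le_trans (cabsB _ _) _; apply: lerD; first exact: hM.
  apply: le_trans (cabsB _ _) _; apply: lerD; first exact: hM.
  rewrite cabsM cabs_real ger0_norm ?invr_ge0 //; apply: le_trans (hK x hx).
  by rewrite ler_piMl ?cabs_ge0 // invf_le1 // ler1n.
move=> z hz; apply: cvgM; first exact: cvg_cst.
apply: cvg_prod_seq => x /mem_rem xs; have [hx _] := rs_disk hz xs.
apply/cvg_seqC_P => d d0.
exists (Num.bound (K / d)) => m hm.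
have -> : g z - (g x - e m * p.[x]) - (g z - g x) = e m * p.[x].
  by set y := p.[x]; ring.
rewrite cabsM cabs_real ger0_norm ?invr_ge0 //.
apply: le_trans (ler_wpM2l _ (hK x hx)) _; first by rewrite invr_ge0.
rewrite mulrC ler_pdivrMr // mulrC -ler_pdivrMr //.
have := archi_boundP (ltW (divr_gt0 K0 d0)) => /ltW /le_trans; apply.
by rewrite ler_nat ltnW.
Qed.

End BlaschkeFibres.

(** * The Gamma function *)

Section GammaFunction.
Variable R : realType.
Local Notation C := (R[i]^o).
Variables (n : nat) (a : 'I_n -> C).
Hypotheses (hn : (0 < n)%N) (ha : forall j, disk (a j)).
Implicit Types (z w x : C) (p q : {poly R[i]}) (f g : C -> C).

Local Notation b := (blaschke a).
Local Notation num := (bnum a).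
Local Notation den := (bden a).

(** The numerator of the derivative of the Blaschke product. *)
Definition wronskian : {poly R[i]} := num^`() * den - num * den^`().

Lemma derive1_blaschke z : disk z -> derive1 b z = wronskian.[z] / den.[z] ^+ 2.
Proof.
move=> hz; apply: derive1_cdiff; have d0 := bden_neq0 ha hz.
have := cdiffM (cdiff_horner num z) (cdiffV d0 (cdiff_horner den z)).
have -> : (fun w : C => num.[w] * den.[w]^-1) = b.
  by apply/funext => w; rewrite -blaschkeE.
rewrite (_ : _ + _ = wronskian.[z] / den.[z] ^+ 2) //.
rewrite /wronskian hornerD hornerN !hornerM.
set A := num.[z]; set A' := num^`().[z]; set D := den.[z] in d0 *; set D' := den^`().[z].
by field.
Qed.

Lemma derive1_blaschke_neq0 z : disk z ->
  (derive1 b z != 0) = (wronskian.[z] != 0).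
Proof.
move=> hz; rewrite derive1_blaschke // mulf_eq0 invr_eq0 expf_eq0 /=.
by rewrite (negbTE (bden_neq0 ha hz)) orbF.
Qed.

(** A zero of order m of the numerator, at which the denominator does not vanish,
    is a zero of order m - 1 of the Wronskian. *)
Lemma wronskian_neq0 : wronskian != 0.
Proof.
have [j _] : exists j : 'I_n, True by exists (Ordinal hn).
have [m [q]] := multiplicity_XsubC num (a j).
have A0 : num.[a j] = 0 by rewrite bnumE (bigD1 j) //= subrr mul0r.
have D0 : den.[a j] != 0 := bden_neq0 ha (ha j).
have N0 : num != 0.
  apply/eqP => N0; have [x /eqP] : exists x : C, num.[x] != 0.
    exists 2; rewrite bnumE; apply/prodf_neq0 => k _; rewrite subr_eq0.
    apply/eqP => a2; have := ha k; rewrite a2 /disk /= -(rmorph_nat (real_complex R)).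
    by rewrite cabs_real normr_nat => h; have := lt_trans h (ltr1n R 2); rewrite ltxx.
  by apply; rewrite N0 horner0.
rewrite N0 /= => qr E.
have m0 : (0 < m)%N.
  case: m E => // E; move: A0; rewrite E expr0 mulr1 => /eqP.
  by rewrite -[_ == 0]/(root q (a j)) (negbTE qr).
case: m m0 E => // m _ E; apply/eqP => W0.
have F : wronskian = ('X - (a j)%:P) ^+ m *
   (q * den *+ m.+1 + ('X - (a j)%:P) * (q^`() * den - q * den^`())).
  rewrite /wronskian E derivM deriv_exp derivXsubC mul1r /= exprS -mulr_natr.
  rewrite -[in RHS]mulr_natr; set X := ('X - _); set Y := X ^+ m; set k := _%:R; ring.
have XN : ('X - (a j)%:P) ^+ m != 0 by rewrite expf_neq0 // polyXsubC_eq0.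
move/eqP: W0; rewrite F mulf_eq0 (negbTE XN) /= => /eqP/(congr1 (fun p => p.[a j])).
rewrite horner0 hornerD hornerM hornerXsubC subrr mul0r addr0 hornerMn hornerM.
move=> /eqP; rewrite mulrn_eq0 /= mulf_eq0 (negbTE D0) orbF.
by rewrite -[_ == 0]/(root q (a j)) (negbTE qr).
Qed.

(** Critical points are isolated, being zeros of a non-zero polynomial. *)
Lemma near_regular z : disk z -> exists2 r : R, 0 < r &
  forall w, w != z -> cabs (w - z) < r -> disk w /\ derive1 b w != 0.
Proof.
move=> hz; have [r1 r10 h1] := disk_ball hz.
have [m [q]] := multiplicity_XsubC wronskian z.
rewrite wronskian_neq0 /= => qr E.
have qz : 0 < cabs (q.[z] : C) by rewrite cabs_gt0.
have q2 : 0 < cabs (q.[z] : C) / 2 by rewrite divr_gt0.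
have [r2 r20 h2] := cdiff_continuous (cdiff_horner q z) q2.
exists (Num.min r1 r2); first by rewrite lt_min r10.
move=> w wz; rewrite lt_min => /andP[/h1 hw /h2 hq]; split=> //.
rewrite derive1_blaschke_neq0 // E hornerM horner_exp hornerXsubC.
rewrite mulf_neq0 ?expf_neq0 ?subr_eq0 //; apply/eqP => qw.
by move: hq; rewrite qw sub0r cabsN; lra.
Qed.

Lemma simple_root z : disk z -> derive1 b z != 0 -> z \notin rem z (fibre_roots a z).
Proof.
move=> hz; rewrite derive1_blaschke_neq0 //; apply: contra => zr.
have E : fibre a z = ltop a z *: (('X - z%:P) * (('X - z%:P) *
    \prod_(x <- rem z (rem z (fibre_roots a z))) ('X - x%:P))).
  rewrite (fibreE hn ha hz) (perm_big _ (perm_to_rem (rs_self hn ha hz))) big_cons.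
  by rewrite (perm_big _ (perm_to_rem zr)) big_cons.
have : (fibre a z)^`().[z] = 0.
  have [X XE X0] : exists2 X : {poly R[i]}, X = 'X - z%:P & X.[z] = 0.
    by exists ('X - z%:P) => //; rewrite hornerXsubC subrr.
  rewrite E -XE derivZ hornerZ !derivM !(hornerD, hornerM) X0.
  by rewrite !(mul0r, mulr0, addr0).
rewrite /fibre derivB derivM derivC mul0r add0r hornerD hornerN hornerM hornerC.
move=> /eqP; rewrite subr_eq0 => /eqP nz.
rewrite /wronskian hornerD hornerN !hornerM nz blaschkeE.
have d0 := bden_neq0 ha hz; apply/eqP.
set A := num.[z]; set D := den.[z] in d0 *; set D' := den^`().[z].
by field.
Qed.

Lemma other_preimagesE z : disk z ->
  other_preimages b z = [set` [seq x <- fibre_roots a z | x != z]].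
Proof.
move=> hz; apply/seteqP; split=> x /=; rewrite mem_filter.
  move=> [hx bx xz]; apply/andP; split; first exact/eqP.
  exact: (rs_mem hn ha).
by move=> /andP[/eqP xz /(rs_disk hn ha hz)[hx bx]].
Qed.

Lemma finite_preimages z : disk z -> finite_set (other_preimages b z).
Proof. by move=> hz; rewrite other_preimagesE //; exact: finite_seq. Qed.

(** The order of w as a root of its fibre polynomial witnesses that the
    multiplicity is not the default value of the choice operator. *)
Lemma value_mult_gt0 w : disk w -> (0 < value_mult b w)%N.
Proof.
move=> hw; rewrite /value_mult; set S := [set k | _].
have [k Sk] : exists k, S k.
  have [m [q]] := multiplicity_XsubC (fibre a w) w.
  rewrite (fibre_neq0 hn ha hw) /= => qr E; exists m.
  exists (fun x => q.[x] * (den.[x])^-1); split.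
  - apply/holomorphic_cdiff => x hx; eexists.
    exact: cdiffM (cdiff_horner q x) (cdiffV (bden_neq0 ha hx) (cdiff_horner den x)).
  - by rewrite mulf_neq0 // invr_eq0 bden_neq0.
  move=> x hx; have d0 := bden_neq0 ha hx.
  have := fibre_horner a w x; rewrite E hornerM horner_exp hornerXsubC => h.
  by rewrite mulrA [_ ^+ m * _]mulrC h mulrBl -blaschkeE mulfK.
have := @xgetPex _ 0%N S (ex_intro _ k Sk); case: (xget 0%N S) => // -[u [_ uw h]].
by have := h w hw; rewrite subrr expr0 mul1r => E; rewrite -E eqxx in uw.
Qed.

Lemma Gamma_regular_neq0 f z w : disk z -> Gamma_regular b f z != 0 ->
  other_preimages b z w -> f z != f w.
Proof.
move=> hz; have fin := finite_preimages hz.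
rewrite /Gamma_regular fsbig_finite // prodf_seq_neq0 => /allP h hw.
have /h /= : w \in finmap.enum_fset (fset_set (other_preimages b z)).
  by have := in_fset_set fin w; rewrite (mem_set hw).
rewrite expf_eq0 negb_and => /orP[|]; last first.
  by rewrite mulf_eq0 negb_or subr_eq0 => /andP[].
by have [dw _ _] := hw; rewrite value_mult_gt0.
Qed.

Lemma Gamma_regular_eq0 f z : disk z -> Gamma_regular b f z = 0 ->
  exists w, [/\ disk w, b w = b z, w != z & f w = f z].
Proof.
move=> hz; have fin := finite_preimages hz.
rewrite /Gamma_regular fsbig_finite // => /eqP.
rewrite prodf_seq_eq0 => /hasP[w wA] /=.
have [dw bw wz] : other_preimages b z w by apply: set_mem; rewrite -(in_fset_set fin).
rewrite expf_eq0 => /andP[_]; rewrite mulf_eq0 invr_eq0 => /orP[|]; rewrite subr_eq0.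
  by move=> /eqP E; exists w; split=> //; exact/eqP.
by move=> /eqP E; case: wz.
Qed.

Lemma Gamma_noncritical f z : derive1 b z != 0 -> Gamma b f z = Gamma_regular b f z.
Proof. by move=> bz; rewrite /Gamma bz. Qed.

Lemma Gamma_critical f z : derive1 b z = 0 ->
  Gamma b f z = lim (Gamma_regular b f w @[w --> z^']).
Proof. by move=> bz; rewrite /Gamma bz eqxx. Qed.

(** At a critical point the value is a limit, so it can be non-zero only if
    nearby regular values are. *)
Lemma Gamma_neq0 f z : disk z -> Gamma b f z != 0 ->
  exists w, [/\ disk w, derive1 b w != 0 & Gamma_regular b f w != 0].
Proof.
move=> hz.
have [bz|bz] : derive1 b z != 0 \/ derive1 b z = 0.
  by case: (eqVneq (derive1 b z) 0); [right|left].
- rewrite Gamma_noncritical // => G0.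
  by exists z; split; [exact: hz|exact: bz|exact: G0].
rewrite (Gamma_critical f bz) => G0.
apply: contrapT => nw; move/eqP: G0; apply; apply/cvg_lim.
  exact: norm_hausdorff.
have [r r0 hr] := near_regular hz.
move=> P /nbhsC_P[e e0 he]; apply/nbhs_dnbhsC_P; exists r => // w wz wr.
have [hw bw] := hr w wz wr; apply: he.
have -> : Gamma_regular b f w = 0.
  by apply: contrapT => /eqP gw; apply: nw; exists w.
by rewrite subrr cabs0.
Qed.

Lemma Delta_neq0 g z : disk z -> derive1 b z != 0 -> Gamma_regular b g z != 0 ->
  Delta a g z != 0.
Proof.
move=> hz bz gz; rewrite /Delta prodf_seq_neq0; apply/allP => x xr /=.
have [hx bx] := rs_disk hn ha hz (mem_rem xr).
rewrite subr_eq0; apply: Gamma_regular_neq0 => //; split=> // xz.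
by have := simple_root hz bz; rewrite -{1}xz xr.
Qed.

(** Point evaluations are continuous for the Hardy norm and for bounded pointwise
    convergence, so an equality of values passes to the closure. *)
Lemma closure_agree g (p : \bar R) f z w : hardy +oo%E g -> (0 < p)%E ->
  disk z -> disk w -> b z = b w -> g z = g w ->
  hardy_closure p (poly_algebra b g) f -> f z = f w.
Proof.
move=> hg p0 hz hw bzw gzw; have hb := hardy_oo_blaschke hn ha.
have agree h : poly_algebra b g h -> h z = h w.
  by move=> [P ->]; rewrite bzw gzw.
case: p p0 => [q| |] // p0 hf.
  have q0 : 0 < q by rewrite -lte_fin.
  have hA h : poly_algebra b g h -> holomorphic h.
    by move=> /(algebra_hardy hb hg)/hardy_ooP[].
  have [hq _] := hf; have [fh _] := hq.
  have /(hardy_closureP q0 hA hq) H := hf.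
  apply/eqP; rewrite -subr_eq0 -cabs_eq0 eq_le cabs_ge0 andbT.
  apply/ler_addgt0Pr => e e0; rewrite add0r; have e2 : 0 < e / 2 by rewrite divr_gt0.
  have [d1 d10 k1] := point_evaluation q0 hz e2.
  have [d2 d20 k2] := point_evaluation q0 hw e2.
  have d0 : 0 < Num.min d1 d2 by rewrite lt_min d10.
  have [h Ah hh] := H _ d0.
  have hfh := holomorphicB fh (hA _ Ah).
  have -> : f z - f w = (f z - h z) - (f w - h w) by rewrite (agree _ Ah); ring.
  apply: le_trans (cabsB _ _) _; rewrite [e]splitr; apply: lerD.
    by apply: (k1 _ hfh) => r hr; apply: le_trans (hh r hr) _; rewrite ge_min lexx.
  by apply: (k2 _ hfh) => r hr; apply: le_trans (hh r hr) _; rewrite ge_min lexx orbT.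
suff [] : [set h | hardy +oo%E h /\ h z = h w] f by [].
apply: smallest_sub hf; last first.
  by move=> h Ah; split; [exact: (algebra_hardy hb hg)|exact: agree].
split; first by move=> h [].
move=> u h hu hh [_ hl]; split=> //.
have := hl z hz; have -> : (fun k => u k z) = fun k => u k w.
  by apply/funext => k; have [] := hu k.
by move=> h1; apply: cvg_unique h1 (hl w hw); exact: norm_hausdorff.
Qed.

Lemma bpc_hardy_closure g (p : \bar R) f : hardy +oo%E g -> (0 < p)%E ->
  bpc b g f -> hardy p f /\ hardy_closure p (poly_algebra b g) f.
Proof.
move=> hg; have hb := hardy_oo_blaschke hn ha.
case: p => [q| |] // p0 hf; last by split=> //; exact: (bpc_hardy hb hg).
have q0 : 0 < q by rewrite -lte_fin.
split; first by apply: hardy_oo_sub => //; exact: (bpc_hardy hb hg).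
apply: bp_closure_sub => //.
- exact: (algebra_hardy hb hg).
- exact: algebra_cst.
- by move=> *; exact: algebraD.
- by move=> *; apply: algebraM => //; exact: algebra_cst.
Qed.

End GammaFunction.

(** * Invariant subspaces and the Gamma function *)

Theorem mainTheorem4 (R : realType) (n : nat) (hn : (2 <= n)%N)
    (a : 'I_n -> R[i]^o) (ha : forall j, disk (a j))
    (g : R[i]^o -> R[i]^o) (hg : hardy +oo%E g)
    (p : \bar R) (hp : (0 < p)%E) :
  (forall z : R[i]^o, disk z -> Gamma (blaschke a) g z = 0) <->
  ~ (exists M : set (R[i]^o -> R[i]^o),
       [/\ z_invariant_subspace p M, nontrivial M &
           M `<=` hardy_closure p (poly_algebra (blaschke a) g)]).
Proof.
have n0 : (0 < n)%N by exact: ltnW.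
split=> [G0 [M [[Mp M0 MD MZ Mz] [f Mf [z0 hz0 fz0]] Mcl]]|nM z hz].
(* f and z f agree at z and at a second point of its fibre, so f vanishes at
   every regular z, and the regular points are dense *)
- have fh : holomorphic f by have [] := Mp f Mf.
  have reg z : disk z -> derive1 (blaschke a) z != 0 -> f z = 0.
    move=> hz bz; have := G0 z hz; rewrite Gamma_noncritical // => Gz.
    have [w [hw bw wz gw]] := Gamma_regular_eq0 n0 ha hz Gz.
    have A h : M h -> h z = h w.
      by move=> /Mcl; exact: (closure_agree n0 ha hg hp hz hw).
    have E1 := A f Mf; have := A _ (Mz f Mf); rewrite -E1 => /eqP.
    rewrite -subr_eq0 -mulrBl mulf_eq0 subr_eq0 eq_sym (negbTE wz) /=.
    by move=> /eqP.
  have f2 : 0 < cabs (f z0) / 2 by rewrite divr_gt0 // cabs_gt0.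
  have [r1 r10 h1] := holomorphic_dcontinuous fh hz0 f2.
  have [r2 r20 h2] := near_regular n0 ha hz0.
  pose r := Num.min r1 r2; have r0 : 0 < r by rewrite lt_min r10.
  pose w : R[i]^o := z0 + (r / 2)%:C.
  have wE : w - z0 = (r / 2)%:C by rewrite /w addrC addKr.
  have cw : cabs (w - z0) = r / 2.
    by rewrite wE cabs_real ger0_norm // divr_ge0 // ltW.
  have : cabs (w - z0) < r by rewrite cw ltr_pdivrMr // ltr_pMr // ltr1n.
  rewrite lt_min => /andP[w1 w2].
  have wz : w != z0 by rewrite -subr_eq0 -cabs_gt0 cw divr_gt0.
  have [hw bw] := h2 w wz w2.
  have := h1 w w1; rewrite (reg w hw bw) sub0r cabsN leNgt => /negP; apply.
  by rewrite ltr_pdivrMr // ltr_pMr ?cabs_gt0 // ltr1n.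
apply: contrapT => /eqP Gz; apply: nM.
have [w [hw bw Gw]] := Gamma_neq0 n0 ha hz Gz.
have Dw := Delta_neq0 n0 ha hw bw Gw.
(* the multiples of Delta by polynomials form the invariant subspace *)
pose F (q : {poly R[i]}) (z : R[i]^o) : R[i]^o := q.[z] * Delta a g z.
have FP q := bpc_hardy_closure n0 ha hg hp (bpc_Delta n0 ha hg q).
exists (range F); split.
- split.
  + by move=> _ [q _ <-]; have [] := FP q.
  + by exists 0 => //; apply/funext => x; rewrite /F horner0 mul0r.
  + move=> _ _ [q1 _ <-] [q2 _ <-]; exists (q1 + q2) => //.
    by apply/funext => x; rewrite /F hornerD mulrDl.
  + move=> c _ [q _ <-]; exists (c%:P * q) => //.
    by apply/funext => x; rewrite /F hornerM hornerC mulrA.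
  + move=> _ [q _ <-]; exists ('X * q) => //.
    by apply/funext => x; rewrite /F hornerM hornerX mulrA.
- exists (F 1); first by exists 1.
  by exists w => //; rewrite /F hornerC mul1r.
- by move=> _ [q _ <-]; have [] := FP q.
Qed.
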